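(* Let $(M,\varphi,\xi_\alpha,\eta^\alpha,g)$ be a Lorentzian $\mathcal{S}$-manifold with $\dim(M)=(4m+2)+s$, $s\geqslant1$, where $\dim(\mathrm{Im}(\varphi))=4m+2$ and $\xi_1$ denotes the timelike characteristic vector field. If $M$ is $\varphi$-null Osserman at $p\in M$, then for all $u\in N_\varphi((\xi_1)_p)$ only one of the following two cases can occur: (i) $\bar R_u^\varphi$ admits exactly one eigenvalue $c$, with multiplicity $4m+1$; (ii) $\bar R_u^\varphi$ admits exactly two eigenvalues $c_1$ and $c_2$, with multiplicities $1$ and $4m$ respectively.
   Context: All manifolds are smooth and connected. Globally framed $f$-manifolds. A globally framed $f$-manifold ($g.f.f$-manifold) $(M,\varphi,\xi_\alpha,\eta^\alpha)$, $\alpha\in\{1,\dots,s\}$, $s\ge 1$, $\dim M=2n+s$, is a manifold with a non-vanishing $(1,1)$-tensor field $\varphi$ of constant rank $2n$, vector fields $\xi_1,\dots,\xi_s$ and $1$-forms $\eta^1,\dots,\eta^s$ such that $\varphi^2=-I+\sum_{\alpha}\eta^\alpha\otimes\xi_\alpha$ and $\eta^\alpha(\xi_\beta)=\delta^\alpha_\beta$ (so $\varphi^3+\varphi=0$, $\varphi\xi_\alpha=0$, $\eta^\alpha\circ\varphi=0$, and $T_pM=\mathrm{Im}(\varphi_p)\oplus\mathrm{span}((\xi_1)_p,\dots,(\xi_s)_p)$). The $\xi_\alpha$ are the characteristic vector fields. It is normal if $[\varphi,\varphi]+2\sum_\alpha d\eta^\alpha\otimes\xi_\alpha=0$, where $[\varphi,\varphi](X,Y)=\varphi^2[X,Y]+[\varphi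 X,\varphi Y]-\varphi[\varphi X,Y]-\varphi[X,\varphi Y]$ and $2d\eta(X,Y)=X(\eta(Y))-Y(\eta(X))-\eta([X,Y])$. An indefinite metric $g$ is compatible if $g(\varphi X,\varphi Y)=g(X,Y)-\sum_\alpha\varepsilon_\alpha\eta^\alpha(X)\eta^\alpha(Y)$, where $\varepsilon_\alpha=g(\xi_\alpha,\xi_\alpha)=\pm1$; then $(M,\varphi,\xi_\alpha,\eta^\alpha,g)$ is an indefinite metric $g.f.f$-manifold. It is an indefinite $\mathcal{S}$-manifold if it is normal and $d\eta^\alpha=\Phi$ for every $\alpha$, where $\Phi(X,Y)=g(X,\varphi Y)$. It is Lorentzian if $g$ is Lorentzian (exactly one minus sign); then exactly one of the $\xi_\alpha$ is timelike, and it is always labelled $\xi_1$ (so $\varepsilon_1=-1$, $\varepsilon_\alpha=1$ for $\alpha\ge2$). Curvature convention: $R(Z,W)=[\nabla_Z,\nabla_W]-\nabla_{[Z,W]}$, $\nabla$ the Levi-Civita connection. Null Jacobi operators. For a lightlike $u\in T_pM$ ($u\ne0$, $g_p(u,u)=0$), let $\bar u^\bot=u^\bot/\mathrm{span}(u)$ with projection $\pi\colon u^\bot\to\bar u^\bot$ and the positive definite inner product $\bar g(\pi(x),\pi(y))=g_p(x,y)$. The Jacobi operator $\bar R_u\colon\bar u^\bot\to\bar u^\bot$ is $\bar R_u(\pi(x))=\pi(R_p(x,u)u)$; it is self-adjoint. $\varphi$-celestial sphere: $S_\varphi((\xi_1)_p)=\{x\in\mathrm{Im}(\varphi_p): g_p(x,x)=1\}$.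 $\varphi$-null congruence set: $N_\varphi((\xi_1)_p)=\{(\xi_1)_p+x : x\in S_\varphi((\xi_1)_p)\}$. $M$ is $\varphi$-null Osserman at $p$ (i.e. with respect to $(\xi_1)_p$) if the eigenvalues of $\bar R_u$ and their multiplicities are independent of $u\in N_\varphi((\xi_1)_p)$. The operator $\bar R_u^\varphi$. For $u=(\xi_1)_p+x\in N_\varphi((\xi_1)_p)$ put $V=x^\bot\cap\mathrm{Im}(\varphi_p)$. The subspace $W=V\oplus\mathrm{span}((\xi_2)_p,\dots,(\xi_s)_p)$ ($W=V$ if $s=1$) satisfies $u^\bot=\mathrm{span}(u)\oplus W$, and $\pi|_W$ is an isometry $W\cong\bar u^\bot$, by which $\bar u^\bot$ is identified with $W$. Under this identification $\bar R_u$ leaves $V$ invariant, and $\bar R_u^\varphi$ denotes the restriction of $\bar R_u$ to $V$, regarded as an endomorphism of $V$ (of dimension $\dim\mathrm{Im}(\varphi_p)-1$). *)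

(* Defs.v *)
From HB Require Import structures.
From mathcomp Require Import all_boot all_order all_algebra.
From mathcomp Require Import all_classical all_reals all_analysis.
Import Order.TTheory GRing.Theory Num.Theory.
Import numFieldNormedType.Exports.

Set Implicit Arguments.
Unset Strict Implicit.
Unset Printing Implicit Defensive.

Local Open Scope classical_set_scope.
Local Open Scope ring_scope.

(** * Smooth manifolds *)

Section Smooth.
Context {R : realType} {N : nat}.

(* f is of class C^k on the open set U: all iterated partial derivatives of
   order at most k exist and are continuous on U. *)
Fixpoint Ck_on (k : nat) (U : set 'rV[R]_N) (f : 'rV[R]_N -> R) : Prop :=
  (forall x, U x -> {for x, continuous f}) /\
  (if k is k'.+1 then
     forall i : 'I_N,
       (forall x, U x -> derivable f x (delta_mx 0 i)) /\
       Ck_on k' U ('D_(delta_mx 0 i) f)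
   else True).

Definition smooth_on (U : set 'rV[R]_N) (f : 'rV[R]_N -> R) : Prop :=
  forall k, Ck_on k U f.

End Smooth.

(* A homeomorphism cmap, with inverse cinv, from the open set cdom onto an open
   subset of R^N; both maps are extended by junk outside of their domains. *)
Record chart (R : realType) (N : nat) (M : topologicalType) := Chart {
  cdom : set M;
  cmap : M -> 'rV[R]_N;
  cinv : 'rV[R]_N -> M;
  cdom_open : open cdom;
  cimg_open : open (cmap @` cdom);
  cmapK : forall q, cdom q -> cinv (cmap q) = q;
  cmap_continuous : forall q, cdom q -> {for q, continuous cmap};
  cinv_continuous : forall x, (cmap @` cdom) x -> {for x, continuous cinv}
}.

(* Smooth connected manifold of dimension N, without boundary. [chart_at] only
   selects, for each point, a chart of the atlas around that point; it is used
   below to represent tangent vectors. *)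
Record manifold (R : realType) (N : nat) := Manifold {
  mcarrier :> topologicalType;
  atlas : set (chart R N mcarrier);
  chart_at : mcarrier -> chart R N mcarrier;
  chart_at_atlas : forall p, atlas (chart_at p);
  chart_at_dom : forall p, cdom (chart_at p) p;
  atlas_compat : forall c d, atlas c -> atlas d -> forall i : 'I_N,
    smooth_on (cmap c @` (cdom c `&` cdom d))
              (fun x => cmap d (cinv c x) 0 i);
  manifold_hausdorff : hausdorff_space mcarrier;
  manifold_second_countable : @second_countable mcarrier;
  manifold_connected : connected [set: mcarrier]
}.

(** * Tensor fields

   The tangent space T_pM is represented by 'rV[R]_N, a vector being given by
   its components in the chart [chart_at p].  At a point p:
   - an endomorphism is a matrix F acting by v |-> v *m F, so that its image is
     the row space of F;
   - a 1-form is a column w, with value v *m w on v;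
   - a bilinear form is a matrix G, with value v *m G *m w^T on (v, w).
   Components in the charts chart_at p need not vary continuously with p, so
   smoothness of fields is expressed in each fixed chart of the atlas. *)

Section Fields.
Context {R : realType} {N : nat} (M : manifold R N).

Definition vfield := M -> 'rV[R]_N.
Definition endofield := M -> 'M[R]_N.
Definition oneform := M -> 'cV[R]_N.
Definition bilfield := M -> 'M[R]_N.

(* The components in the chart c of the tangent vector v at q. *)
Definition tcoord (c : chart R N M) (q : M) (v : 'rV[R]_N) : 'rV[R]_N :=
  'D_v (cmap c \o cinv (chart_at q)) (cmap (chart_at q) q).

(* The tangent vector at q whose components in the chart c are v.  As q varies
   in cdom c, this is the coordinate vector field sum_i v_i d/dx_i. *)
Definition tvec (c : chart R N M) (v : 'rV[R]_N) : vfield :=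
  fun q => 'D_v (cmap (chart_at q) \o cinv c) (cmap c q).

Definition smooth_in (U : set M) (c : chart R N M) (f : M -> R) : Prop :=
  smooth_on (cmap c @` (cdom c `&` U)) (f \o cinv c).

Definition smooth_fun (U : set M) (f : M -> R) : Prop :=
  forall c, @atlas R N M c -> smooth_in U c f.

Definition smooth_vfield (U : set M) (X : vfield) : Prop :=
  forall c, @atlas R N M c -> forall i,
    smooth_in U c (fun q => tcoord c q (X q) 0 i).

(* tvec c (delta_mx 0 i) is the i-th coordinate field of c: the next three
   definitions say that the components in c are smooth. *)
Definition smooth_endofield (F : endofield) : Prop :=
  forall c, @atlas R N M c -> forall i j,
    smooth_in setT c
      (fun q => tcoord c q (tvec c (delta_mx 0 i) q *m F q) 0 j).

Definition smooth_form (w : oneform) : Prop :=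
  forall c, @atlas R N M c -> forall i,
    smooth_in setT c (fun q => (tvec c (delta_mx 0 i) q *m w q) 0 0).

Definition smooth_bilfield (G : bilfield) : Prop :=
  forall c, @atlas R N M c -> forall i j,
    smooth_in setT c
      (fun q => (tvec c (delta_mx 0 i) q *m G q
                 *m (tvec c (delta_mx 0 j) q)^T) 0 0).

Definition eapp (F : endofield) (X : vfield) : vfield := fun q => X q *m F q.

Definition fapp (w : oneform) (X : vfield) : M -> R :=
  fun q => (X q *m w q) 0 0.

Definition bapp (G : bilfield) (X Y : vfield) : M -> R :=
  fun q => (X q *m G q *m (Y q)^T) 0 0.

(* The function X(f). *)
Definition vder (X : vfield) (f : M -> R) : M -> R :=
  fun q => 'D_(X q) (f \o cinv (chart_at q)) (cmap (chart_at q) q).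

(* The Lie bracket, [X, Y]^k = sum_i (X^i d_i Y^k - Y^i d_i X^k) in the
   coordinates of chart_at q. *)
Definition vlocal (c : chart R N M) (X : vfield) : 'rV[R]_N -> 'rV[R]_N :=
  fun x => tcoord c (cinv c x) (X (cinv c x)).

Definition bracket (X Y : vfield) : vfield :=
  fun q => let c := chart_at q in
    'D_(X q) (vlocal c Y) (cmap c q) - 'D_(Y q) (vlocal c X) (cmap c q).

(* 2 dw(X, Y) = X(w(Y)) - Y(w(X)) - w([X, Y]). *)
Definition ext_der (w : oneform) (X Y : vfield) : M -> R :=
  fun q => 2^-1 * (vder X (fapp w Y) q - vder Y (fapp w X) q
                   - fapp w (bracket X Y) q).

Definition nijenhuis (F : endofield) (X Y : vfield) : vfield :=
  fun q => eapp F (eapp F (bracket X Y)) q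
           + bracket (eapp F X) (eapp F Y) q
           - eapp F (bracket (eapp F X) Y) q
           - eapp F (bracket X (eapp F Y)) q.

(** * Levi-Civita connection and curvature *)

(* The Levi-Civita connection of g, acting on vector fields defined on
   arbitrary open subsets U of M; the values of fields outside of U are
   irrelevant. *)
Record levi_civita (g : bilfield) (nabla : vfield -> vfield -> vfield) : Prop :=
  LeviCivita {
  lc_smooth : forall U X Y, open U ->
    smooth_vfield U X -> smooth_vfield U Y -> smooth_vfield U (nabla X Y);
  lc_addl : forall U X X' Y, open U ->
    smooth_vfield U X -> smooth_vfield U X' -> smooth_vfield U Y ->
    forall q, U q ->
    nabla (fun r => X r + X' r) Y q = nabla X Y q + nabla X' Y q;
  lc_scalel : forall U f X Y, open U ->
    smooth_fun U f -> smooth_vfield U X -> smooth_vfield U Y ->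
    forall q, U q -> nabla (fun r => f r *: X r) Y q = f q *: nabla X Y q;
  lc_addr : forall U X Y Y', open U ->
    smooth_vfield U X -> smooth_vfield U Y -> smooth_vfield U Y' ->
    forall q, U q ->
    nabla X (fun r => Y r + Y' r) q = nabla X Y q + nabla X Y' q;
  lc_leibniz : forall U f X Y, open U ->
    smooth_fun U f -> smooth_vfield U X -> smooth_vfield U Y ->
    forall q, U q ->
    nabla X (fun r => f r *: Y r) q = vder X f q *: Y q + f q *: nabla X Y q;
  lc_torsion_free : forall U X Y, open U ->
    smooth_vfield U X -> smooth_vfield U Y ->
    forall q, U q -> nabla X Y q - nabla Y X q = bracket X Y q;
  lc_metric : forall U X Y Z, open U ->
    smooth_vfield U X -> smooth_vfield U Y -> smooth_vfield U Z ->
    forall q, U q ->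
    vder X (bapp g Y Z) q = bapp g (nabla X Y) Z q + bapp g Y (nabla X Z) q
}.

Definition curvature (nabla : vfield -> vfield -> vfield) (Z W X : vfield)
    : vfield :=
  fun q => nabla Z (nabla W X) q - nabla W (nabla Z X) q
           - nabla (bracket Z W) X q.

(* R_p(x, y)z.  The curvature is a tensor, so that the choice of local
   extensions of x, y, z to vector fields does not matter; coordinate vector
   fields of chart_at p are used. *)
Definition curvature_at (nabla : vfield -> vfield -> vfield) (p : M)
    (x y z : 'rV[R]_N) : 'rV[R]_N :=
  let e := tvec (chart_at p) in curvature nabla (e x) (e y) (e z) p.

(* The endomorphism x |-> R_p(x, u)u of T_pM. *)
Definition jacobi (nabla : vfield -> vfield -> vfield) (p : M) (u : 'rV[R]_N)
    : 'M[R]_N :=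
  lin1_mx (fun x => curvature_at nabla p x u u).

(** * Lorentzian S-manifolds *)

(* G is symmetric, non-degenerate, with exactly one minus sign. *)
Definition lorentzian (G : 'M[R]_N) : Prop :=
  G^T = G /\
  exists2 P : 'M[R]_N, P \in unitmx &
    P *m G *m P^T = diag_mx (\row_(i < N) if val i == 0%N then -1 else 1).

Section GFF.
Context {s : nat}.
Variables (phi : endofield) (xi : 'I_s -> vfield) (eta : 'I_s -> oneform).

Record is_gff : Prop := IsGFF {
  gff_s_gt0 : (0 < s)%N;
  gff_phi_smooth : smooth_endofield phi;
  gff_xi_smooth : forall a, smooth_vfield setT (xi a);
  gff_eta_smooth : forall a, smooth_form (eta a);
  gff_rank : exists n, [/\ (0 < n)%N, N = (2 * n + s)%N &
    forall q, \rank (phi q) = (2 * n)%N];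
  gff_phi2 : forall q,
    phi q *m phi q = - 1%:M + \sum_(a < s) eta a q *m xi a q;
  gff_dual : forall q a b, fapp (eta a) (xi b) q = (a == b)%:R
}.

Definition normal : Prop :=
  forall U X Y, open U -> smooth_vfield U X -> smooth_vfield U Y ->
  forall q, U q ->
    nijenhuis phi X Y q
    + 2 *: \sum_(a < s) ext_der (eta a) X Y q *: xi a q = 0.

Variable g : bilfield.

Definition eps (a : 'I_s) (q : M) : R := bapp g (xi a) (xi a) q.

Definition compatible : Prop :=
  (forall a q, eps a q = 1 \/ eps a q = -1) /\
  (forall q, phi q *m g q *m (phi q)^T =
     g q - \sum_(a < s) eps a q *: (eta a q *m (eta a q)^T)).

(* A Lorentzian S-manifold whose timelike characteristic field is xi t. *)
Record lorentzian_S_manifold (t : 'I_s) : Prop := LorentzianS {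
  lS_gff : is_gff;
  lS_metric_smooth : smooth_bilfield g;
  lS_lorentzian : forall q, lorentzian (g q);
  lS_compatible : compatible;
  lS_timelike : forall a q, eps a q = if a == t then -1 else 1;
  lS_normal : normal;
  lS_contact : forall a U X Y, open U ->
    smooth_vfield U X -> smooth_vfield U Y ->
    forall q, U q -> ext_der (eta a) X Y q = bapp g X (eapp phi Y) q
}.

(** * The phi-null Osserman condition *)

Variables (nabla : vfield -> vfield -> vfield) (t : 'I_s) (p : M).

Definition celestial_sphere (x : 'rV[R]_N) : Prop :=
  (x <= phi p)%MS /\ (x *m g p *m x^T) 0 0 = 1.

Definition null_congruence (u : 'rV[R]_N) : Prop :=
  exists2 x, celestial_sphere x & u = xi t p + x.

Definition orth (u : 'rV[R]_N) : 'M[R]_N := kermx (g p *m u^T).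

(* The matrix of the projection T_pM -> T_pM / span(u), v |-> v *m qproj u. *)
Definition qproj (u : 'rV[R]_N) : 'M[R]_(N, \rank (cokermx u)) :=
  col_base (cokermx u).

(* The Jacobi operator of u on u^orth / span(u), in a basis of that space:
   pinvmx (qproj u) lifts classes to T_pM. *)
Definition jacobi_bar (u : 'rV[R]_N) : 'M[R]_(\rank (orth u *m qproj u)) :=
  restrictmx (orth u *m qproj u)
    (pinvmx (qproj u) *m jacobi nabla p u *m qproj u).

Definition phi_null_osserman : Prop :=
  forall u u', null_congruence u -> null_congruence u' ->
  forall a : R, \rank (eigenspace (jacobi_bar u) a)
              = \rank (eigenspace (jacobi_bar u') a).

(* V = x^orth :&: Im phi_p, where u = xi_t + x. *)
Definition Vspace (u : 'rV[R]_N) : 'M[R]_N :=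
  (orth (u - xi t p) :&: phi p)%MS.

Definition Wspace (u : 'rV[R]_N) : 'M[R]_N :=
  (Vspace u + \sum_(a < s | a != t) <<xi a p>>)%MS.

(* Identifying u^orth / span(u) with W, the Jacobi operator of u maps w to the
   component in W of R_p(w, u)u along span(u); this is its restriction to V, in
   a basis of V. *)
Definition jacobi_phi (u : 'rV[R]_N) : 'M[R]_(\rank (Vspace u)) :=
  restrictmx (Vspace u) (jacobi nabla p u *m proj_mx (Wspace u) <<u>>%MS).

End GFF.
End Fields.

Definition one_eigenvalue (R : realType) (k n : nat) (A : 'M[R]_n) : Prop :=
  exists c : R,
    (forall a, eigenvalue A a <-> a = c) /\
    \rank (eigenspace A c) = k.

Definition two_eigenvalues (R : realType) (k1 k2 n : nat) (A : 'M[R]_n)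
    : Prop :=
  exists c1 c2 : R,
    [/\ c1 != c2,
        (forall a, eigenvalue A a <-> a = c1 \/ a = c2),
        \rank (eigenspace A c1) = k1 &
        \rank (eigenspace A c2) = k2].

(* Main.v *)
(* On an S-manifold the characteristic fields are Killing, with
   nabla_X xi_a = - eps_a phi X, and nabla phi is given by
     (nabla_X phi) Y = g(phi X, phi Y) xibar + etabar(Y) phi^2 X,
   where xibar = sum_a xi_a and etabar = g(xibar, .).  Differentiating once more
   shows that, on H = Im phi_p, the tensor R - sigma R0 with sigma = sum_a eps_a
   and R0(x, y) z = g(y, z) x - g(x, z) y has all the symmetries of the curvature
   of a Kaehler manifold.  For u = xi_1 + x, the Jacobi operator of u is, on V,
   the Jacobi operator K_x of this Kaehler tensor plus sigma + 1, and it maps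
   each of xi_2, .., xi_s to xi_2 + .. + xi_s modulo u: the phi-null Osserman
   condition thus says that the spectrum of K_x is the same for all unit x in H.

   It remains to determine such "isospectral" Kaehler tensors on R^(4m + 2).
   Let M be the maximum of the holomorphic curvature h(x) = <K_x Jx, Jx> on the
   sphere, attained at x, and mt its minimum.  Up to replacing K by - K one has
   M > 0 and mt >= - M, and then M is the largest eigenvalue of every K_u,
   simple at x.  That M is an eigenvalue of K_{x + t v} to second order in t
   splits the orthogonal of x and Jx as U1 + U3, where K + JKJ^-1 = - M on U1 and
   3 K + JKJ^-1 = M on U3.  If mt > - M/2 then U1 = 0 and K = M/4 on U3.  If
   mt < - M/2, comparing the dimensions and traces at x and at a minimum of h
   gives a contradiction.  If mt = - M/2 and U1 is not 0, then U1 is a complex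
   line, and on the orthogonal of <x, Jx> + U1 the tensor is again isospectral,
   in dimension 4 less, with multiplicities that an induction on m excludes. *)

Require Import Defs.
From HB Require Import structures.
From mathcomp Require Import all_boot all_order all_fingroup all_algebra.
From mathcomp Require Import all_classical all_reals all_analysis.
From mathcomp Require Import ring lra zify.
Import Order.TTheory GRing.Theory Num.Theory.
Import numFieldNormedType.Exports.

Set Implicit Arguments.
Unset Strict Implicit.
Unset Printing Implicit Defensive.

Local Open Scope ring_scope.

(** * Symmetric matrices *)

(** The threshold [- M/2] comes from [U1]: the lower bound [mt] of [h], averaged over [x + s],
    [x - s], [x + Js], [x - Js] for a unit [s] in [U1], gives [h(s) >= 3 M + 4 mt], while
    [h(s) <= M]. Hence [U1 = 0] above the threshold, and at the threshold every inequality involved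
    is an equality. The dimension enters through parity. [U1] is stable under [J], so its rank is
    even, and so is that of [U3] because the two add up to [4m]. Below the threshold, counting the
    positive and negative directions of [K] bounds the sum of the ranks of [U3] at a maximum and at
    a minimum by [4m - 1]; parity lowers this to [4m - 2], and that gain is what makes the two trace
    inequalities contradict each other. At the threshold, the multiplicities left on the smaller
    space would force its dimension to be 4, whereas it is 2 modulo 4. No eigenvalue is
    differentiated in the perturbation argument. Only the existence, for each [t], of an eigenvector
    for [M] at [x + t v] is used, and it is confronted with a polynomial in [t] ([Gap] below) that
    would be positive on all candidates. *)

Section Euclidean.
Context {R : realType}.

Definition dot {N} (x y : 'rV[R]_N) : R := (x *m y^T) 0 0.

Lemma dotE N (x y : 'rV[R]_N) : dot x y = \sum_i x 0 i * y 0 i.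
Proof. by rewrite /dot mxE; apply: eq_bigr => i _; rewrite mxE. Qed.

Lemma dotC N (x y : 'rV[R]_N) : dot x y = dot y x.
Proof. by rewrite !dotE; apply: eq_bigr => i _; rewrite mulrC. Qed.

Lemma dotDl N (x y z : 'rV[R]_N) : dot (x + y) z = dot x z + dot y z.
Proof. by rewrite /dot mulmxDl mxE. Qed.

Lemma dotZl N a (x y : 'rV[R]_N) : dot (a *: x) y = a * dot x y.
Proof. by rewrite /dot -scalemxAl mxE. Qed.

Lemma dotDr N (x y z : 'rV[R]_N) : dot x (y + z) = dot x y + dot x z.
Proof. by rewrite dotC dotDl dotC (dotC z). Qed.

Lemma dotZr N a (x y : 'rV[R]_N) : dot x (a *: y) = a * dot x y.
Proof. by rewrite dotC dotZl dotC. Qed.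

Lemma dot0l N (y : 'rV[R]_N) : dot 0 y = 0.
Proof. by rewrite /dot mul0mx mxE. Qed.

Lemma dot0r N (y : 'rV[R]_N) : dot y 0 = 0.
Proof. by rewrite dotC dot0l. Qed.

Lemma dotNl N (x y : 'rV[R]_N) : dot (- x) y = - dot x y.
Proof. by rewrite /dot mulNmx mxE. Qed.

Lemma dotNr N (x y : 'rV[R]_N) : dot x (- y) = - dot x y.
Proof. by rewrite dotC dotNl dotC. Qed.

Lemma dotBl N (x y z : 'rV[R]_N) : dot (x - y) z = dot x z - dot y z.
Proof. by rewrite dotDl dotNl. Qed.

Lemma dotBr N (x y z : 'rV[R]_N) : dot x (y - z) = dot x y - dot x z.
Proof. by rewrite dotDr dotNr. Qed.

Definition dotE_lin := (@dotDl, @dotDr, @dotZl, @dotZr, @dotNl, @dotNr).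

Lemma dot_mulmx M N (x : 'rV[R]_M) (A : 'M[R]_(M, N)) (y : 'rV[R]_N) :
  dot (x *m A) y = dot x (y *m A^T).
Proof. by rewrite /dot trmx_mul trmxK mulmxA. Qed.

Lemma dot_ge0 N (x : 'rV[R]_N) : 0 <= dot x x.
Proof. by rewrite dotE sumr_ge0 // => i _; rewrite -expr2 sqr_ge0. Qed.

Lemma dot_eq0 N (x : 'rV[R]_N) : (dot x x == 0) = (x == 0).
Proof.
apply/idP/eqP => [|->]; last by rewrite dot0l.
rewrite dotE psumr_eq0 => [/allP h|i _]; last by rewrite -expr2 sqr_ge0.
apply/rowP => i; have := h i (mem_index_enum _).
by rewrite mulf_eq0 orbb mxE => /eqP.
Qed.

Lemma dot_gt0 N (x : 'rV[R]_N) : (0 < dot x x) = (x != 0).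
Proof. by rewrite lt_def dot_eq0 dot_ge0 andbT. Qed.

Lemma dot_delta N (x : 'rV[R]_N) i : dot x (delta_mx 0 i) = x 0 i.
Proof.
rewrite dotE (bigD1 i) //= mxE !eqxx mulr1 big1 ?addr0 // => j ji.
by rewrite mxE (negbTE ji) andbF mulr0.
Qed.

Lemma dot_ext N (x y : 'rV[R]_N) : (forall z, dot x z = dot y z) -> x = y.
Proof. by move=> h; apply/rowP => i; rewrite -!dot_delta. Qed.

Lemma dot_row M N (A : 'M[R]_(M, N)) (B : 'M[R]_(M, N)) i j :
  (A *m B^T) i j = dot (row i A) (row j B).
Proof. by rewrite dotE mxE; apply: eq_bigr => k _; rewrite !mxE. Qed.

(** The third clause allows forms of even degree to be rescaled without meeting the square root. *)
Lemma normalize N (x : 'rV[R]_N) : x != 0 ->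
  exists a, [/\ 0 < a, dot (a *: x) (a *: x) = 1 & a ^+ 2 = (dot x x)^-1].
Proof.
move=> x0; exists (Num.sqrt (dot x x))^-1.
have d0 : 0 < dot x x by rewrite dot_gt0.
have e : (Num.sqrt (dot x x))^-1 ^+ 2 = (dot x x)^-1.
  by rewrite exprVn sqr_sqrtr // ltW.
split=> //; first by rewrite invr_gt0 sqrtr_gt0.
by rewrite dotZl dotZr mulrA -expr2 e mulVf // gt_eqF.
Qed.

Lemma quad_lin0 (a b : R) : (forall t, 0 <= a * t ^+ 2 + b * t) -> b = 0.
Proof.
move=> h; apply/eqP/negP => /negP b0.
have bp : 0 < b ^+ 2 by rewrite lt_def sqr_ge0 sqrf_eq0 b0.
have a1 : 0 < `|a| + 1 by have := normr_ge0 a; lra.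
(* At this [t] the form equals [b^2 / c * (a / c - 1)] with [c = |a| + 1 > a], which is negative
   unless [b = 0]. *)
have := h (- (b / (`|a| + 1))).
set c := `|a| + 1 in a1 *.
have -> : a * (- (b / c)) ^+ 2 + b * - (b / c) = (b ^+ 2 / c) * (a / c - 1).
  by field; rewrite gt_eqF.
rewrite pmulr_rge0 ?divr_gt0 // subr_ge0 ler_pdivlMr // mul1r /c => h1.
by have := ler_norm a; lra.
Qed.

End Euclidean.

(** * Extrema on the unit sphere *)

Section Sphere.
Context {R : realType}.

Definition sphere N : set 'rV[R]_N := [set x | dot x x = 1].

Lemma cont_sum (T : topologicalType) (I : Type) (r : seq I) (f : I -> T -> R) :
  (forall i, continuous (f i)) -> continuous (fun x => \sum_(i <- r) f i x).
Proof.
move=> h; elim: r => [|i r ih] x.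
  by under eq_fun do rewrite big_nil; exact: cvg_cst.
by under eq_fun do rewrite big_cons; apply: cvgD; [exact: h | exact: ih].
Qed.

Lemma cont_mul (T : topologicalType) (f g : T -> R) :
  continuous f -> continuous g -> continuous (fun x => f x * g x).
Proof. by move=> hf hg x; apply: cvgM; [exact: hf | exact: hg]. Qed.

Lemma cont_coord N (i : 'I_N) : continuous (fun x : 'rV[R]_N => x 0 i).
Proof. exact: coord_continuous. Qed.

Lemma cont_dot N : continuous (fun x : 'rV[R]_N => dot x x).
Proof.
have -> : (fun x : 'rV[R]_N => dot x x) = (fun x => \sum_i x 0 i * x 0 i).
  by apply/funext => x; rewrite dotE.
by apply: cont_sum => i; apply: cont_mul; exact: cont_coord.
Qed.

Lemma dot_cont_closed N : closed (@sphere N).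
Proof.
apply: (@preimage_closed _ _ (fun x : 'rV[R]_N => dot x x) [set 1]%classic).
  by move=> x _; apply: cont_dot.
exact: closed_eq.
Qed.

Lemma sphere_compact N : compact (@sphere N).
Proof.
apply: bounded_closed_compact; last exact: dot_cont_closed.
exists 1; split=> [|r r1 x hx]; first exact: real1.
suff h : `|x| <= 1 by apply: le_trans h (ltW r1).
have -> : `|x| = mx_norm x by [].
rewrite mx_normrE.
apply/bigmax_leP; split=> // [[i j] _] /=; rewrite (ord1 i).
rewrite -(@ler_pXn2r _ 2) ?nnegrE // expr1n real_normK ?num_real //.
rewrite -hx dotE (bigD1 j) //= -expr2 lerDl sumr_ge0 // => k _.
by rewrite -expr2 sqr_ge0.
Qed.

Lemma sphere_max N (f : 'rV[R]_N.+1 -> R) : continuous f ->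
  exists2 x, dot x x = 1 & forall y, dot y y = 1 -> f y <= f x.
Proof.
move=> cf.
have [||x /set_mem hx xm] := EVT_max_rV _ (@sphere_compact N.+1) (f := f).
- by exists (delta_mx 0 0); rewrite /sphere /= dot_delta mxE !eqxx.
- exact: continuous_subspaceT.
by exists x => // y hy; apply: xm; apply/mem_set.
Qed.

Lemma cont_form N (A : 'M[R]_N) : continuous (fun x : 'rV[R]_N => dot (x *m A) x).
Proof.
have -> : (fun x : 'rV[R]_N => dot (x *m A) x) =
    (fun x => \sum_i (\sum_j x 0 j * A j i) * x 0 i).
  by apply/funext => x; rewrite dotE; apply: eq_bigr => i _; rewrite mxE.
apply: cont_sum => i; apply: cont_mul; last exact: cont_coord.
apply: cont_sum => j; apply: cont_mul; first exact: cont_coord.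
exact: cst_continuous.
Qed.

End Sphere.

(** * Spectral theorem, orthonormal bases and multiplicities of eigenvalues *)

Section Spectral.
Context {R : realType}.

(** The form [l |y|^2 - A(y, y)] is nonnegative and vanishes at [x], so its derivative at [x]
    vanishes in every direction [w]. *)
Lemma form_max_eigen N (A : 'M[R]_N) (x : 'rV[R]_N) l : A^T = A ->
  (forall y, dot (y *m A) y <= l * dot y y) -> dot (x *m A) x = l * dot x x ->
  x *m A = l *: x.
Proof.
move=> sA le eq; apply: dot_ext => w; rewrite dotZl.
pose B := l * dot x w - dot (x *m A) w.
suff : B *+ 2 = 0 by move/eqP; rewrite mulrn_eq0 /= => /eqP; rewrite /B; lra.
apply: (@quad_lin0 _ (l * dot w w - dot (w *m A) w)) => t.
have := le (x + t *: w).
have e : dot (w *m A) x = dot (x *m A) w by rewrite dot_mulmx sA dotC.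
rewrite mulmxDl -scalemxAl !(dotDl, dotDr, dotZl, dotZr) e eq (dotC w x).
by rewrite /B mulr2n; lra.
Qed.

Lemma top_eigenvector N (A : 'M[R]_N.+1) : A^T = A ->
  exists x l, [/\ dot x x = 1, x *m A = l *: x &
    forall y, dot (y *m A) y <= l * dot y y].
Proof.
move=> sA; have [x x1 xm] := sphere_max (@cont_form R N.+1 A).
have le y : dot (y *m A) y <= dot (x *m A) x * dot y y.
  have [->|y0] := eqVneq y 0; first by rewrite mul0mx !dot0l mulr0.
  have [a [a0 a1 a2]] := normalize y0.
  have := xm _ a1; rewrite -scalemxAl dotZl dotZr mulrA -expr2 a2.
  by rewrite mulrC ler_pdivrMr ?dot_gt0.
exists x, (dot (x *m A) x); split=> //.
by apply: form_max_eigen => //; rewrite x1 mulr1.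
Qed.

(** The reflection that exchanges [v] with the first basis vector: it is symmetric and its own
    inverse. When these two vectors coincide it degenerates and the identity is taken. *)
Lemma householder N (v : 'rV[R]_N.+1) : dot v v = 1 ->
  exists P : 'M[R]_N.+1, P *m P^T = 1%:M /\ row 0 P = v.
Proof.
move=> v1; pose e : 'rV[R]_N.+1 := delta_mx 0 0.
have e1 : dot e e = 1 by rewrite dot_delta mxE !eqxx.
have [->|ve] := eqVneq v e; first by exists 1%:M; rewrite trmx1 mulmx1 row1.
have [w we] : exists w, w = e - v by eexists.
have w0 : dot w w != 0 by rewrite dot_eq0 we subr_eq0 eq_sym.
have dw : dot w w = 2 * dot e w.
  by rewrite we !(dotBl, dotBr) (dotC v e) e1 v1; ring.
pose P : 'M[R]_N.+1 := 1%:M - (2 / dot w w) *: (w^T *m w).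
have PT : P^T = P.
  by rewrite /P linearB /= trmx1 [(_ *: _)^T]linearZ /= trmx_mul trmxK.
exists P; split.
  rewrite PT /P mulmxBl mul1mx mulmxBr mulmx1 -scalemxAl -scalemxAr.
  rewrite scalerA mulmxA -(mulmxA _ w w^T).
  have -> : w *m w^T = (dot w w)%:M by rewrite [LHS]mx11_scalar.
  rewrite mul_mx_scalar -scalemxAl scalerA.
  set a := 2 / dot w w; rewrite -addrA -opprD.
  have -> : a * a * dot w w = a + a by rewrite /a; field; exact: w0.
  have -> : a *: (w^T *m w) - (a + a) *: (w^T *m w) = - (a *: (w^T *m w)).
    by rewrite scalerDl opprD addrA subrr sub0r.
  by rewrite subrr subr0.
rewrite rowE /P mulmxBr mulmx1 -scalemxAr mulmxA.
have -> : (delta_mx 0 0 : 'rV_N.+1) *m w^T = (dot e w)%:M.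
  by rewrite [LHS]mx11_scalar.
rewrite mul_scalar_mx scalerA.
have -> : 2 / dot w w * dot e w = 1.
  by rewrite mulrAC -dw divff.
by rewrite scale1r we opprB addrC subrK.
Qed.

(** Induction on the dimension: a reflection whose first row is a top eigenvector brings [A] to
    block diagonal form. *)
Lemma spectral N (A : 'M[R]_N) : A^T = A ->
  exists P (d : 'rV_N), P *m P^T = 1%:M /\ P *m A *m P^T = diag_mx d.
Proof.
elim: N A => [|N IH] A sA.
  by exists 1%:M, 0; split; rewrite !thinmx0 //; apply/matrixP => - [].
have [x [l [x1 xA _]]] := top_eigenvector sA.
have [P [PP Px]] := householder x1.
have [B eB] : exists B : 'M[R]_(1 + N), B = P *m A *m P^T by eexists.
have BT : B^T = B by rewrite eB !trmx_mul trmxK sA mulmxA.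
have r0 : row 0 B = l *: delta_mx 0 0.
  rewrite eB -mulmxA row_mul Px mulmxA xA -scalemxAl; congr (_ *: _).
  have := congr1 (row 0) PP; rewrite row_mul Px => ->.
  by rewrite row1.
have ul : ulsubmx B = l%:M.
  apply/matrixP => i j; rewrite !ord1 !mxE.
  have := congr1 (fun r : 'rV_N.+1 => r 0 0) r0; rewrite !mxE /= mulr1n mulr1.
  by move=> <-; congr (B _ _); apply/val_inj.
have ur : ursubmx B = 0.
  apply/matrixP => i j; rewrite !ord1 !mxE.
  have := congr1 (fun r : 'rV_N.+1 => r 0 (rshift 1 j)) r0.
  rewrite !mxE /= mulr0 => <-.
  by congr (B _ _); apply/val_inj.
have dl : dlsubmx B = 0 by rewrite -[dlsubmx B]trmxK trmx_dlsub BT ur trmx0.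
have sD : (drsubmx B)^T = drsubmx B by rewrite trmx_drsub BT.
have [Q [d [QQ Qd]]] := IH _ sD.
pose S : 'M[R]_(1 + N) := block_mx 1%:M 0 0 Q.
have SS : S *m S^T = 1%:M.
  rewrite /S tr_block_mx mulmx_block !trmx0 trmx1 !(mulmx0, mul0mx) mulmx1.
  by rewrite !addr0 add0r QQ -scalar_mx_block.
exists (S *m P), (row_mx l%:M d); split.
  by rewrite trmx_mul mulmxA -(mulmxA S) PP mulmx1 SS.
rewrite trmx_mul !mulmxA -(mulmxA S) -(mulmxA S) -eB.
have -> : S^T = block_mx 1%:M 0 0 Q^T.
  by rewrite /S tr_block_mx !trmx0 trmx1.
rewrite -[B]submxK ul ur dl /S mulmx_block.
rewrite !(mulmx0, mul0mx, mulmx1, mul1mx) !addr0 !add0r.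
have e2 X Y : (block_mx l%:M 0 0 X : 'M[R]_(1 + N)) *m block_mx 1%:M 0 0 Y =
    block_mx l%:M 0 0 (X *m Y).
  by rewrite mulmx_block !(mulmx0, mul0mx, mulmx1, mul1mx) !addr0 !add0r.
etransitivity; first exact: e2.
have e3 : diag_mx (row_mx l%:M d) = block_mx l%:M 0 0 (diag_mx d) :> 'M[R]_(1 + N).
  by rewrite diag_mx_row; congr block_mx; apply/matrixP => i j; rewrite !mxE !ord1.
by rewrite Qd; exact: esym e3.
Qed.

Lemma rowmul_inj m n (A B : 'M[R]_(m, n)) :
  (forall v : 'rV_m, v *m A = v *m B) -> A = B.
Proof. by move=> h; apply/row_matrixP => i; rewrite !rowE. Qed.

Lemma dot_mul2 m n (A B : 'M[R]_(m, n)) (x y : 'rV_m) :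
  dot (x *m A) (y *m B) = dot (x *m (A *m B^T)) y.
Proof. by rewrite mulmxA [RHS]dot_mulmx trmxK. Qed.

(** Positivity is asked on [V] only, since besides the Euclidean product this serves the Lorentzian
    metric on the image of [phi]. The Gram matrix of a basis is diagonalised, then the rows are
    divided by the square roots of its eigenvalues. *)
Lemma orthonormal_basis m n (S : 'M[R]_n) (V : 'M[R]_(m, n)) : S^T = S ->
  (forall v : 'rV_n, (v <= V)%MS -> v != 0 -> 0 < dot (v *m S) v) ->
  exists E : 'M[R]_(\rank V, n), E *m S *m E^T = 1%:M /\ (E :=: V)%MS.
Proof.
move=> sS pos.
have [B [Bf BV]] : exists B : 'M[R]_(\rank V, n), row_free B /\ (B :=: V)%MS.
  by exists (row_base V); split; [exact: row_base_free | exact: eq_row_base].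
have GT : (B *m S *m B^T)^T = B *m S *m B^T.
  by rewrite !trmx_mul trmxK sS !mulmxA.
have [P [d [PP Pd]]] := spectral GT.
have Pu : P \in unitmx by case/mulmx1_unit: PP.
have dp i : 0 < d 0 i.
  have -> : d 0 i = dot (row i (P *m B) *m S) (row i (P *m B)).
    have := congr1 (fun M : 'M[R]_(\rank V) => M i i) Pd; rewrite [in RHS]mxE eqxx.
    rewrite mulr1n => <-; rewrite -row_mul -dot_row trmx_mul !mulmxA.
    by rewrite -!mulmxA.
  apply: pos.
    by rewrite row_mul -BV submxMl.
  apply/negP => /eqP h.
  have : delta_mx 0 i *m (P *m B) = 0 :> 'rV_n by rewrite -rowE.
  move/eqP; rewrite mulmxA mulmx_free_eq0 ?Bf // => /eqP.
  move/(congr1 (mulmx^~ (invmx P))); rewrite mulmxK // mul0mx.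
  by move/rowP/(_ i)/eqP; rewrite !mxE !eqxx oner_eq0.
pose c := \row_i (Num.sqrt (d 0 i))^-1.
have cd : diag_mx c *m diag_mx d *m diag_mx c = 1%:M.
  rewrite -!mulmxA !mul_diag_mx; apply/matrixP => i j; rewrite !mxE.
  case: eqVneq => [->|_]; last by rewrite !mulr0n !mulr0.
  rewrite /= !mulr1n mulrCA -expr2 exprVn sqr_sqrtr ?ltW //.
  by rewrite mulfV // gt_eqF.
have cu : diag_mx c \in unitmx.
  rewrite unitmxE det_diag unitfE prodf_seq_neq0; apply/allP => i _ /=.
  by rewrite mxE invr_eq0 sqrtr_eq0 -ltNge.
exists (diag_mx c *m (P *m B)); split.
  rewrite !trmx_mul tr_diag_mx !mulmxA -!(mulmxA (diag_mx c)).
  by have <- := cd; rewrite -Pd !mulmxA.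
apply: eqmx_trans BV; rewrite mulmxA.
by apply: eqmxMfull; rewrite row_full_unit unitmx_mul cu.
Qed.

Lemma onb m n (V : 'M[R]_(m, n)) :
  exists E : 'M[R]_(\rank V, n), E *m E^T = 1%:M /\ (E :=: V)%MS.
Proof.
have [||E [EE EV]] := @orthonormal_basis m n 1%:M V; first exact: trmx1.
  by move=> v _ v0; rewrite mulmx1 dot_gt0.
by exists E; rewrite mulmx1 in EE.
Qed.

(** The rows of [P] span a [K]-stable space on which [K] has matrix [C]; the injection [v -> v P]
    carries eigenvectors of [C] onto the eigenvectors of [K] in that space. *)
Lemma eig_transfer k n (P : 'M[R]_(k, n)) (K : 'M[R]_n) (C : 'M[R]_k) a :
  row_free P -> P *m K = C *m P ->
  \rank (eigenspace C a) = \rank (P :&: eigenspace K a)%MS.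
Proof.
move=> Pf PK; rewrite -(mxrankMfree (eigenspace C a) Pf).
apply/eqmx_rank/andP; split.
  rewrite sub_capmx submxMl /=; apply/eigenspaceP.
  rewrite -mulmxA PK mulmxA.
  by have /eigenspaceP -> := submx_refl (eigenspace C a); rewrite -scalemxAl.
apply/row_subP => i; set v := row i _.
have : (v <= P :&: eigenspace K a)%MS by apply: row_sub.
rewrite sub_capmx => /andP[/submxP[w vw] /eigenspaceP vK].
rewrite vw; apply: submxMr; apply/eigenspaceP.
have /eqP := vK; rewrite vw -mulmxA PK mulmxA scalemxAl -subr_eq0 -mulmxBl.
by rewrite mulmx_free_eq0 // subr_eq0 => /eqP.
Qed.

Lemma rank_eigenspace_block p q (A : 'M[R]_p) (B : 'M[R]_q) a :
  \rank (eigenspace (block_mx A 0 0 B) a) =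
  (\rank (eigenspace A a) + \rank (eigenspace B a))%N.
Proof.
rewrite !mxrank_ker (scalar_mx_block p q a) opp_block_mx add_block_mx !subr0.
rewrite rank_diag_block_mx.
have := rank_leq_row (A - a%:M); have := rank_leq_row (B - a%:M).
by set x := \rank _; set y := \rank _; lia.
Qed.

Lemma rank_eigenspace_scalar p c a :
  \rank (eigenspace (c%:M : 'M[R]_p) a) = if a == c then p else 0%N.
Proof.
rewrite mxrank_ker -raddfB /=; case: eqVneq => [->|ac].
  by rewrite subrr raddf0 mxrank0 subn0.
rewrite -scalemx1 mxrank_scale_nz ?mxrank1 ?subnn //.
by rewrite subr_eq0 eq_sym.
Qed.

Definition same_eig n (A B : 'M[R]_n) := forall a,
  \rank (eigenspace A a) = \rank (eigenspace B a).

Lemma orth_row_full n (P : 'M[R]_n) : P *m P^T = 1%:M -> P \in unitmx.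
Proof. by case/mulmx1_unit. Qed.

Lemma orthT n (P : 'M[R]_n) : P *m P^T = 1%:M -> P^T *m P = 1%:M.
Proof. exact: mulmx1C. Qed.

Lemma row_free_orth k n (P : 'M[R]_(k, n)) : P *m P^T = 1%:M -> row_free P.
Proof. by move=> h; apply/row_freeP; exists P^T. Qed.

Lemma same_eig_conj n (A P : 'M[R]_n) : P *m P^T = 1%:M ->
  same_eig (P *m A *m P^T) A.
Proof.
move=> PP a; rewrite (@eig_transfer _ _ P A) ?row_free_orth //; last first.
  by rewrite -!mulmxA (orthT PP) mulmx1.
apply/eqmx_rank/andP; rewrite capmxSr sub_capmx submx_refl andbT; split=> //.
by apply: submx_full; rewrite row_full_unit orth_row_full.
Qed.

Lemma rank_eigenspace_diag n (d : 'rV[R]_n) a :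
  \rank (eigenspace (diag_mx d) a) = (\sum_i (d 0%R i == a))%N.
Proof.
elim: n d => [|n IH] d; first by rewrite big_ord0 thinmx0 mxrank0.
suff h (d1 : 'rV[R]_1) (d2 : 'rV[R]_n) :
    \rank (eigenspace (diag_mx (row_mx d1 d2)) a) =
    ((d1 0%R 0%R == a) + \sum_i (d2 0%R i == a))%N.
  have := h (lsubmx (d : 'rV_(1 + n))) (rsubmx (d : 'rV_(1 + n))).
  rewrite hsubmxK => ->; rewrite big_ord_recl !mxE.
  congr (nat_of_bool (d _ _ == _) + _)%N; first exact/val_inj.
  apply: eq_bigr => i _; rewrite mxE.
  by congr (nat_of_bool (d _ _ == _)); apply/val_inj.
rewrite diag_mx_row rank_eigenspace_block IH; congr (_ + _)%N.
have -> : diag_mx d1 = (d1 0 0)%:M.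
  by apply/matrixP => i j; rewrite !mxE !ord1 !eqxx !mulr1n.
by rewrite rank_eigenspace_scalar eq_sym; case: eqVneq.
Qed.

(** After diagonalisation, equal multiplicities mean that the two diagonals differ by a permutation,
    whose matrix links the two eigenbases. *)
Lemma same_eig_orth n (A B : 'M[R]_n) : A^T = A -> B^T = B -> same_eig A B ->
  exists O : 'M[R]_n, O *m O^T = 1%:M /\ B = O^T *m A *m O.
Proof.
move=> sA sB AB.
have [P [d [PP Pd]]] := spectral sA; have [Q [e [QQ Qe]]] := spectral sB.
have de a : (\sum_i (d 0%R i == a) = \sum_i (e 0%R i == a))%N.
  have <- := rank_eigenspace_diag d a; have <- := rank_eigenspace_diag e a.
  rewrite -Pd -Qe; apply: etrans (same_eig_conj A PP a) _.
  exact: etrans (AB a) (esym (same_eig_conj B QQ a)).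
have /tuple_permP[s sP] :
    perm_eq [tuple e 0 i | i < n] [tuple d 0 i | i < n].
  apply/allP => a _ /=; apply/eqP.
  rewrite -!sum1_count !big_map /index_enum /= -!enumT.
  transitivity (\sum_i (e 0%R i == a))%N; [|rewrite -de]; last apply: esym.
    by rewrite big_enum_cond /= big_mkcond /=; apply: eq_bigr => i _; case: eqP.
  by rewrite big_enum_cond /= big_mkcond /=; apply: eq_bigr => i _; case: eqP.
pose S := perm_mx s : 'M[R]_n.
have eS : diag_mx e = S *m diag_mx d *m S^T.
  rewrite /S tr_perm_mx -row_permE -col_permE.
  apply/matrixP => i j; rewrite !mxE (inj_eq perm_inj).
  case: eqVneq => [->|_]; last by rewrite !mulr0n.
  rewrite !mulr1n.
  have := congr1 (fun t => nth 0 t j) sP.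
  by rewrite -!tnth_nth !tnth_mktuple.
have SS : S *m S^T = 1%:M by rewrite /S tr_perm_mx -perm_mxM mulgV perm_mx1.
exists (P^T *m S^T *m Q); split.
  rewrite !trmx_mul !trmxK !mulmxA -(mulmxA _ Q) QQ mulmx1.
  by rewrite -(mulmxA _ S^T) (orthT SS) mulmx1 (orthT PP).
rewrite !trmx_mul !trmxK !mulmxA -(mulmxA _ P) -(mulmxA _ _ P^T) Pd.
rewrite -(mulmxA _ S) -(mulmxA _ _ S^T) -eS -Qe.
by rewrite !mulmxA (orthT QQ) mul1mx -mulmxA (orthT QQ) mulmx1.
Qed.

(** On a basis of [U], [J] acts by a real matrix [C] with [C^2 = -1]; then [det(C)^2 = (-1)^r] must
    be nonnegative. *)
Lemma rank_stable_even r n (U : 'M[R]_(r, n)) (J : 'M[R]_n) :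
  J *m J = - 1%:M -> (U *m J <= U)%MS -> ~~ odd (\rank U).
Proof.
move=> JJ UJ; pose B := row_base U.
have /submxP[C BJ] : (B *m J <= B)%MS.
  by rewrite !eq_row_base (eqmxMr _ (eq_row_base U)).
have CC : C *m C = - 1%:M.
  apply: (row_free_inj (row_base_free U)).
  by rewrite -mulmxA -BJ mulmxA -BJ -mulmxA JJ mulmxN mulmx1 mulNmx mul1mx.
have := congr1 determinant CC; rewrite det_mulmx -scaleN1r detZ det1 mulr1.
apply: contra_eqN => odr; rewrite -signr_odd odr expr1.
by apply/negP => /eqP h; have := sqr_ge0 (\det C); rewrite expr2 h; lra.
Qed.

End Spectral.

(** * Isospectral Kaehler tensors *)

Section RealPoly.
Context {R : realType}.

Lemma lim_ge0 (a b c : R) :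
  (forall t, t != 0 -> 0 <= a + b * t + c * t ^+ 2) -> 0 <= a.
Proof.
move=> h; rewrite leNgt; apply/negP => a0.
pose s := - a; have s0 : 0 < s by rewrite oppr_gt0.
pose D := s + `|b| + `|c| + 1.
have Dp : 0 < D by rewrite /D; have := normr_ge0 b; have := normr_ge0 c; lra.
(* Since [t <= 1], the terms in [b] and [c] add up to less than [D t = s / 2], which cannot
   compensate [a = - s]. *)
pose t := s / (2 * D).
have t0 : 0 < t by rewrite divr_gt0 // mulr_gt0.
have tD : t * (2 * D) = s by rewrite /t divfK // gt_eqF // mulr_gt0.
have := h t (lt0r_neq0 t0).
have t1 : t <= 1.
  rewrite /t ler_pdivrMr ?mulr_gt0 // mul1r /D.
  by have := normr_ge0 b; have := normr_ge0 c; lra.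
have h1 : b * t <= `|b| * t by rewrite ler_pM2r // ler_norm.
have h2 : c * t ^+ 2 <= `|c| * t.
  apply: le_trans (_ : `|c| * t ^+ 2 <= _).
    by rewrite ler_wpM2r ?sqr_ge0 // ler_norm.
  by rewrite ler_wpM2l // expr2 ger_pMl.
have : t * (2 * D) = 2 * s * t + 2 * `|b| * t + 2 * `|c| * t + 2 * t.
  by rewrite /D; ring.
have := normr_ge0 b; have := normr_ge0 c => hc hb.
have := mulr_ge0 (ltW s0) (ltW t0).
have := mulr_ge0 hb (ltW t0); have := mulr_ge0 hc (ltW t0).
by rewrite tD /s; lra.
Qed.

(** Applied to [M |y|^4 - h(y)] along a line through a maximum of [h], the three conclusions give
    the critical point equation, the Hessian bound and, where the Hessian degenerates, a third-order
    identity. *)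
Lemma quartic_ge0 (a1 a2 a3 a4 : R) :
  (forall t, 0 <= a1 * t + a2 * t ^+ 2 + a3 * t ^+ 3 + a4 * t ^+ 4) ->
  [/\ a1 = 0, 0 <= a2 & (a2 = 0 -> a3 = 0)].
Proof.
move=> h.
(* The factor [s] will be 1 and -1, the latter accounting for [t] replaced by [- t], to obtain both
   signs of [a1]. *)
have e (s : R) : (forall t, 0 <= (s * a1) * t + a2 * t ^+ 2 + (s * a3) * t ^+ 3 + a4 * t ^+ 4) ->
    0 <= s * a1.
  move=> hs; rewrite leNgt; apply/negP => s0.
  pose r := - (s * a1); have r0 : 0 < r by rewrite oppr_gt0.
  pose C := `|a2| + `|s * a3| + `|a4|.
  have C0 : 0 <= C by rewrite /C !addr_ge0.
  pose t := r / (r + C + 1).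
  have D0 : 0 < r + C + 1 by lra.
  have t0 : 0 < t by rewrite divr_gt0.
  have tD : t * (r + C + 1) = r by rewrite divfK // gt_eqF.
  have t1 : t <= 1 by rewrite ler_pdivrMr // mul1r; lra.
  have := hs t.
  have b (c : R) (n : nat) : c * t ^+ n.+2 <= `|c| * t ^+ 2.
    apply: le_trans (_ : `|c| * t ^+ n.+2 <= _).
      by apply: ler_wpM2r; [rewrite exprn_ge0 // ltW | exact: ler_norm].
    by rewrite ler_wpM2l // ler_wiXn2l // ltW.
  have := b a2 0%N; have := b (s * a3) 1%N; have := b a4 2%N.
  move=> h4 h3 h2 h0.
  have : 0 <= t * (- r + C * t) by rewrite /C /r; lra.
  rewrite pmulr_rge0 //.
  have : t * (r + C + 1) = r * t + C * t + t by ring.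
  by have := mulr_gt0 r0 t0; lra.
have a10 : a1 = 0.
  have h1 := e 1; have h2 := e (-1).
  have {}h1 : 0 <= 1 * a1 by apply: h1 => t; have := h t; lra.
  have {}h2 : 0 <= -1 * a1.
    by apply: h2 => t; have := h (- t); rewrite !exprS !expr0; lra.
  lra.
have h2 t : t != 0 -> 0 <= a2 + a3 * t + a4 * t ^+ 2.
  move=> t0; have := h t; rewrite a10.
  have -> : 0 * t + a2 * t ^+ 2 + a3 * t ^+ 3 + a4 * t ^+ 4 =
    t ^+ 2 * (a2 + a3 * t + a4 * t ^+ 2) by ring.
  by rewrite pmulr_rge0 // lt_def sqr_ge0 sqrf_eq0 t0.
split=> //; first exact: lim_ge0 h2.
move=> a20; apply: (@quad_lin0 _ a4) => t.
have [->|t0] := eqVneq t 0; first by lra.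
by have := h2 _ t0; rewrite a20; lra.
Qed.

End RealPoly.

Section FormBounds.
Context {R : realType}.

Lemma posdef_bound N (A : 'M[R]_N) : A^T = A ->
  (forall y, y != 0 -> 0 < dot (y *m A) y) ->
  exists2 b, 0 < b & forall y, b * dot y y <= dot (y *m A) y.
Proof.
case: N A => [|N] A sA pos.
  by exists 1 => // y; rewrite [y]thinmx0 mul0mx !dot0l mulr0.
have sA' : (- A)^T = - A by rewrite linearN /= sA.
have [x [l [x1 xA le]]] := top_eigenvector sA'.
exists (- l).
  have x0 : x != 0 by rewrite -dot_gt0 x1.
  have := pos _ x0; have := congr1 (dot ^~ x) xA.
  by rewrite mulmxN dotNl dotZl x1; lra.
by move=> y; have := le y; rewrite mulmxN dotNl; lra.
Qed.

Lemma form_bound N (A : 'M[R]_N) : A^T = A ->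
  exists2 C, 0 <= C & forall y, dot (y *m A) y <= C * dot y y.
Proof.
case: N A => [|N] A sA.
  by exists 0 => // y; rewrite [y]thinmx0 mul0mx !dot0l mulr0.
have [x [l [x1 xA le]]] := top_eigenvector sA.
exists `|l| => // y; apply: le_trans (le y) _.
by rewrite ler_wpM2r ?dot_ge0 // ler_norm.
Qed.

Lemma linear_sum_delta N (f : 'rV[R]_N -> R) :
  (forall a x y, f (a *: x + y) = a * f x + f y) ->
  forall x, f x = \sum_i x 0 i * f (delta_mx 0 i).
Proof.
move=> fl x; have f0 : f 0 = 0.
  by have := fl 1 0 0; rewrite scale1r addr0 mul1r => /eqP; lra.
rewrite {1}[x]row_sum_delta.
elim/big_rec2: _ => [|i y1 y2 _ <-]; first exact: f0.
by rewrite fl.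
Qed.

End FormBounds.

Lemma col_mx_intertwine (R : realType) N p q (X : 'M[R]_(p, N))
    (Y : 'M[R]_(q, N)) (K : 'M[R]_N) A B :
  X *m K = A *m X -> Y *m K = B *m Y ->
  col_mx X Y *m K = block_mx A 0 0 B *m col_mx X Y.
Proof. by move=> hX hY; rewrite mul_col_mx mul_block_col !mul0mx addr0 add0r hX hY. Qed.

(** * Algebra of Kaehler curvature tensors *)

Section Kaehler.
Context {R : realType} {N : nat}.
Implicit Types (x y z w v u : 'rV[R]_N).

(** Linearity and invariance under [J] are asked in the first slots only; [k_skew] and [k_pair]
    carry them to the others. *)
Record kaehler (J : 'M[R]_N)
    (k : 'rV[R]_N -> 'rV[R]_N -> 'rV[R]_N -> 'rV[R]_N -> R) : Prop := Kaehler {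
  k_lin : forall a x x' y z w,
    k (a *: x + x') y z w = a * k x y z w + k x' y z w;
  k_skew : forall x y z w, k x y z w = - k y x z w;
  k_pair : forall x y z w, k x y z w = k z w x y;
  k_bianchi : forall x y z w, k x y z w + k y z x w + k z x y w = 0;
  k_J : forall x y z w, k (x *m J) (y *m J) z w = k x y z w }.

Context (J : 'M[R]_N) (JJ : J *m J = - 1%:M) (JT : J *m J^T = 1%:M).
Context (k : 'rV[R]_N -> 'rV[R]_N -> 'rV[R]_N -> 'rV[R]_N -> R).
Context (hk : kaehler J k).

Lemma J2 x : x *m J *m J = - x.
Proof. by rewrite -mulmxA JJ mulmxN mulmx1. Qed.

Lemma JTN : J^T = - J.
Proof.
have : J *m (J^T + J) = 0 by rewrite mulmxDr JT JJ subrr.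
move/(congr1 (mulmx J)); rewrite mulmxA JJ mulNmx mul1mx mulmx0 => /eqP.
by rewrite oppr_eq0 addr_eq0 => /eqP.
Qed.

Lemma dotJ x y : dot (x *m J) (y *m J) = dot x y.
Proof. by rewrite dot_mul2 JT mulmx1. Qed.

Lemma dotJl x y : dot (x *m J) y = - dot x (y *m J).
Proof. by rewrite dot_mulmx JTN mulmxN dotNr. Qed.

Lemma dotJx x : dot (x *m J) x = 0.
Proof. by have := dotJl x x; rewrite (dotC x); lra. Qed.

Lemma dotxJ x : dot x (x *m J) = 0.
Proof. by rewrite dotC dotJx. Qed.

Lemma J_eq0 x : (x *m J == 0) = (x == 0).
Proof. by rewrite -!dot_eq0 dotJ. Qed.

Lemma kD1 x x' y z w : k (x + x') y z w = k x y z w + k x' y z w.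
Proof. by have := k_lin hk 1 x x' y z w; rewrite scale1r mul1r. Qed.

Lemma k0 y z w : k 0 y z w = 0.
Proof. by have := kD1 0 0 y z w; rewrite addr0; lra. Qed.

Lemma kZ1 a x y z w : k (a *: x) y z w = a * k x y z w.
Proof. by have := k_lin hk a x 0 y z w; rewrite addr0 k0 addr0. Qed.

Lemma kN1 x y z w : k (- x) y z w = - k x y z w.
Proof. by rewrite -scaleN1r kZ1 mulN1r. Qed.

Lemma kD2 x y y' z w : k x (y + y') z w = k x y z w + k x y' z w.
Proof. by rewrite !(k_skew hk x) kD1 opprD. Qed.

Lemma kZ2 a x y z w : k x (a *: y) z w = a * k x y z w.
Proof. by rewrite !(k_skew hk x) kZ1 mulrN. Qed.

Lemma kN2 x y z w : k x (- y) z w = - k x y z w.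
Proof. by rewrite !(k_skew hk x) kN1. Qed.

Lemma kD3 x y z z' w : k x y (z + z') w = k x y z w + k x y z' w.
Proof. by rewrite !(k_pair hk x) kD1. Qed.

Lemma kZ3 a x y z w : k x y (a *: z) w = a * k x y z w.
Proof. by rewrite !(k_pair hk x) kZ1. Qed.

Lemma kN3 x y z w : k x y (- z) w = - k x y z w.
Proof. by rewrite !(k_pair hk x) kN1. Qed.

Lemma kD4 x y z w w' : k x y z (w + w') = k x y z w + k x y z w'.
Proof. by rewrite !(k_pair hk x) kD2. Qed.

Lemma kZ4 a x y z w : k x y z (a *: w) = a * k x y z w.
Proof. by rewrite !(k_pair hk x) kZ2. Qed.

Lemma kN4 x y z w : k x y z (- w) = - k x y z w.
Proof. by rewrite !(k_pair hk x) kN2. Qed.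

Definition kE := (kD1, kD2, kD3, kD4, kZ1, kZ2, kZ3, kZ4, kN1, kN2, kN3, kN4).

Lemma k_skew' x y z w : k x y z w = - k x y w z.
Proof. by rewrite (k_pair hk) (k_skew hk) (k_pair hk). Qed.

Lemma k_J' x y z w : k x y (z *m J) (w *m J) = k x y z w.
Proof. by rewrite (k_pair hk) (k_J hk) (k_pair hk). Qed.

Lemma kJswap x y z w : k (x *m J) y z w = k (y *m J) x z w.
Proof.
by rewrite -(k_J hk (x *m J)) J2 kN1 (k_skew hk x) opprK.
Qed.

Lemma kJswap' x y z w : k x y z (w *m J) = k x y w (z *m J).
Proof.
by rewrite !(k_pair hk x) (k_skew hk z) kJswap -(k_skew hk).
Qed.

(* With k x y z w = <R(x, y)z, w>, kap x is the form of the Jacobi operator of x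
   and hol x is the holomorphic sectional curvature when |x| = 1. *)
Definition kap x y z := k y x x z.
(** The polarisation of [kap] in its first argument: the coefficient of [t] in
    [kap (x + t v) y z]. *)
Definition kap2 x v y z := k y x v z + k y v x z.
Definition hol x := kap x (x *m J) (x *m J).

Lemma kap_sym x y z : kap x y z = kap x z y.
Proof. by rewrite /kap (k_pair hk) (k_skew hk) k_skew' opprK. Qed.

Lemma kapxy x y : kap x y y = kap y x x.
Proof. by rewrite /kap (k_skew hk) k_skew' opprK. Qed.

Lemma kap2_sym x v y z : kap2 x v y z = kap2 x v z y.
Proof.
rewrite /kap2 addrC (k_pair hk y v) (k_skew hk x) k_skew' opprK.
by congr (_ + _); rewrite (k_pair hk y x) (k_skew hk v) k_skew' opprK.
Qed.

Lemma kapJ x y z : kap (x *m J) y z = kap x (y *m J) (z *m J).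
Proof. by rewrite /kap -(k_J hk y) -k_J' !J2 !kE !opprK. Qed.

Lemma kapJJ x y z : kap (x *m J) (y *m J) (z *m J) = kap x y z.
Proof. by rewrite kapJ !J2 /kap !kE !opprK. Qed.

Lemma kap_x0 x z : kap x x z = 0.
Proof. by rewrite /kap; have := k_skew hk x x x z; lra. Qed.

Lemma kap_lin x a y y' z : kap x (a *: y + y') z = a * kap x y z + kap x y' z.
Proof. by rewrite /kap !kE. Qed.

Lemma kapD x v y z : kap (x + v) y z = kap x y z + kap2 x v y z + kap v y z.
Proof. by rewrite /kap /kap2 !kE; ring. Qed.

Lemma kapZ a x y z : kap (a *: x) y z = a ^+ 2 * kap x y z.
Proof. by rewrite /kap !kE; ring. Qed.

Lemma kapNN x y z : kap x (- y) (- z) = kap x y z.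
Proof. by rewrite /kap !kE opprK. Qed.

Lemma holZ a x : hol (a *: x) = a ^+ 4 * hol x.
Proof. by rewrite /hol -scalemxAl kapZ /kap !kE; ring. Qed.

Lemma holJ x : hol (x *m J) = hol x.
Proof. by rewrite /hol kapJJ. Qed.

(** The Bianchi identity on [Jx], [x], [v]: moving [J] across a pair turns its two other terms into
    values of [kap x]. This is what reduces the mixed terms of later expansions to the Jacobi form
    of [x] alone. *)
Lemma k_bi x v w : k (x *m J) x v w = kap x (v *m J) w - kap x v (w *m J).
Proof.
have e1 : k v (x *m J) x w = - kap x (v *m J) w.
  by rewrite (k_skew hk) kJswap.
have e2 : k x v (x *m J) w = kap x v (w *m J).
  by rewrite (k_skew' x v) kJswap' -(k_skew hk).
by have := k_bianchi hk (x *m J) x v w; rewrite e1 e2; lra.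
Qed.

Lemma kap2_JxJx x v : kap2 x v (x *m J) (x *m J) = 2 * kap x (x *m J) (v *m J).
Proof.
rewrite /kap2 k_bi (kJswap x v) -[k (v *m J) x x (x *m J)]/(kap x _ _).
have -> : kap x v (x *m J *m J) = 0.
  by rewrite J2 kap_sym; have := kap_x0 x v; rewrite /kap !kE => ->; rewrite oppr0.
by rewrite (kap_sym x (v *m J)); ring.
Qed.

Lemma kap2_Jx x v w :
  kap2 x v (x *m J) w = 2 * kap x (v *m J) w - kap x v (w *m J).
Proof. by rewrite /kap2 k_bi (kJswap x v) /kap; ring. Qed.

Lemma hol_expand x v :
  hol (x + v) = hol x + 4 * kap x (x *m J) (v *m J) +
    (2 * kap x v v + 6 * kap x (v *m J) (v *m J)) +
    4 * kap v (v *m J) (x *m J) + hol v.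
Proof.
(* This expression is symmetric in [a], [b] and in [c], [d], so the sixteen terms of the expansion
   collapse to a few. *)
pose s a b c d := k (a *m J) b c (d *m J).
have s12 a b c d : s a b c d = s b a c d by rewrite /s kJswap.
have s34 a b c d : s a b c d = s a b d c by rewrite /s kJswap'.
have e1 a b : kap a (b *m J) (b *m J) = s b a a b by [].
have e2 a b : kap a (a *m J) (b *m J) = s a a a b by [].
have e3 a b : s a a b b = kap a b b + s b a a b.
  by rewrite /s k_bi J2 /kap !kE; ring.
have -> : kap x v v = s x x v v - s v x x v by rewrite e3; ring.
have e5 a b : s a a b a = s a a a b by rewrite s34.
have e4 a b : s b a a a = s a a a b.
  by rewrite -e2 kap_sym.
rewrite /hol !e1 !e2.
have -> : s (x + v) (x + v) (x + v) (x + v) = 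
  s x x x x + s x x x v + s x x v x + s x x v v +
  s x v x x + s x v x v + s x v v x + s x v v v +
  s v x x x + s v x x v + s v x v x + s v x v v +
  s v v x x + s v v x v + s v v v x + s v v v v.
  by rewrite /s mulmxDl !kE; ring.
rewrite !(s12 x v) !(s34 _ _ v x) !e4.
rewrite (s12 v x v v) !e4 e3.
have -> : s v v x x = s x x v v.
  rewrite /s (k_pair hk) (k_skew hk) k_skew' opprK.
  by rewrite -[k _ x v _](k_pair hk).
rewrite (s34 v v x v); ring.
Qed.

Definition Kmx x : 'M[R]_N := \matrix_(i, j) kap x (delta_mx 0 i) (delta_mx 0 j).

Lemma KmxE x y z : dot (y *m Kmx x) z = kap x y z.
Proof.
rewrite (linear_sum_delta (f := fun y => kap x y z)); last by move=> *; exact: kap_lin.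
rewrite dotE; under eq_bigr => j _ do rewrite mxE big_distrl /=.
rewrite exchange_big /=; apply: eq_bigr => i _.
rewrite kap_sym (linear_sum_delta (f := fun z => kap x z (delta_mx 0 i))); last first.
  by move=> *; exact: kap_lin.
rewrite big_distrr; apply: eq_bigr => j _ /=.
by rewrite mxE (kap_sym x (delta_mx 0 i)); ring.
Qed.

Lemma Kmx_sym x : (Kmx x)^T = Kmx x.
Proof. by apply/matrixP => i j; rewrite !mxE kap_sym. Qed.

Lemma KmxP x y z : (forall w, kap x y w = dot z w) -> y *m Kmx x = z.
Proof. by move=> h; apply: dot_ext => w; rewrite KmxE. Qed.

Lemma Kmx_x0 x : x *m Kmx x = 0.
Proof. by apply: KmxP => w; rewrite kap_x0 dot0l. Qed.

Definition Kmx' x : 'M[R]_N := J *m Kmx x *m J^T.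

Lemma Kmx'E x y z : dot (y *m Kmx' x) z = kap x (y *m J) (z *m J).
Proof. by rewrite /Kmx' !mulmxA dot_mulmx trmxK KmxE. Qed.

(** The space called T below: the orthogonal of the complex line through [x]. *)
Definition perpT x v := dot v x = 0 /\ dot v (x *m J) = 0.

Lemma perpTJ x v : perpT x v -> perpT x (v *m J).
Proof.
move=> [h1 h2]; split; last by rewrite dotJ.
by rewrite dotJl h2 oppr0.
Qed.

Lemma perpT_lin x a v w : perpT x v -> perpT x w -> perpT x (a *: v + w).
Proof.
by move=> [h1 h2] [h3 h4]; split; rewrite !dotE_lin ?h1 ?h2 ?h3 ?h4 mulr0 addr0.
Qed.

(** * Consequences of a maximum of the holomorphic curvature *)

Section Maximum.
Context (x : 'rV[R]_N) (M mt : R).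
Context (x1 : dot x x = 1) (hx : hol x = M).
Context (hM : forall y, hol y <= M * dot y y ^+ 2).
Context (hm : forall y, mt * dot y y ^+ 2 <= hol y).

(** The right-hand side is [M |x + t v|^4 - h(x + t v)], whose constant term vanishes at a
    maximum. *)
Lemma hol_expandt v t : dot v x = 0 ->
  0 <= (- 4 * kap x (x *m J) (v *m J)) * t +
    (2 * M * dot v v - 2 * kap x v v - 6 * kap x (v *m J) (v *m J)) * t ^+ 2 +
    (- 4 * kap v (v *m J) (x *m J)) * t ^+ 3 +
    (M * dot v v ^+ 2 - hol v) * t ^+ 4.
Proof.
move=> vx; have := hM (x + t *: v).
rewrite hol_expand holZ hx kapZ !dotE_lin x1 (dotC x v) vx -!scalemxAl.
rewrite /kap !kE; lra.
Qed.

Lemma crit v : dot v x = 0 -> kap x (x *m J) (v *m J) = 0.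
Proof.
move=> vx; have [h _ _] := quartic_ge0 (fun t => hol_expandt t vx); lra.
Qed.

Lemma hess v : dot v x = 0 ->
  kap x v v + 3 * kap x (v *m J) (v *m J) <= M * dot v v.
Proof.
move=> vx; have [_ h _] := quartic_ge0 (fun t => hol_expandt t vx); lra.
Qed.

Lemma hess_flat v : dot v x = 0 ->
  kap x v v + 3 * kap x (v *m J) (v *m J) = M * dot v v ->
  kap v (v *m J) (x *m J) = 0.
Proof.
move=> vx e; have [_ _ h] := quartic_ge0 (fun t => hol_expandt t vx); lra.
Qed.

Lemma kap_xJ v : kap x (x *m J) v = M * dot (x *m J) v.
Proof.
pose c := dot (x *m J) v; pose w := v - c *: (x *m J).
have wx : dot (w *m J) x = 0.
  by rewrite dotJl /w dotBl dotZl dotJ x1 (dotC v) /c; ring.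
have := crit wx; rewrite J2.
have -> : v = w + c *: (x *m J) by rewrite /w subrK.
have -> : dot (x *m J) (w + c *: (x *m J)) = c.
  by rewrite /w subrK.
have := hx; rewrite /hol /kap !kE => ->; lra.
Qed.

Lemma Kmx_xJ : x *m J *m Kmx x = M *: (x *m J).
Proof. by apply: KmxP => w; rewrite kap_xJ dotZl. Qed.

(** Adding the lower bounds of [h] at [x + v] and [x - v] removes the terms of odd degree. *)
Lemma hol_pm v : dot v x = 0 ->
  2 * M + 2 * hol v + 4 * kap x v v + 12 * kap x (v *m J) (v *m J) >=
  2 * mt * (1 + dot v v) ^+ 2.
Proof.
move=> vx; have := hm (x + v); have := hm (x - v).
rewrite !hol_expand !dotE_lin x1 (dotC x v) vx hx mulNmx /hol mulNmx /kap !kE.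
lra.
Qed.

Context (M0 : 0 < M).

(** A unit eigenvector [y] for [L > M] is orthogonal to [x] and [Jx], whose eigenvalues are 0 and
    [M]. Then [hess] at [Jy] gives [K(Jy, Jy) <= M - 3 L], and [hol_pm] at [y] gives
    [8 mt <= 16 M - 32 L], which contradicts [mt >= - 2 M]: this is where the constant 2 comes
    from. *)
Lemma top_bound_x : - 2 * M <= mt -> forall y, kap x y y <= M * dot y y.
Proof.
case: (posnP N) => [N0 _ y|N0 hmt].
  have := x1; rewrite dotE big1 => [|i _]; first by move/eqP; rewrite eq_sym oner_eq0.
  by have := ltn_ord i; rewrite {2}N0.
have [y [L [y1 yL le]]] : exists y L, [/\ dot y y = 1, y *m Kmx x = L *: y &
    forall z, dot (z *m Kmx x) z <= L * dot z z].
  have := Kmx_sym x; move: (Kmx x); rewrite -(prednK N0) => A.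
  exact: top_eigenvector.
have LM : L <= M.
  rewrite leNgt; apply/negP => ML.
  have eL z : kap x y z = L * dot y z by rewrite -KmxE yL dotZl.
  have yx : dot y x = 0.
    have := eL x; rewrite kap_sym kap_x0 => /esym/eqP.
    by rewrite mulf_eq0 (gt_eqF (lt_trans M0 ML)) => /eqP.
  have yxJ : dot y (x *m J) = 0.
    have := eL (x *m J); rewrite kap_sym kap_xJ dotC => /eqP.
    by rewrite -subr_eq0 -mulrBl mulf_eq0 subr_eq0 (lt_eqF ML) => /eqP.
  have yJx : dot (y *m J) x = 0 by rewrite dotJl yxJ oppr0.
  have h1 := hess yJx; rewrite J2 dotJ kapNN y1 in h1.
  have h2 := hol_pm yx; have h3 := hM y.
  by rewrite y1 in h2 h3; have := eL y; rewrite y1; lra.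
by move=> z; rewrite -KmxE; apply: le_trans (le z) _; rewrite ler_wpM2r ?dot_ge0.
Qed.

(** The two inequalities behind [top_bound_x] give [4 K(w, w) <= 2 M - mt] for every unit [w] in
    T. *)
Lemma top_simple v : - 2 * M < mt -> perpT x v -> v != 0 ->
  kap x v v < M * dot v v.
Proof.
move=> hmt [vx vxJ] v0; have [a [a0 a1 a2]] := normalize v0.
suff : kap x (a *: v) (a *: v) < M.
  rewrite /kap !kE -/(kap x v v) mulrA -expr2 a2 -/(kap x v v).
  by rewrite mulrC ltr_pdivrMr ?dot_gt0.
set w := a *: v in a1 *.
have wx : dot w x = 0 by rewrite dotZl vx mulr0.
have wJx : dot (w *m J) x = 0 by rewrite dotJl dotZl vxJ mulr0 oppr0.
have := hess wJx; have := hol_pm wx; have := hM w.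
rewrite J2 dotJ a1 kapNN; lra.
Qed.

End Maximum.

(** * Second-order perturbation of the top eigenvalue *)

Section Decomposition.
Context (x : 'rV[R]_N) (M : R).
Context (x1 : dot x x = 1) (M0 : 0 < M).
Context (xJ : forall v, kap x (x *m J) v = M * dot (x *m J) v).
Context (hS : forall v, perpT x v -> v != 0 -> kap x v v < M * dot v v).
Context (hG : forall u y, kap u y y <= M * dot u u * dot y y).
Context (htop : forall u, u != 0 ->
  exists y, [/\ y != 0, dot y u = 0 & kap u y y = M * dot u u * dot y y]).

(** The deficit in the bound [K_u(y', y') <= M |u|^2 |y'|^2], where [y'] is the component of [y]
    orthogonal to [u], multiplied out so as to be polynomial in [u] and [y]. *)
Definition Gap u y := M * (dot u u * dot y y - dot u y ^+ 2) - kap u y y.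

Lemma Gap_shift u y c : Gap u (y + c *: u) = Gap u y.
Proof.
rewrite /Gap !dotE_lin (dotC y u).
have -> : kap u (y + c *: u) (y + c *: u) = kap u y y.
  have h := kap_x0 u; rewrite [kap u _ _]/kap !kE.
  rewrite -[k u u u y]/(kap u u y) -[k y u u u]/(kap u y u) (kap_sym u y) !h.
  by rewrite -[k u u u u]/(kap u u u) h /kap; ring.
ring.
Qed.

Lemma Gap_ge0 u y : 0 <= Gap u y.
Proof.
have [->|u0] := eqVneq u 0; first by rewrite /Gap !dot0l kapxy /kap k0; lra.
pose c := dot y u / dot u u.
have e : dot u (y - c *: u) = 0.
  rewrite dotBr dotZr /c (dotC u y) divfK ?subrr // dot_eq0 //.
have := hG u (y - c *: u).
have -> : Gap u y = Gap u (y - c *: u) by rewrite -scaleNr Gap_shift.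
rewrite /Gap e; lra.
Qed.

Definition Bf v w := M * dot v w - kap x v w.
(** The term coupling a variation [v] of [x] with a variation [w] of [Jx], expressed in [u = Jv]. *)
Definition Gf u w := 2 * kap x u w + kap x (u *m J) (w *m J).

(** The terms of order 0 and 1 vanish because [Jx] is an eigenvector for [M] at [x]. The coefficient
    of [t^2] is the null form in [u = Jv] and [w]. *)
Lemma Gap_expand v w t : perpT x v -> perpT x w ->
  Gap (x + t *: v) (x *m J + t *: w) =
  t ^+ 2 * (Bf w w - 2 * Gf (v *m J) w + Bf (v *m J) (v *m J))
  - t ^+ 3 * (kap2 x v w w + 2 * kap v (x *m J) w) + t ^+ 4 * Gap v w.
Proof.
move=> [vx vxJ] [wx wxJ].
have e1 : kap2 x v (x *m J) w = Gf (v *m J) w.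
  by rewrite kap2_Jx /Gf J2 /kap !kE.
have e2 : kap v (x *m J) (x *m J) = kap x (v *m J) (v *m J).
  by rewrite kapxy kapJ.
have e3 : kap2 x v (x *m J) (x *m J) = 0.
  by rewrite kap2_JxJx xJ dotJ (dotC x) vx; ring.
have e4 : kap x (x *m J) (x *m J) = M by rewrite xJ dotJ x1 mulr1.
have e5 : kap x (x *m J) w = 0 by rewrite xJ (dotC _ w) wxJ mulr0.
have e6 : kap2 x (t *: v) (x *m J + t *: w) (x *m J + t *: w) =
   t * (kap2 x v (x *m J) (x *m J) + 2 * t * kap2 x v (x *m J) w
     + t ^+ 2 * kap2 x v w w).
  have : t ^+ 2 * kap2 x v w (x *m J) = t ^+ 2 * kap2 x v (x *m J) w.
    by rewrite kap2_sym.
  by rewrite /kap2 !kE; lra.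
have e7 u : kap u (x *m J + t *: w) (x *m J + t *: w) =
   kap u (x *m J) (x *m J) + 2 * t * kap u (x *m J) w + t ^+ 2 * kap u w w.
  have : t * kap u w (x *m J) = t * kap u (x *m J) w by rewrite kap_sym.
  by rewrite /kap !kE; lra.
rewrite /Gap kapD kapZ e6 !e7 e1 e2 e3 e4 e5 /Bf !dotE_lin !dotJ.
rewrite (dotC x v) (dotC (x *m J) w) (dotC x w) vx wx wxJ vxJ dotxJ x1.
ring.
Qed.

Lemma Gap_expand0 v w t : perpT x v -> perpT x w ->
  Gap (x + t *: v) w = Bf w w - t * kap2 x v w w + t ^+ 2 * Gap v w.
Proof.
move=> [vx vxJ] [wx wxJ].
have e6 : kap2 x (t *: v) w w = t * kap2 x v w w.
  by rewrite /kap2 !kE; ring.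
rewrite /Gap kapD kapZ e6 /Bf !dotE_lin (dotC x v) (dotC x w) vx wx x1; ring.
Qed.

Lemma perpT0 : perpT x 0.
Proof. by split; rewrite dot0l. Qed.

Lemma perpTZ a v : perpT x v -> perpT x (a *: v).
Proof. by move=> h; rewrite -[_ *: _]addr0; apply: perpT_lin h perpT0. Qed.

Lemma null_form_ge0 u w : perpT x u -> perpT x w ->
  0 <= Bf w w - 2 * Gf u w + Bf u u.
Proof.
move=> uT wT; pose v := - (u *m J).
have vT : perpT x v by rewrite /v -scaleN1r; apply/perpTZ/perpTJ.
have vJ : v *m J = u by rewrite mulNmx J2 opprK.
apply: (@lim_ge0 _ _ (- (kap2 x v w w + 2 * kap v (x *m J) w)) (Gap v w)) => t t0.
have := Gap_ge0 (x + t *: v) (x *m J + t *: w).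
rewrite Gap_expand // vJ.
set A := Bf w w - _ + _; set B := (_ + 2 * _); set C := Gap v w.
have -> : t ^+ 2 * A - t ^+ 3 * B + t ^+ 4 * C =
  t ^+ 2 * (A + - B * t + C * t ^+ 2) by ring.
by rewrite pmulr_rge0 // lt_def sqr_ge0 sqrf_eq0 t0.
Qed.

(* M - K on T, made invertible on the whole space. *)
Definition Bmx : 'M[R]_N := M%:M - Kmx x + (x *m J)^T *m (x *m J).

Lemma BmxE v w : dot (v *m Bmx) w =
  M * dot v w - kap x v w + dot v (x *m J) * dot w (x *m J).
Proof.
rewrite /Bmx mulmxDr mulmxBr mul_mx_scalar dotDl dotBl dotZl KmxE; congr (_ + _).
rewrite mulmxA.
have -> : v *m (x *m J)^T = (dot v (x *m J))%:M by rewrite [LHS]mx11_scalar.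
by rewrite mul_scalar_mx dotZl (dotC w).
Qed.

Lemma Bmx_sym : Bmx^T = Bmx.
Proof.
by rewrite /Bmx linearD linearB /= tr_scalar_mx Kmx_sym trmx_mul trmxK.
Qed.

Lemma split_T y : exists a b w, y = a *: x + (b *: (x *m J) + w) /\ perpT x w.
Proof.
exists (dot y x), (dot y (x *m J)), (y - dot y x *: x - dot y (x *m J) *: (x *m J)).
split; first by apply/rowP => i; rewrite !mxE; ring.
by split; rewrite !dotE_lin ?dotJ ?dotxJ ?dotJx x1; ring.
Qed.

Lemma Bmx_pos y : y != 0 -> 0 < dot (y *m Bmx) y.
Proof.
have [a [b [w [-> [wx wxJ]]]]] := split_T y => y0.
have -> : dot ((a *: x + (b *: (x *m J) + w)) *m Bmx)
    (a *: x + (b *: (x *m J) + w)) = M * a ^+ 2 + b ^+ 2 + Bf w w.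
  rewrite BmxE.
  have -> : kap x (a *: x + (b *: (x *m J) + w)) (a *: x + (b *: (x *m J) + w)) =
    b ^+ 2 * M + kap x w w.
    have h z : kap x x z = 0 by exact: kap_x0.
    have h' z : kap x z x = 0 by rewrite kap_sym h.
    have e5 : kap x (x *m J) w = 0 by rewrite xJ (dotC _ w) wxJ mulr0.
    have e6 : kap x w (x *m J) = 0 by rewrite kap_sym.
    have e4 : kap x (x *m J) (x *m J) = M by rewrite xJ dotJ x1 mulr1.
    move: h h' e4 e5 e6; rewrite /kap => h h' e4 e5 e6.
    by rewrite !kE !h !h' e4 e5 e6; ring.
  rewrite !dotE_lin dotJ (dotC x w) (dotC _ w) wx wxJ dotxJ dotJx x1 /Bf.
  ring.
have [w0|w0] := eqVneq w 0.
  rewrite w0 /Bf dot0l /kap !k0 mulr0 subrr addr0.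
  have h : (a != 0) || (b != 0).
    apply: contraNT y0; rewrite negb_or !negbK => /andP[/eqP-> /eqP->].
    by rewrite w0 !scale0r !addr0.
  have h1 : 0 <= M * a ^+ 2 by rewrite mulr_ge0 ?sqr_ge0 // ltW.
  have h2 := sqr_ge0 b.
  rewrite lt_def addr_ge0 // andbT paddr_eq0 // mulf_eq0 !sqrf_eq0 gt_eqF //=.
  by rewrite negb_and.
have : 0 < Bf w w by rewrite /Bf subr_gt0 hS.
have : 0 <= M * a ^+ 2 by rewrite mulr_ge0 ?sqr_ge0 // ltW.
have := sqr_ge0 b; lra.
Qed.

Lemma Bmx_unit : Bmx \in unitmx.
Proof.
rewrite -row_free_unit -kermx_eq0; apply/rowV0P => v /sub_kermxP vB.
apply/eqP; apply: contraT => /Bmx_pos; rewrite vB dot0l ltxx //.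
Qed.

Lemma Bf_bound : exists2 b, 0 < b &
  forall w, perpT x w -> b * dot w w <= Bf w w.
Proof.
have [b b0 hb] := posdef_bound Bmx_sym Bmx_pos.
exists b => // w [wx wxJ]; have := hb w.
by rewrite BmxE wxJ mulr0 addr0.
Qed.

Lemma kap2_bound v : exists2 C, 0 <= C &
  forall w, kap2 x v w w <= C * dot w w.
Proof.
pose A : 'M[R]_N := Kmx (x + v) - Kmx x - Kmx v.
have sA : A^T = A by rewrite /A !linearB /= !Kmx_sym.
have [C C0 hC] := form_bound sA; exists C => // w.
by have := hC w; rewrite /A !mulmxBr !dotBl !KmxE kapD; lra.
Qed.

Lemma lin_bound (v : 'rV[R]_N) w : 2 * dot v w <= dot v v + dot w w.
Proof. by have := dot_ge0 (v - w); rewrite !dotE_lin (dotC w v); lra. Qed.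

Lemma Bf_lin a v v' w : Bf (a *: v + v') w = a * Bf v w + Bf v' w.
Proof. by rewrite /Bf kap_lin !dotE_lin; ring. Qed.

Lemma Bf_sym v w : Bf v w = Bf w v.
Proof. by rewrite /Bf dotC kap_sym. Qed.

(* The top eigenvalue M is attained at x + t v for every t; expanding to second
   order in t, the null form in (u, w) cannot be positive for all w. *)
Lemma null_vector u : perpT x u ->
  exists w, [/\ perpT x w, forall z, perpT x z -> Bf w z = Gf u z &
    Bf w w - 2 * Gf u w + Bf u u = 0].
Proof.
move=> uT.
(* For fixed [u], the minimum of the null form in [w] is at the solution of [B w = G u], with
   [B = M - K] and [G = 2 K + JKJ^-1]. *)
pose w0 := u *m (2 *: Kmx x + Kmx' x) *m invmx Bmx.
have w0B z : dot (w0 *m Bmx) z = Gf u z.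
  rewrite /w0 mulmxKV ?Bmx_unit // mulmxDr -scalemxAr dotDl dotZl KmxE Kmx'E.
  by [].
have w0T : perpT x w0.
  have h1 := w0B x; have h2 := w0B (x *m J).
  rewrite BmxE kap_sym kap_x0 dotxJ in h1.
  rewrite BmxE (kap_sym x w0) xJ (dotC _ w0) dotJ x1 in h2.
  have e1 : Gf u x = 0.
    rewrite /Gf (kap_sym x u) kap_x0 (kap_sym x (u *m J)) xJ dotJ (dotC x).
    by case: uT => -> _; ring.
  have e2 : Gf u (x *m J) = 0.
    rewrite /Gf (kap_sym x u) xJ (dotC _ u) (kap_sym x (u *m J)) J2 /kap !kE.
    by rewrite -[k x x x _]/(kap x x _) kap_x0; case: uT => _ ->; ring.
  split; last by lra.
  have : M * dot w0 x = 0 by lra.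
  by move/eqP; rewrite mulf_eq0 gt_eqF //= => /eqP.
have w0B' z : perpT x z -> Bf w0 z = Gf u z.
  by move=> [_ zxJ]; rewrite -w0B BmxE zxJ mulr0 addr0.
exists w0; split=> //.
set c := (_ - _ + _).
have c0 : 0 <= c by apply: null_form_ge0.
apply/eqP; rewrite eq_le c0 andbT leNgt; apply/negP => cp.
have qE w : perpT x w ->
    Bf w w - 2 * Gf u w + Bf u u = c + Bf (w - w0) (w - w0).
  move=> wT; rewrite /c -(w0B' w wT) -(w0B' w0 w0T).
  have h y y' z : Bf (y - y') z = Bf y z - Bf y' z.
    by rewrite addrC -scaleN1r Bf_lin; ring.
  rewrite h !(Bf_sym _ (w - w0)) !h (Bf_sym w0 w); ring.
have [b b0 hb] := Bf_bound.
pose v := - (u *m J).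
have vT : perpT x v by rewrite /v -scaleN1r; apply/perpTZ/perpTJ.
have vJ : v *m J = u by rewrite mulNmx J2 opprK.
have [C1 C10 hC1] := kap2_bound v.
pose a := x *m J *m Kmx v.
pose C := C1 + 1 + dot a a.
have Cp : 0 < C by rewrite /C; have := dot_ge0 a; lra.
(* If the minimum [c] is positive, then since [|w|^2 <= 2 |w - w0|^2 + 2 |w0|^2], this [e] gives
   [e (1 + |w|^2) <= c + b |w - w0|^2], hence a lower bound of the null form uniform in [w]. *)
pose e := Num.min (b / 2) (c / (1 + 2 * dot w0 w0)).
have d0 : 0 < 1 + 2 * dot w0 w0 by have := dot_ge0 w0; lra.
have ep : 0 < e by rewrite lt_min !divr_gt0.
have eb : e <= b / 2 by rewrite ge_min lexx.
have ec : e * (1 + 2 * dot w0 w0) <= c.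
  by rewrite -ler_pdivlMr // ge_min lexx orbT.
have q_ge w : perpT x w -> e * (1 + dot w w) <= Bf w w - 2 * Gf u w + Bf u u.
  move=> wT; rewrite qE //.
  have zT : perpT x (w - w0) by rewrite addrC -scaleN1r; apply: perpT_lin.
  have h1 := hb _ zT.
  have h2 : dot w w <= 2 * dot (w - w0) (w - w0) + 2 * dot w0 w0.
    have := dot_ge0 (w - 2 *: w0).
    by rewrite !dotE_lin (dotC w0 w); lra.
  have h3 : e * dot w w <= e * (2 * dot (w - w0) (w - w0) + 2 * dot w0 w0).
    by rewrite ler_pM2l.
  have h4 : e * dot (w - w0) (w - w0) <= b / 2 * dot (w - w0) (w - w0).
    by rewrite ler_wpM2r ?dot_ge0.
  lra.
(* With [t C] at most [e / 2] and [b / 2], the next term of the expansion takes at most half of the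
   leading bound, both along [Jx + t w] and along T. *)
pose t := Num.min (e / (2 * C)) (b / (2 * C)).
have tp : 0 < t by rewrite lt_min !divr_gt0 // mulr_gt0.
have te : t * C <= e / 2.
  rewrite -ler_pdivlMr // ge_min; apply/orP; left.
  by rewrite le_eqVlt; apply/orP; left; apply/eqP; field; rewrite gt_eqF.
have tb : t * C <= b / 2.
  rewrite -ler_pdivlMr // ge_min; apply/orP; right.
  by rewrite le_eqVlt; apply/orP; left; apply/eqP; field; rewrite gt_eqF.
pose xt := x + t *: v.
have pos1 w : perpT x w -> 0 < Gap xt (x *m J + t *: w).
  move=> wT; rewrite Gap_expand // vJ.
  have h1 := q_ge _ wT; have h2 := Gap_ge0 v w.
  have h3 : kap2 x v w w + 2 * kap v (x *m J) w <= C * (1 + dot w w).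
    have := hC1 w; have := lin_bound a w.
    rewrite -KmxE -/a /C; have := dot_ge0 a; have := dot_ge0 w.
    move=> hw ha; have := mulr_ge0 ha hw; lra.
  have h4 : t * (kap2 x v w w + 2 * kap v (x *m J) w) <= e / 2 * (1 + dot w w).
    apply: le_trans (_ : t * (C * (1 + dot w w)) <= _); first by rewrite ler_pM2l.
    by rewrite mulrA ler_wpM2r //; have := dot_ge0 w; lra.
  set A := (X in t ^+ 2 * X); set B := (X in t ^+ 3 * X).
  have {}h1 : e * (1 + dot w w) <= A by [].
  have {}h4 : t * B <= e / 2 * (1 + dot w w) by [].
  clearbody A B.
  have -> : t ^+ 2 * A - t ^+ 3 * B + t ^+ 4 * Gap v w =
    t ^+ 2 * (A - t * B + t ^+ 2 * Gap v w) by ring.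
  rewrite pmulr_rgt0 ?exprn_gt0 //.
  have h5 : 0 <= t ^+ 2 * Gap v w by rewrite mulr_ge0 ?sqr_ge0.
  have h6 : 0 <= e * dot w w by rewrite mulr_ge0 ?dot_ge0 // ltW.
  have h7 : 0 < e by [].
  lra.
have pos2 w : perpT x w -> w != 0 -> 0 < Gap xt w.
  move=> wT w0'; rewrite Gap_expand0 //.
  have h1 := hb _ wT; have h2 := Gap_ge0 v w; have h3 := hC1 w.
  have wp : 0 < dot w w by rewrite dot_gt0.
  have h5 : 0 <= t ^+ 2 * Gap v w by rewrite mulr_ge0 ?sqr_ge0.
  have h4 : t * kap2 x v w w <= b / 2 * dot w w.
    apply: le_trans (_ : t * (C * dot w w) <= _).
      rewrite ler_pM2l //; apply: le_trans h3 _; rewrite ler_pM2r // /C.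
      by have := dot_ge0 a; lra.
    by rewrite mulrA ler_pM2r.
  have := mulr_gt0 b0 wp; lra.
have xt0 : xt != 0.
  apply/negP => /eqP /(congr1 (dot^~ x)).
  rewrite dot0l /xt dotDl dotZl x1; case: vT => -> _.
  by move/eqP; rewrite mulr0 addr0 oner_eq0.
(* Modulo [xt], this top eigenvector is a multiple of [Jx] plus a vector of T. Up to scaling, [pos1]
   applies if the multiple is nonzero and [pos2] otherwise, so its [Gap] cannot vanish. *)
have [y [y0 yxt yG]] := htop xt0.
have G0 : Gap xt y = 0 by rewrite /Gap (dotC xt) yxt yG; ring.
have [al [be [w [yE wT]]]] := split_T y.
have e1 : Gap xt y = Gap xt (be *: (x *m J) + (w - (al * t) *: v)).
  rewrite -(Gap_shift xt y (- al)); congr (Gap xt _).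
  by rewrite yE /xt; apply/rowP => i; rewrite !mxE; ring.
set w' := w - _ in e1.
have w'T : perpT x w' by rewrite /w' addrC -scaleNr; apply: perpT_lin.
have [be0|be0] := eqVneq be 0.
  have [w'0|w'0] := eqVneq w' 0.
    have yE' : y = al *: xt.
      have : w = (al * t) *: v by apply/eqP; rewrite -subr_eq0 -/w' w'0.
      by rewrite yE be0 scale0r add0r => ->; rewrite scalerDr scalerA.
    move: yxt; rewrite yE' dotZl => /eqP; rewrite mulf_eq0 dot_eq0 (negbTE xt0).
    by rewrite orbF => /eqP al0; move: y0; rewrite yE' al0 scale0r eqxx.
  have := pos2 _ w'T w'0.
  have <- : Gap xt y = Gap xt w' by rewrite e1 be0 scale0r add0r.
  by rewrite G0 ltxx.
have h := pos1 ((t * be)^-1 *: w') (perpTZ _ w'T).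
have e2 : Gap xt y = be ^+ 2 * Gap xt (x *m J + t *: ((t * be)^-1 *: w')).
  rewrite e1; have -> : be *: (x *m J) + w' =
      be *: (x *m J + t *: ((t * be)^-1 *: w')).
    rewrite scalerDr !scalerA; congr (_ + _).
    have -> : be * t / (t * be) = 1 by field; rewrite be0 gt_eqF.
    by rewrite scale1r.
  set y' := (_ + _ in X in _ = _ * Gap _ X); by rewrite /Gap /kap kZ1 kZ4 !dotZl !dotZr; ring.
have : 0 < Gap xt y by rewrite e2 pmulr_rgt0 // lt_def sqr_ge0 sqrf_eq0 be0.
by rewrite G0 ltxx.
Qed.

(** A zero [(u, w)] of the nonnegative null form lies in its kernel, so [B w = G u] and [B u = G w].
    Hence [B + G] kills [u - w] and [B - G] kills [u + w], which are the two displayed equations. *)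
Lemma decomposition u : perpT x u ->
  exists a b, [/\ u = a + b, perpT x a /\ perpT x b,
    (forall z, perpT x z -> kap x a z + kap x (a *m J) (z *m J) = - M * dot a z) &
    (forall z, perpT x z -> 3 * kap x b z + kap x (b *m J) (z *m J) = M * dot b z)].
Proof.
move=> uT; have [w [wT wB w0]] := null_vector uT.
have wG z : perpT x z -> Bf u z = Gf z w.
  move=> zT.
  suff : 2 * (Bf u z - Gf z w) = 0 by lra.
  apply: (@quad_lin0 _ (Bf z z)) => t.
  have uzT : perpT x (t *: z + u) by apply: perpT_lin.
  have := null_form_ge0 uzT wT; rewrite Bf_lin (Bf_sym z) (Bf_sym u) !Bf_lin.
  have -> : Gf (t *: z + u) w = t * Gf z w + Gf u w.
    by rewrite /Gf mulmxDl -scalemxAl !kap_lin; ring.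
  rewrite (Bf_sym z u); lra.
have Gsym z y : Gf z y = Gf y z.
  by rewrite /Gf kap_sym (kap_sym x (z *m J)).
exists (2^-1 *: (u - w)), (2^-1 *: (u + w)); split.
- by apply/rowP => i; rewrite !mxE; field.
- by split; apply: perpTZ; [rewrite addrC -scaleN1r | rewrite -[u]scale1r];
    apply: perpT_lin.
- move=> z zT; have h1 := wB _ zT; have h2 := wG _ zT.
  rewrite Gsym in h2; move: h1 h2.
  by rewrite /Bf /Gf -!scalemxAl mulmxBl /kap !kE !dotE_lin; lra.
- move=> z zT; have h1 := wB _ zT; have h2 := wG _ zT.
  rewrite Gsym in h2; move: h1 h2.
  by rewrite /Bf /Gf -!scalemxAl mulmxDl /kap !kE !dotE_lin; lra.
Qed.

End Decomposition.

Definition isospectral := forall x u : 'rV[R]_N,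
  dot x x = 1 -> dot u u = 1 -> same_eig (Kmx x) (Kmx u).

Lemma eigen_transfer (x u : 'rV[R]_N) a (y : 'rV[R]_N) : isospectral -> dot x x = 1 -> dot u u = 1 ->
  y *m Kmx x = a *: y -> y != 0 ->
  exists2 z : 'rV[R]_N, z != 0 & z *m Kmx u = a *: z.
Proof.
move=> iso x1 u1 yK y0.
have h : \rank (eigenspace (Kmx u) a) != 0%N.
  rewrite -(iso x u) // mxrank_eq0; apply: contraNneq y0 => e0.
  by rewrite -submx0 -e0; apply/eigenspaceP.
have /rowV0Pn[z z1 z0] : eigenspace (Kmx u) a != 0 by rewrite -mxrank_eq0.
by exists z => //; apply/eigenspaceP.
Qed.

Lemma top_transfer x u c : isospectral -> dot x x = 1 -> dot u u = 1 ->
  (forall y, kap x y y <= c * dot y y) -> forall y, kap u y y <= c * dot y y.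
Proof.
move=> iso x1 u1 le y.
have [y2 [L [y1 yL leL]]] : exists y L, [/\ dot y y = 1, y *m Kmx u = L *: y &
    forall z, dot (z *m Kmx u) z <= L * dot z z].
  case: (posnP N) => [N0|N0].
    have := x1; rewrite dotE big1 => [|i _]; first by move/eqP; rewrite eq_sym oner_eq0.
    by have := ltn_ord i; rewrite {2}N0.
  have := Kmx_sym u; move: (Kmx u); rewrite -(prednK N0) => A.
  exact: top_eigenvector.
have y20 : y2 != 0 by rewrite -dot_gt0 y1.
have [z z0 zL] := eigen_transfer iso u1 x1 yL y20.
have Lc : L <= c.
  have := le z; rewrite -KmxE zL dotZl ler_pM2r // dot_gt0 //.
rewrite -KmxE; apply: le_trans (leL y) _.
by rewrite ler_wpM2r ?dot_ge0.
Qed.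

Lemma top_transferZ x c : isospectral -> dot x x = 1 ->
  (forall y, kap x y y <= c * dot y y) ->
  forall u y, kap u y y <= c * dot u u * dot y y.
Proof.
move=> iso x1 le u y; have [->|u0] := eqVneq u 0.
  by rewrite kapxy /kap k0 dot0l mulr0 mul0r.
have [a [a0 a1 a2]] := normalize u0.
have := top_transfer iso x1 a1 le y.
rewrite kapZ a2 ler_pdivrMl ?dot_gt0 //.
by rewrite mulrA (mulrC c).
Qed.

Definition Tmx x : 'M[R]_N := kermx (col_mx x (x *m J))^T.

Lemma TmxP x v : reflect (perpT x v) (v <= Tmx x)%MS.
Proof.
have e (y : 'rV[R]_N) : v *m y^T = (dot v y)%:M by rewrite [LHS]mx11_scalar.
apply: (iffP sub_kermxP); rewrite tr_col_mx mul_mx_row !e.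
  move=> h; split.
    have := congr1 (fun A : 'M[R]_(1, 1 + 1) => lsubmx A 0 0) h.
    by rewrite row_mxKl !mxE mulr1n.
  have := congr1 (fun A : 'M[R]_(1, 1 + 1) => rsubmx A 0 0) h.
  by rewrite row_mxKr !mxE mulr1n.
by move=> [-> ->]; rewrite !raddf0 row_mx0.
Qed.

Lemma pair_orth x : dot x x = 1 ->
  col_mx x (x *m J) *m (col_mx x (x *m J))^T = 1%:M.
Proof.
move=> x1; rewrite tr_col_mx mul_col_row.
have e (y z : 'rV[R]_N) : y *m z^T = (dot y z)%:M by rewrite [LHS]mx11_scalar.
by rewrite !e dotJ x1 dotxJ dotJx !raddf0 -scalar_mx_block.
Qed.

Lemma rank_Tmx x : dot x x = 1 -> \rank (Tmx x) = (N - 2)%N.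
Proof.
move=> x1; rewrite mxrank_ker mxrank_tr; congr (_ - _)%N.
by apply/eqP; apply: row_free_orth (pair_orth x1).
Qed.

Lemma rank_eig_split x m1 c a : dot x x = 1 ->
  x *m J *m Kmx x = m1 *: (x *m J) ->
  (forall v, perpT x v -> v *m Kmx x = c *: v) ->
  \rank (eigenspace (Kmx x) a) = ((a == 0%R) + (a == m1) + (a == c) * (N - 2))%N.
Proof.
move=> x1 xJK TK; have [E [EE ET]] := onb (Tmx x).
have ETr i : perpT x (row i E) by apply/TmxP; rewrite -ET row_sub.
pose P := col_mx (col_mx x (x *m J)) E.
have PP : P *m P^T = 1%:M.
  have e : E *m (col_mx x (x *m J))^T = 0.
    by apply/sub_kermxP; rewrite ET.
  have e' : col_mx x (x *m J) *m E^T = 0.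
    by rewrite -[LHS]trmxK trmx_mul trmxK e trmx0.
  by rewrite /P tr_col_mx mul_col_row pair_orth // EE e e' -scalar_mx_block.
pose C := block_mx (block_mx (0%:M : 'M[R]_1) 0 0 (m1%:M : 'M[R]_1)) 0 0
  (c%:M : 'M[R]_(\rank (Tmx x))).
have PK : P *m Kmx x = C *m P.
  apply: col_mx_intertwine.
    apply: col_mx_intertwine; rewrite mul_scalar_mx ?scale0r //.
    exact: Kmx_x0.
  by apply/row_matrixP => i; rewrite row_mul TK // mul_scalar_mx !rowE scalemxAr.
have Pf := row_free_orth PP.
have := eig_transfer a Pf PK.
have full : (1%:M <= P)%MS.
  rewrite sub1mx /row_full; move: Pf; rewrite /row_free => /eqP ->.
  have := rank_leq_col (col_mx x (x *m J)).
  have /eqP -> := row_free_orth (pair_orth x1) => N2.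
  by rewrite rank_Tmx // subnKC.
have -> : \rank (P :&: eigenspace (Kmx x) a)%MS = \rank (eigenspace (Kmx x) a).
  apply/eqmx_rank/andP; rewrite capmxSr sub_capmx submx_refl andbT; split=> //.
  exact: submx_trans (submx1 _) full.
move=> <-; rewrite /C !rank_eigenspace_block !rank_eigenspace_scalar rank_Tmx //.
by case: (a == 0); case: (a == m1); case: (a == c); rewrite ?mul1n ?mul0n.
Qed.

(** * The splitting [U1 + U3] of T at a maximum *)

Section Half.
Context (x : 'rV[R]_N) (M mt : R) (iso : isospectral).
Context (x1 : dot x x = 1) (hx : hol x = M).
Context (hM : forall y, hol y <= M * dot y y ^+ 2).
Context (hm : forall y, mt * dot y y ^+ 2 <= hol y).
Context (M0 : 0 < M).

Lemma half_top : - 2 * M <= mt ->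
  forall u y, kap u y y <= M * dot u u * dot y y.
Proof. by move=> h; apply: top_transferZ iso x1 _; apply: top_bound_x hm _ _. Qed.

Context (hmt : - 2 * M < mt).

Let hS v : perpT x v -> v != 0 -> kap x v v < M * dot v v.
Proof. exact: (top_simple x1 hx hM hm). Qed.

Let xJ := kap_xJ x1 hx hM.

Lemma half_decomposition u : perpT x u ->
  exists a b, [/\ u = a + b, perpT x a /\ perpT x b,
    (forall z, perpT x z -> kap x a z + kap x (a *m J) (z *m J) = - M * dot a z) &
    (forall z, perpT x z -> 3 * kap x b z + kap x (b *m J) (z *m J) = M * dot b z)].
Proof.
apply: decomposition => //; first by apply: half_top; exact: ltW.
move=> {}u u0; have [a [a0 a1 a2]] := normalize u0.
have xJK := Kmx_xJ x1 hx hM.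
have xJ0 : x *m J != 0 by rewrite -dot_gt0 dotJ x1.
have [y y0 yK] := eigen_transfer iso x1 a1 xJK xJ0.
exists y; split=> //.
  have : kap (a *: u) y (a *: u) = 0 by rewrite kap_sym kap_x0.
  rewrite -KmxE yK dotZl dotZr => /eqP.
  by rewrite !mulf_eq0 (gt_eqF M0) (gt_eqF a0) => /eqP.
have : kap (a *: u) y y = M * dot y y by rewrite -KmxE yK dotZl.
rewrite kapZ a2 => /(congr1 ( *%R (dot u u))).
by rewrite mulrA mulfV ?dot_eq0 // mul1r => ->; ring.
Qed.

Definition U1 := (Tmx x :&: eigenspace (Kmx x + Kmx' x) (- M))%MS.
Definition U3 := (Tmx x :&: eigenspace (3 *: Kmx x + Kmx' x) M)%MS.

Lemma Kmx_T v : perpT x v -> perpT x (v *m Kmx x).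
Proof.
move=> [vx vxJ]; split; rewrite KmxE kap_sym ?kap_x0 //.
by rewrite xJ dotC vxJ mulr0.
Qed.

Lemma Kmx'_T v : perpT x v -> perpT x (v *m Kmx' x).
Proof.
move=> vT; rewrite /Kmx' !mulmxA JTN mulmxN -scaleN1r -[_ *: _]addr0.
apply: perpT_lin; last by split; rewrite dot0l.
by apply/perpTJ/Kmx_T/perpTJ.
Qed.

Lemma T_eq v w : perpT x v -> perpT x w ->
  (forall z, perpT x z -> dot v z = dot w z) -> v = w.
Proof.
move=> vT wT h; apply/eqP; rewrite -subr_eq0 -dot_eq0.
have T : perpT x (v - w) by rewrite addrC -scaleN1r; apply: perpT_lin.
by rewrite dotBl h // subrr.
Qed.

Lemma U1P v : reflect (perpT x v /\ forall z, perpT x z ->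
    kap x v z + kap x (v *m J) (z *m J) = - M * dot v z) (v <= U1)%MS.
Proof.
rewrite sub_capmx; apply: (iffP andP) => [[/TmxP vT /eigenspaceP e]|[vT e]].
  split=> // z _; rewrite -KmxE -Kmx'E -dotDl -mulmxDr e dotZl //.
split; first exact/TmxP.
apply/eigenspaceP; rewrite mulmxDr; apply: T_eq.
- by rewrite -[X in X + _]scale1r; apply: perpT_lin; [exact: Kmx_T | exact: Kmx'_T].
- by rewrite -[_ *: _]addr0; apply: perpT_lin => //; split; rewrite dot0l.
by move=> z zT; rewrite dotDl KmxE Kmx'E e // dotZl.
Qed.

Lemma U3P v : reflect (perpT x v /\ forall z, perpT x z ->
    3 * kap x v z + kap x (v *m J) (z *m J) = M * dot v z) (v <= U3)%MS.
Proof.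
rewrite sub_capmx; apply: (iffP andP) => [[/TmxP vT /eigenspaceP e]|[vT e]].
  split=> // z _; rewrite -KmxE -Kmx'E -dotZl -dotDl scalemxAr -mulmxDr e dotZl //.
split; first exact/TmxP.
apply/eigenspaceP; rewrite mulmxDr -scalemxAr; apply: T_eq.
- by apply: perpT_lin; [exact: Kmx_T | exact: Kmx'_T].
- by rewrite -[_ *: _]addr0; apply: perpT_lin => //; split; rewrite dot0l.
by move=> z zT; rewrite dotDl dotZl KmxE Kmx'E e // dotZl.
Qed.

Lemma U13_sum : (Tmx x <= U1 + U3)%MS.
Proof.
apply/rV_subP => v /TmxP vT; have [a [b [-> [aT bT] ha hb]]] := half_decomposition vT.
by apply: addmx_sub_adds; [apply/U1P | apply/U3P].
Qed.

(** Subtracting the two equations gives [K = M] on the intersection, against the simplicity of the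
    top eigenvalue. *)
Lemma U13_cap : (U1 :&: U3 = 0)%MS.
Proof.
apply/eqP/rowV0P => v; rewrite sub_capmx => /andP[/U1P[vT h1] /U3P[_ h3]].
apply/eqP; apply: contraT => v0; have := hS vT v0.
have := h1 _ vT; have := h3 _ vT; lra.
Qed.

Lemma rank_U13 : (\rank U1 + \rank U3 = N - 2)%N.
Proof.
rewrite -(rank_Tmx x1) -mxrank_sum_cap U13_cap mxrank0 addn0.
apply/eqmx_rank/andP; split; last exact: U13_sum.
by rewrite addsmx_sub !capmxSl.
Qed.

(** [K + JKJ^-1] commutes with [J], whereas [3 K + JKJ^-1] need not. *)
Lemma U1_J : (U1 *m J <= U1)%MS.
Proof.
apply/rV_subP => v /submxP[w ->]; rewrite mulmxA.
have /U1P[vT h] : (w *m U1 <= U1)%MS by apply: submxMl.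
apply/U1P; split=> [|z zT]; first exact: perpTJ.
have zJT := perpTJ zT; have := h _ zJT.
rewrite !J2 [kap x (- _) _]/kap /kap !kE dotJl; lra.
Qed.

Lemma even_rank_U1 : ~~ odd (\rank U1).
Proof. exact: rank_stable_even JJ U1_J. Qed.

(* K is positive on <Jx> + U3, since 3K = M - K' there and K' < M. *)
Lemma pos_U3 v : (v <= x *m J + U3)%MS -> v != 0 -> 0 < kap x v v.
Proof.
move=> /sub_addsmxP[[a b] /= ->]; set w := b *m U3.
have /U3P[wT hw] : (w <= U3)%MS by apply: submxMl.
have -> : a *m (x *m J) = a 0 0 *: (x *m J).
  by rewrite {1}[a]mx11_scalar mul_scalar_mx.
set c := a 0 0 => v0.
have e5 : kap x (x *m J) w = 0 by case: wT => _ h; rewrite xJ (dotC _ w) h mulr0.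
have e6 : kap x w (x *m J) = 0 by rewrite kap_sym.
have e4 : kap x (x *m J) (x *m J) = M by rewrite xJ dotJ x1 mulr1.
have -> : kap x (c *: (x *m J) + w) (c *: (x *m J) + w) = M * c ^+ 2 + kap x w w.
  by rewrite kap_lin !(kap_sym x _ (_ + _)) !kap_lin e4 e5 e6; ring.
have h1 : 0 <= M * c ^+ 2 by rewrite mulr_ge0 ?sqr_ge0 // ltW.
have [w0|w0] := eqVneq w 0.
  have c0 : c != 0.
    by apply: contraNneq v0 => ->; rewrite w0 scale0r addr0.
  rewrite w0 /kap k0 addr0 lt_def h1 andbT mulf_eq0 sqrf_eq0 (negbTE c0) orbF.
  by rewrite gt_eqF.
have wJ0 : w *m J != 0 by rewrite J_eq0.
have := hS (perpTJ wT) wJ0; have := hw _ wT; rewrite dotJ; lra.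
Qed.

Lemma rank_JU3 : \rank (x *m J + U3)%MS = (\rank U3).+1.
Proof.
have h : (x *m J :&: U3 = 0)%MS.
  apply/eqP/rowV0P => v; rewrite sub_capmx => /andP[/sub_rVP[a ->] /U3P[[_ h] _]].
  by move: h; rewrite dotZl dotJ x1 mulr1 => ->; rewrite scale0r.
have := mxrank_sum_cap (x *m J) U3; rewrite h mxrank0 addn0 => ->.
rewrite rank_rV; have -> : x *m J != 0 by rewrite -dot_gt0 dotJ x1.
by rewrite add1n.
Qed.

(** No orthogonality between [U1] and [U3] has been established, so traces are not computed in a
    basis adapted to both. Instead [K + JKJ^-1], of trace [2 tr K], is bounded above by an explicit
    operator: it is [- M] on [U1], and at most [M / 2] on the rest of T, by adding the Hessian
    bounds at [r] and [Jr]. *)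
Lemma trace_le : 2 * \tr (Kmx x) <=
  2 * M - M * (\rank U1)%:R + M / 2 * (\rank U3)%:R.
Proof.
have [E [EE EU]] := onb U1.
pose A := Kmx x + Kmx' x.
have trA : \tr A = 2 * \tr (Kmx x).
  rewrite /A linearD /= /Kmx' mxtrace_mulC mulmxA JTN mulNmx JJ opprK mul1mx.
  by ring.
(* The comparison operator has values [M/2 + M/2 = M] on [x], [Jx], then [M/2 - 3M/2 = - M] on [U1],
   and [M/2] on the orthogonal of both. *)
pose C := (M / 2) *: 1%:M + (M / 2) *: (x^T *m x + (x *m J)^T *m (x *m J))
  - (3 * M / 2) *: (E^T *m E) - A.
have trC : \tr C = M / 2 * N%:R + M - 3 * M / 2 * (\rank U1)%:R - 2 * \tr (Kmx x).
  rewrite /C !(mxtraceD, mxtraceZ, raddfN) /= -/A trA mxtrace1.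
  have t1 (y : 'rV[R]_N) : \tr (y^T *m y) = dot y y.
    by rewrite mxtrace_mulC /dot {1}[y *m y^T]mx11_scalar mxtrace_scalar mulr1n.
  rewrite [\tr (_ *: (E^T *m E))]mxtraceZ.
  by rewrite !t1 dotJ x1 [\tr (E^T *m E)]mxtrace_mulC EE mxtrace1; field.
have N2 : (2 <= N)%N.
  have := rank_leq_col (col_mx x (x *m J)).
  by have /eqP -> := row_free_orth (pair_orth x1).
have nE : N%:R = 2 + (\rank U1)%:R + (\rank U3)%:R :> R.
  by rewrite -addrA -natrD rank_U13 -(natrD _ 2) subnKC.
suff : 0 <= \tr C by rewrite trC nE; lra.
suff psd v : 0 <= dot (v *m C) v.
  apply: sumr_ge0 => i _; have := psd (delta_mx 0 i).
  by rewrite dot_delta -rowE mxE.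
have [a [b [t [vE tT]]]] := split_T x1 v.
pose s := t *m E^T *m E; pose r := t - s.
have sU : (s <= U1)%MS by rewrite -EU submxMl.
have /U1P[sT hs] := sU.
have rT : perpT x r by rewrite /r addrC -scaleN1r; apply: perpT_lin.
have rE : r *m E^T = 0.
  by rewrite /r mulmxBl /s -!mulmxA EE mulmx1 subrr.
have rs : dot r s = 0.
  by rewrite /s -[t *m _ *m _]mulmxA dotC dot_mulmx trmx_mul trmxK mulmxA rE mul0mx dot0r.
have xE : x *m E^T = 0 /\ x *m J *m E^T = 0.
  have h y : (forall z, perpT x z -> dot z y = 0) -> y *m E^T = 0.
    move=> hy; apply/rowP => i; rewrite -[_ i]dot_delta dot_mulmx trmxK dotC -rowE.
    rewrite hy ?mxE //; suff /U1P[] : (row i E <= U1)%MS by [].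
    by rewrite -EU row_sub.
  by split; apply: h => z [].
have vs : v *m (E^T *m E) = s.
  by rewrite vE !mulmxA !mulmxDl -!scalemxAl xE.1 xE.2 !mul0mx !scaler0 !add0r.
have tsr : t = s + r by rewrite /r subrKC.
clearbody r s.
have sv : dot s v = dot s s.
  have -> : v = a *: x + (b *: (x *m J) + (s + r)) by rewrite vE tsr.
  by case: sT => h1 h2; rewrite !dotE_lin h1 h2 (dotC s r) rs; ring.
have rr : dot t t = dot s s + dot r r.
  rewrite tsr.
  by rewrite !dotE_lin (dotC s r) rs; ring.
have vv : dot v v = a ^+ 2 + b ^+ 2 + dot s s + dot r r.
  case: tT => h1 h2; rewrite vE !dotE_lin dotJ dotxJ dotJx (dotC x t).
  by rewrite (dotC _ t) h1 h2 x1 rr; ring.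
have h z : kap x x z = 0 by exact: kap_x0.
have h' z : kap x z x = 0 by rewrite kap_sym h.
have e4 : kap x (x *m J) (x *m J) = M by rewrite xJ dotJ x1 mulr1.
have split2 c d y : perpT x y ->
    kap x (c *: x + (d *: (x *m J) + y)) (c *: x + (d *: (x *m J) + y)) =
    M * d ^+ 2 + kap x y y.
  move=> [_ yT].
  have e5 : kap x (x *m J) y = 0 by rewrite xJ (dotC _ y) yT mulr0.
  have e6 : kap x y (x *m J) = 0 by rewrite kap_sym.
  move: h h' e4 e5 e6; rewrite /kap => h h' e4 e5 e6.
  by rewrite !kE !h !h' e4 e5 e6; ring.
have vJ : v *m J = (- b) *: x + (a *: (x *m J) + t *m J).
  by rewrite vE !mulmxDl -!scalemxAl J2 scalerN -scaleNr addrCA.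
have e7 : kap x v v = M * b ^+ 2 + kap x t t by rewrite vE split2.
have e8 : kap x (v *m J) (v *m J) = M * a ^+ 2 + kap x (t *m J) (t *m J).
  by rewrite vJ split2 //; exact: perpTJ.
have e9 : kap x t t + kap x (t *m J) (t *m J) =
    - M * dot s s + (kap x r r + kap x (r *m J) (r *m J)).
  rewrite tsr.
  have := hs _ sT; have := hs _ rT; rewrite (dotC s r) rs mulr0.
  have := kap_sym x s r; have := kap_sym x (s *m J) (r *m J).
  by rewrite mulmxDl /kap !kE; lra.
have e10 : 2 * (kap x r r + kap x (r *m J) (r *m J)) <= M * dot r r.
  have [r1 r2] := rT.
  have := hess x1 hx hM r1.
  have rJ1 : dot (r *m J) x = 0 by rewrite dotJl r2 oppr0.
  have := hess x1 hx hM rJ1; rewrite J2 kapNN dotJ; lra.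
rewrite /C !mulmxBr mulmxDr !dotBl dotDl -!scalemxAr !dotZl vs sv mulmx1 vv.
have -> : dot (v *m (x^T *m x + (x *m J)^T *m (x *m J))) v = a ^+ 2 + b ^+ 2.
  have t1 (y : 'rV[R]_N) : dot (v *m (y^T *m y)) v = dot v y ^+ 2.
    have -> : v *m (y^T *m y) = dot v y *: y.
      by rewrite mulmxA [v *m y^T]mx11_scalar mul_scalar_mx.
    by rewrite dotZl (dotC y) expr2.
  rewrite mulmxDr dotDl !t1 vE; case: tT => h1 h2.
  by rewrite !dotE_lin dotJ dotxJ dotJx h1 h2 x1; ring.
rewrite /A mulmxDr dotDl KmxE Kmx'E e7 e8; lra.
Qed.

(* The holomorphic curvatures at x + s, x - s, x + Js, x - Js add up to
   4 hol s - 12 M. *)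
Lemma U1_hol s : (s <= U1)%MS -> dot s s = 1 ->
  3 * M + 4 * mt <= hol s /\
  (hol s <= 3 * M + 4 * mt -> kap x s s = kap x (s *m J) (s *m J)).
Proof.
move=> /U1P[sT hs] s1; have := hs _ sT; rewrite s1 mulr1.
have sx : dot s x = 0 by case: sT.
have sJx : dot (s *m J) x = 0 by case: sT => _ h; rewrite dotJl h oppr0.
have := hol_pm x1 hx hm sx; have := hol_pm x1 hx hm sJx.
rewrite J2 kapNN holJ dotJ s1 => h1 h2 h3.
by split; [lra | move=> h4; lra].
Qed.

Lemma U1_0 : - M / 2 < mt -> \rank U1 = 0%N.
Proof.
move=> hmt'; apply/eqP; rewrite mxrank_eq0; apply: contraTT isT => /rowV0Pn[s sU s0].
have [a [a0 a1 _]] := normalize s0.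
have aU : (a *: s <= U1)%MS by apply: scalemx_sub.
have [h _] := U1_hol aU a1; have := hM (a *: s); rewrite a1; lra.
Qed.

(** With [K' = JKJ^-1], membership of [v] gives [3 K + K' = M] at [v], and that of [Jv] gives
    [K + 3 K' = M] at [v]. *)
Lemma U3_flat v : (v <= U3)%MS -> (v *m J <= U3)%MS -> v *m Kmx x = (M / 4) *: v.
Proof.
move=> /U3P[vT h] /U3P[_ h']; apply: T_eq.
- exact: Kmx_T.
- by rewrite -[_ *: _]addr0; apply: perpT_lin => //; split; rewrite dot0l.
move=> z zT; have := h _ zT; have := h' _ (perpTJ zT).
rewrite KmxE dotZl !J2 dotJ kapNN; lra.
Qed.

Lemma flat_T : \rank U1 = 0%N -> forall v, perpT x v -> v *m Kmx x = (M / 4) *: v.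
Proof.
move=> U10; have TU : (Tmx x <= U3)%MS.
  have : U1 = 0 by apply/eqP; rewrite -mxrank_eq0 U10.
  by have := U13_sum => + U0; rewrite U0 adds0mx_id.
move=> v vT; apply: U3_flat; apply: submx_trans TU; apply/TmxP => //.
exact: perpTJ.
Qed.

Lemma eig_top : (eigenspace (Kmx x) M <= x *m J)%MS.
Proof.
apply/rV_subP => v /eigenspaceP vK.
have vx : dot v x = 0.
  have : kap x v x = 0 by rewrite kap_sym kap_x0.
  rewrite -KmxE vK dotZl => /eqP.
  by rewrite mulf_eq0 (gt_eqF M0) => /eqP.
pose c := dot v (x *m J); pose t := v - c *: (x *m J).
have tT : perpT x t.
  by split; rewrite /t dotBl dotZl ?dotJ ?dotJx ?vx ?x1 /c; ring.
have tK : kap x t t = M * dot t t.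
  rewrite -KmxE /t mulmxBl vK -scalemxAl (Kmx_xJ x1 hx hM) scalerA (mulrC c).
  by rewrite -scalerA -scalerBr dotZl.
have t0 : t = 0.
  by apply/eqP; apply: contraT => t0; have := hS tT t0; rewrite tK ltxx.
have -> : v = c *: (x *m J) by apply/eqP; rewrite -subr_eq0 -/t t0.
exact: scalemx_sub.
Qed.

Lemma rank_eig_top : \rank (eigenspace (Kmx x) M) = 1%N.
Proof.
have xJ0 : x *m J != 0 by rewrite -dot_gt0 dotJ x1.
apply/eqP; rewrite eqn_leq; apply/andP; split.
  by apply: leq_trans (mxrankS eig_top) _; rewrite rank_rV xJ0.
rewrite -(_ : \rank (x *m J) = 1%N); last by rewrite rank_rV xJ0.
apply: mxrankS; apply/eigenspaceP; exact: Kmx_xJ x1 hx hM.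
Qed.

End Half.

Lemma eigen_orth (A : 'M[R]_N) a b y w : A^T = A -> y *m A = a *: y ->
  w *m A = b *: w -> a != b -> dot y w = 0.
Proof.
move=> sA yA wA ab; have : dot (y *m A) w = dot y (w *m A).
  by rewrite dot_mulmx sA.
rewrite yA wA dotZl dotZr => /eqP; rewrite -subr_eq0 -mulrBl mulf_eq0.
by rewrite subr_eq0 (negbTE ab) => /eqP.
Qed.

(** * The boundary case [mt = - M/2] *)

Section Boundary.
Context (M : R) (M0 : 0 < M) (iso : isospectral).
Context (hM : forall y, hol y <= M * dot y y ^+ 2).
Context (hm : forall y, - M / 2 * dot y y ^+ 2 <= hol y).
Context (hup : forall u y, kap u y y <= M * dot u u * dot y y).
Context (hlow : forall u y, - M / 2 * dot u u * dot y y <= kap u y y).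

Let hmt : - 2 * M < - M / 2. Proof. by move: M0; lra. Qed.

Lemma low_eigen u y : kap u y y = - M / 2 * dot u u * dot y y ->
  y *m Kmx u = (- M / 2 * dot u u) *: y.
Proof.
move=> e; suff : y *m (- Kmx u) = (M / 2 * dot u u) *: y.
  by rewrite mulmxN => /(congr1 -%R); rewrite opprK => ->; rewrite -scaleNr; congr (_ *: _); lra.
apply: form_max_eigen; first by rewrite linearN /= Kmx_sym.
  by move=> z; rewrite mulmxN dotNl KmxE; have := hlow u z; lra.
by rewrite mulmxN dotNl KmxE e; lra.
Qed.

Lemma up_eigen u y : kap u y y = M * dot u u * dot y y ->
  y *m Kmx u = (M * dot u u) *: y.
Proof.
move=> e; apply: form_max_eigen; first by rewrite Kmx_sym.
  by move=> z; rewrite KmxE.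
by rewrite KmxE.
Qed.

Lemma U1_boundary x s : dot x x = 1 -> hol x = M -> (s <= U1 x M)%MS ->
  dot s s = 1 ->
  [/\ kap x s s = - M / 2, kap x (s *m J) (s *m J) = - M / 2 & hol s = M].
Proof.
move=> x1 hx sU s1.
have [h1 h2] := U1_hol x1 hx hM hm sU s1.
have h3 := hM s; rewrite s1 in h3.
have /(U1P x1 hx hM)[sT h5] := sU.
have := h5 _ sT; rewrite s1 => h6.
have h7 := h2 ltac:(lra).
by split; lra.
Qed.

Lemma hess_min x v : dot x x = 1 -> hol x = - M / 2 -> dot v x = 0 ->
  - M / 2 * dot v v <= kap x v v + 3 * kap x (v *m J) (v *m J).
Proof.
move=> x1 hx vx; suff h t :
  0 <= (4 * kap x (x *m J) (v *m J)) * t +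
    (2 * kap x v v + 6 * kap x (v *m J) (v *m J) + M * dot v v) * t ^+ 2 +
    (4 * kap v (v *m J) (x *m J)) * t ^+ 3 +
    (hol v + M / 2 * dot v v ^+ 2) * t ^+ 4.
  by have [_ h2 _] := quartic_ge0 h; lra.
have := hm (x + t *: v).
rewrite hol_expand holZ hx kapZ !dotE_lin x1 (dotC x v) vx -!scalemxAl.
by rewrite /kap !kE; lra.
Qed.

(** The Hessian bound at a minimum, taken at [Jv], reads [K(Jv, Jv) + 3 K(v, v) >= - M/2 |v|^2];
    with [K(v, v) = - M/2 |v|^2] it pushes [K(Jv, Jv)] up to its maximal value [M |v|^2]. *)
Lemma min_eigen x v : dot x x = 1 -> hol x = - M / 2 -> perpT x v ->
  v *m Kmx x = (- M / 2) *: v -> v *m J *m Kmx x = M *: (v *m J).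
Proof.
move=> x1 hx [vx vxJ] vK.
have vJx : dot (v *m J) x = 0 by rewrite dotJl vxJ oppr0.
have h1 := hess_min x1 hx vJx; have h2 := hup x (v *m J).
have h3 : kap x v v = - M / 2 * dot v v by rewrite -KmxE vK dotZl.
move: h1 h2; rewrite J2 kapNN dotJ x1 h3 => h1 h2.
by have := @up_eigen x (v *m J); rewrite x1 mulr1 dotJ; apply; lra.
Qed.

(** By isospectrality the multiplicity is counted at the minimum [xt]: [J xt] accounts for 1, and in
    T, [J] embeds the eigenspace of [- M/2] into that of [M], which is simple. *)
Lemma rank_min_le x xt : dot x x = 1 -> hol x = M ->
  dot xt xt = 1 -> hol xt = - M / 2 ->
  (\rank (eigenspace (Kmx x) (- M / 2)) <= 2)%N.
Proof.
move=> x1 hx t1 ht; rewrite (iso x1 t1).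
have tJK : xt *m J *m Kmx xt = (- M / 2) *: (xt *m J).
  by have := @low_eigen xt (xt *m J); rewrite t1 mulr1; apply; rewrite dotJ t1 mulr1.
pose P := (Tmx xt :&: eigenspace (Kmx xt) (- M / 2))%MS.
have sub : (eigenspace (Kmx xt) (- M / 2) <= xt *m J + P)%MS.
  apply/rV_subP => v /eigenspaceP vK.
  have vx : dot v xt = 0.
    apply: (eigen_orth (Kmx_sym xt) vK (_ : xt *m Kmx xt = 0 *: xt)).
      by rewrite Kmx_x0 scale0r.
    by apply/eqP; move: M0; lra.
  pose c := dot v (xt *m J).
  have -> : v = c *: (xt *m J) + (v - c *: (xt *m J)) by rewrite subrKC.
  apply: addmx_sub_adds; first exact: scalemx_sub.
  rewrite sub_capmx; apply/andP; split.
    apply/TmxP; split; first by rewrite dotBl dotZl dotJx vx; ring.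
    by rewrite dotBl dotZl dotJ t1 /c; ring.
  by apply/eigenspaceP; rewrite mulmxBl vK -scalemxAl tJK scalerBr !scalerA (mulrC c).
apply: leq_trans (mxrankS sub) _.
apply: leq_trans (mxrank_adds_leqif _ _) _; rewrite -(addn1 1).
apply: leq_add; first by rewrite rank_rV; case: eqP.
rewrite -(rank_eig_top x1 hx hM hm M0 hmt) (iso x1 t1).
have Jf : row_free J by apply: row_free_orth.
rewrite -(mxrankMfree P Jf); apply: mxrankS; apply/rV_subP => v /submxP[w ->].
rewrite mulmxA; have : (w *m P <= P)%MS by apply: submxMl.
rewrite sub_capmx => /andP[/TmxP wT /eigenspaceP wK].
by apply/eigenspaceP; exact: min_eigen.
Qed.

(** Two orthogonal complex lines on which [h] is maximal, while their mutual curvature takes the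
    extreme value [- M/2]. The conditions are symmetric in [x], [s] and stable under [J], so that
    later claims need one case only. *)
Record pair x s : Prop := Pair {
  p_x : dot x x = 1; p_hx : hol x = M;
  p_s : dot s s = 1; p_hs : hol s = M; p_xs : perpT x s;
  p_k : kap x s s = - M / 2; p_kJ : kap x (s *m J) (s *m J) = - M / 2 }.

Lemma perpT_sym x s : perpT x s -> perpT s x.
Proof. by move=> [h1 h2]; split; rewrite dotC // dotJl h2 oppr0. Qed.

Lemma pair_sym x s : pair x s -> pair s x.
Proof.
case=> x1 hx s1 hs xs e eJ; split=> //; first exact: perpT_sym.
  by rewrite kapxy.
by rewrite kapxy kapJ.
Qed.

Lemma pair_J x s : pair x s -> pair x (s *m J).
Proof.
case=> x1 hx s1 hs xs e eJ; split=> //; rewrite ?dotJ ?holJ ?J2 ?kapNN //.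
exact: perpTJ.
Qed.

Lemma pair_U1 x s : pair x s -> (s <= U1 x M)%MS.
Proof.
case=> x1 hx s1 hs xs e eJ; apply/(U1P x1 hx hM); split=> // z zT.
have := @low_eigen x s; rewrite x1 s1 !mulr1 => /(_ e) h1.
have := @low_eigen x (s *m J); rewrite x1 dotJ s1 !mulr1 => /(_ eJ) h2.
by rewrite -!KmxE h1 h2 !dotZl dotJ; lra.
Qed.

Lemma U1_low x : dot x x = 1 -> hol x = M ->
  (U1 x M <= eigenspace (Kmx x) (- M / 2)%R)%MS.
Proof.
move=> x1 hx; apply/rV_subP => s sU; apply/eigenspaceP.
have [->|s0] := eqVneq s 0; first by rewrite mul0mx scaler0.
have [a [a0 a1 _]] := normalize s0.
have aU : (a *: s <= U1 x M)%MS by apply: scalemx_sub.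
have [e _ _] := U1_boundary x1 hx aU a1.
have := @low_eigen x (a *: s); rewrite x1 a1 !mulr1 => /(_ e).
by rewrite -scalemxAl scalerA mulrC -scalerA => /(scalerI (lt0r_neq0 a0)).
Qed.

Context (xt : 'rV[R]_N) (t1 : dot xt xt = 1) (ht : hol xt = - M / 2).

(** [U1] contains [s] and [Js] and lies in an eigenspace of rank at most 2, hence it is the complex
    line through [s]. *)
Lemma pair_span x s w : pair x s -> perpT s w -> 
  forall v, (v <= U1 x M)%MS -> dot w v = 0.
Proof.
move=> ps [ws wsJ] v vU; have [x1 hx s1 _ _ _ _] := ps.
have sub : (col_mx s (s *m J) <= U1 x M)%MS.
  by rewrite col_mx_sub (pair_U1 ps) pair_U1 //; exact: pair_J.
have [_] := mxrank_leqif_sup sub.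
have -> : (\rank (col_mx s (s *m J)) == \rank (U1 x M)).
  have /eqP r2 := row_free_orth (pair_orth s1); rewrite r2.
  rewrite eqn_leq -{1}r2 mxrankS //=.
  by apply: leq_trans (mxrankS (U1_low x1 hx)) (rank_min_le x1 hx t1 ht).
move=> /esym h; have := submx_trans vU h => /submxP[c ->].
rewrite dotC dot_mulmx tr_col_mx mul_mx_row.
have e (y z : 'rV[R]_N) : y *m z^T = (dot y z)%:M by rewrite [LHS]mx11_scalar.
by rewrite !e ws wsJ !raddf0 row_mx0 dot0r.
Qed.

(** A vector orthogonal to [s], [Js] is orthogonal to [U1]. Its component in [U3] turns out to be so
    too, hence its component in [U1] is zero and [U3_flat] applies. *)
Lemma pair_flat x s w : pair x s -> perpT x w -> perpT s w ->
  w *m Kmx x = (M / 4) *: w.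
Proof.
move=> ps wx ws; have [x1 hx _ _ _ _ _] := ps.
suff U v : perpT x v -> perpT s v -> (v <= U3 x M)%MS.
  by apply: (U3_flat x1 hx hM); apply: U => //; exact: perpTJ.
move=> vx vs; have := U13_sum iso x1 hx hM hm M0 hmt.
have vT : (v <= Tmx x)%MS by apply/TmxP.
move=> /(submx_trans vT)/sub_addsmxP[[p q] /= vE].
move: vE; set a := p *m _; set b := q *m _ => vE.
have aU : (a <= U1 x M)%MS by apply: submxMl.
have bU : (b <= U3 x M)%MS by apply: submxMl.
have va := pair_span ps vs aU.
have /(U1P x1 hx hM)[aT _] := aU.
have /(U3P x1 hx hM)[bT hb] := bU.
have aK := eigenspaceP (submx_trans aU (U1_low x1 hx)).
have aJU := submx_trans (submxMr J aU) (U1_J x1 hx hM).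
have aJK := eigenspaceP (submx_trans aJU (U1_low x1 hx)).
(* [3 K + JKJ^-1] is [M] on [b] and [- 2 M] on [a], so the two are orthogonal. *)
have ba : dot b a = 0.
  have := hb _ aT; rewrite kap_sym -KmxE aK dotZl (kap_sym x (b *m J)) -KmxE aJK.
  rewrite dotZl dotJ (dotC a b) => ?.
  by apply/eqP; rewrite -(mulrI_eq0 _ (lregP (lt0r_neq0 M0))); apply/eqP; lra.
have a0 : a = 0.
  by apply/eqP; rewrite -dot_eq0; move: va; rewrite vE dotDl ba addr0 => ->.
by rewrite vE a0 add0r.
Qed.

(** Off the pair, [K_x = M/4] turns the Hessian bound into an equality, so the cubic term of [h]
    vanishes. Polarised, this reads [A + 3 B = 0] for [A = kap v c x] and [B = kap v Jc Jx];
    replacing [v] by [Jv] gives [3 A + B = 0]. *)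
Lemma pair_third x s v c : pair x s -> perpT x v -> perpT s v ->
  perpT x c -> perpT s c -> kap v c x = 0 /\ kap v c (x *m J) = 0.
Proof.
move=> ps; have [x1 hx _ _ _ _ _] := ps.
have f0 v' : perpT x v' -> perpT s v' -> kap v' (v' *m J) (x *m J) = 0.
  move=> vx vs; apply: (hess_flat x1 hx hM); first by case: vx.
  rewrite -!KmxE (pair_flat ps) // (pair_flat ps); try exact: perpTJ.
  by rewrite !dotZl dotJ; field.
have f1 v' c' : perpT x v' -> perpT s v' -> perpT x c' -> perpT s c' ->
    kap v' c' x + 3 * kap v' (c' *m J) (x *m J) = 0.
  move=> vx vs cx cs.
  have p (a : R) u : perpT u v' -> perpT u c' -> perpT u (v' + a *: c').
    by move=> ? ?; rewrite addrC; apply: perpT_lin.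
  have h a : kap (v' + a *: c') ((v' + a *: c') *m J) (x *m J) = 0.
    by apply: f0; apply: p.
  have h1 := h 1; have h2 := h (-1); have h3 := f0 _ vx vs; have h4 := f0 _ cx cs.
  have e := kap2_Jx v' c' (x *m J); rewrite J2 in e.
  move: h1 h2 h3 h4 e; rewrite /kap2 mulmxDl -scalemxAl /kap !kE mulmxDl -scalemxAl /kap !kE.
  by lra.
have g v' c' : perpT x v' -> perpT s v' -> perpT x c' -> perpT s c' ->
    kap v' c' x = 0.
  move=> vx vs cx cs; have := f1 _ _ vx vs cx cs.
  have := f1 _ _ (perpTJ vx) (perpTJ vs) cx cs.
  rewrite !kapJ !J2.
  have -> : kap v' (- c') (- x) = kap v' c' x by rewrite kapNN.
  by lra.
move=> vx vs cx cs; split; first exact: g.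
have := g _ _ (perpTJ vx) (perpTJ vs) cx cs.
rewrite kapJ => h; have := f1 _ _ (perpTJ vx) (perpTJ vs) cx cs.
have := g _ _ vx vs (perpTJ cx) (perpTJ cs) => h2.
have := f1 _ _ vx vs (perpTJ cx) (perpTJ cs); rewrite h2 J2 /kap !kE; lra.
Qed.

Definition Lmx (x s : 'rV[R]_N) := col_mx (col_mx x (x *m J)) (col_mx s (s *m J)).
Definition Lp (x s : 'rV[R]_N) : 'M[R]_N := kermx (Lmx x s)^T.

Lemma LpP x s v : reflect (perpT x v /\ perpT s v) (v <= Lp x s)%MS.
Proof.
apply: (iffP sub_kermxP); rewrite tr_col_mx mul_mx_row.
  move=> h; split; apply/TmxP/sub_kermxP.
    by have := congr1 lsubmx h; rewrite row_mxKl raddf0.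
  by have := congr1 rsubmx h; rewrite row_mxKr raddf0.
by move=> [/TmxP/sub_kermxP -> /TmxP/sub_kermxP ->]; rewrite row_mx0.
Qed.

Lemma Lmx_orth x s : dot x x = 1 -> dot s s = 1 -> perpT x s ->
  Lmx x s *m (Lmx x s)^T = 1%:M.
Proof.
move=> x1 s1 xs; have sx := perpT_sym xs.
rewrite /Lmx tr_col_mx mul_col_row !pair_orth //.
have h (y z : 'rV[R]_N) : perpT z y -> col_mx y (y *m J) *m (col_mx z (z *m J))^T = 0.
  move=> yz; have := perpTJ yz => yJz.
  by rewrite mul_col_mx; move/TmxP/sub_kermxP: yz => ->; move/TmxP/sub_kermxP: yJz => ->; rewrite col_mx0.
by rewrite !h // -scalar_mx_block.
Qed.

Lemma rank_Lp x s : pair x s -> (\rank (Lp x s) = N - 4)%N.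
Proof.
case=> x1 _ s1 _ xs _ _; rewrite mxrank_ker mxrank_tr; congr (_ - _)%N.
by apply/eqP; apply: row_free_orth (Lmx_orth x1 s1 xs).
Qed.

(** The normalised [x + s] is a minimum of [h]. Its other known eigenvectors push its eigenspace for
    [M/4] into [Lp x s], and isospectrality with [x] makes the two equal. Comparing the Jacobi forms
    of [x + s], [x] and [s] on [Lp x s] then isolates the polarised term. *)
Lemma pair_cross x s w : pair x s -> perpT x w -> perpT s w -> kap w x s = 0.
Proof.
move=> ps wx ws; have [x1 hx s1 hs xs kxs kxsJ] := ps.
have sx := perpT_sym xs.
pose u := x + s; pose y := x - s.
have uu : dot u u = 2.
  by case: xs => h1 h2; rewrite /u !dotE_lin (dotC x s) h1 x1 s1; ring.
have holu : hol u = - 2 * M.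
  rewrite /u hol_expand hx hs (kap_xJ x1 hx hM) (kap_xJ s1 hs hM) !dotJ kxs kxsJ.
  by case: xs => h1 _; rewrite (dotC x) h1; field.
pose a : R := (Num.sqrt 2)^-1.
have a2 : a ^+ 2 = 2^-1 by rewrite exprVn sqr_sqrtr.
have a0 : a != 0 by rewrite invr_eq0 sqrtr_eq0 -ltNge.
pose u0 := a *: u.
have u01 : dot u0 u0 = 1.
  by rewrite dotZl dotZr uu mulrA -expr2 a2 mulVf.
have h0 : hol u0 = - M / 2.
  by rewrite holZ holu (exprM a 2 2) a2; lra.
have yy : dot y y = 2.
  by case: xs => h1 h2; rewrite /y !dotE_lin (dotC x s) h1 x1 s1; ring.
have kuy : kap u y y = - 2 * M.
  have e : kap u s s = - M / 2.
    rewrite kapxy /u.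
    have -> : kap s (x + s) (x + s) = kap s x x.
      have := kap_x0 s s; have := kap_x0 s x; have := kap_sym s x s.
      by rewrite /kap !kE; lra.
    by rewrite kapxy.
  have -> : y = u - 2 *: s by apply/rowP => i; rewrite !mxE; ring.
  have := kap_x0 u s; have := kap_x0 u u; have := kap_sym u u s; move: e.
  rewrite /kap !kE; lra.
have yK : y *m Kmx u0 = (- M / 2) *: y.
  have := @low_eigen u0 y; rewrite u01 mulr1; apply.
  by rewrite kapZ a2 kuy yy; field.
have uJK : u0 *m J *m Kmx u0 = (- M / 2) *: (u0 *m J).
  have := @low_eigen u0 (u0 *m J); rewrite u01 mulr1; apply.
  by rewrite dotJ u01 mulr1.
have yT : perpT u0 y.
  have [h1 h2] := xs; have [h3 h4] := sx.
  split; rewrite /u0 /u /y -?scalemxAl ?mulmxDl !dotE_lin ?dotxJ; last by rewrite h4 h2; ring.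
  by rewrite (dotC x s) h1 x1 s1; ring.
have yJK := min_eigen u01 h0 yT yK.
have u0K : u0 *m Kmx u0 = 0 *: u0 by rewrite Kmx_x0 scale0r.
have sub : (eigenspace (Kmx u0) (M / 4) <= Lp x s)%MS.
  apply/rV_subP => v /eigenspaceP vK.
  have ne1 : M / 4 != 0 by apply/eqP; move: M0; lra.
  have ne2 : M / 4 != - M / 2 by apply/eqP; move: M0; lra.
  have ne3 : M / 4 != M by apply/eqP; move: M0; lra.
  have o1 := eigen_orth (Kmx_sym u0) vK u0K ne1.
  have o2 := eigen_orth (Kmx_sym u0) vK yK ne2.
  have o3 := eigen_orth (Kmx_sym u0) vK uJK ne2.
  have o4 := eigen_orth (Kmx_sym u0) vK yJK ne3.
  move: o1 o2 o3 o4; rewrite /u0 /u /y -scalemxAl !mulmxDl mulNmx !dotE_lin.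
  move=> /eqP; rewrite mulf_eq0 (negbTE a0) /= => /eqP o1 o2.
  move=> /eqP; rewrite mulf_eq0 (negbTE a0) /= => /eqP o3 o4.
  by apply/LpP; split; split; lra.
have sub2 : (Lp x s <= eigenspace (Kmx x) (M / 4)%R)%MS.
  apply/rV_subP => v /LpP[vx vs]; apply/eigenspaceP; exact: pair_flat ps vx vs.
have eq : (Lp x s <= eigenspace (Kmx u0) (M / 4)%R)%MS.
  have [_ <-] := mxrank_leqif_sup sub.
  by rewrite eqn_leq (mxrankS sub) (iso u01 x1) mxrankS.
have wL : (w <= Lp x s)%MS by apply/LpP.
have /eigenspaceP wK := submx_trans wL eq.
have e1 : kap u w w = M / 2 * dot w w.
  have : kap u0 w w = M / 4 * dot w w by rewrite -KmxE wK dotZl.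
  by rewrite kapZ a2; lra.
have e2 : kap x w w = M / 4 * dot w w by rewrite -KmxE (pair_flat ps) // dotZl.
have e3 : kap s w w = M / 4 * dot w w.
  by rewrite -KmxE (pair_flat (pair_sym ps)) // dotZl.
have e4 : kap2 x s w w = 2 * kap w x s.
  rewrite /kap2 /kap (k_skew hk w x) (k_skew' x w) opprK (k_skew hk w s) (k_skew' s w) opprK.
  by rewrite -[k s w w x]/(kap w s x) kap_sym /kap; ring.
by move: e1; rewrite kapD e2 e3 e4; lra.
Qed.

Lemma pair_Jl x s : pair x s -> pair (x *m J) s.
Proof. by move/pair_sym/pair_J/pair_sym. Qed.

Lemma pair_perpTJ x w : perpT x w -> perpT (x *m J) w.
Proof. by move=> [h1 h2]; split; rewrite ?J2 ?dotNr ?h1 ?oppr0. Qed.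

(** The error [d] is orthogonal to the two complex lines, hence lies in [Lp x s]; by [pair_third] it
    is orthogonal to [Lp x s] as well, hence to itself. *)
Lemma pair_block1 x s w : pair x s -> perpT x w -> perpT s w -> dot w w = 1 ->
  x *m Kmx w = (M / 4) *: x.
Proof.
move=> ps wx ws w1; have [x1 hx s1 hs xs kxs kxsJ] := ps.
pose d := x *m Kmx w - (M / 4) *: x.
have dE z : dot d z = kap w x z - M / 4 * dot x z.
  by rewrite /d dotBl dotZl KmxE.
have xx : dot d x = 0.
  by rewrite dE kapxy -KmxE (pair_flat ps) // dotZl w1 x1; ring.
have xJ : dot d (x *m J) = 0.
  rewrite dE dotxJ /kap kJswap' (k_skew hk) -[k w x x _]/(kap x w _).
  rewrite -KmxE (pair_flat ps) // dotZl dotxJ; ring.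
have xs0 : dot d s = 0.
  by rewrite dE (pair_cross ps) //; case: xs => h _; rewrite dotC h; ring.
have xsJ : dot d (s *m J) = 0.
  rewrite dE (pair_cross (pair_J ps)) //; last exact: pair_perpTJ.
  by have [_ h] := perpT_sym xs; rewrite h; ring.
have h c : perpT x c -> perpT s c -> dot d c = 0.
  move=> cx cs; rewrite dE kap_sym.
  have [-> _] := pair_third ps wx ws cx cs.
  by case: cx => h _; rewrite dotC h; ring.
by apply/eqP; rewrite -subr_eq0 -/d -dot_eq0; apply/eqP; apply: h.
Qed.

Lemma pair_block x s w : pair x s -> (w <= Lp x s)%MS -> dot w w = 1 ->
  Lmx x s *m Kmx w = (M / 4)%:M *m Lmx x s.
Proof.
move=> ps /LpP[wx ws] w1.
rewrite mul_scalar_mx /Lmx !scale_col_mx !mul_col_mx.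
have wxJ := pair_perpTJ wx; have wsJ := pair_perpTJ ws.
rewrite (pair_block1 ps) // (pair_block1 (pair_Jl ps)) //.
by rewrite (pair_block1 (pair_sym ps)) // (pair_block1 (pair_Jl (pair_sym ps))).
Qed.

Lemma Lp_stable (x s w c : 'rV[R]_N) : pair x s -> (w <= Lp x s)%MS ->
  (c <= Lp x s)%MS -> (c *m Kmx w <= Lp x s)%MS.
Proof.
move=> ps /LpP[wx ws] /LpP[cx cs].
have [h1 h2] := pair_third ps wx ws cx cs.
have [h3 h4] := pair_third (pair_sym ps) ws wx cs cx.
by apply/LpP; split; split; rewrite KmxE.
Qed.

Lemma Lp_J x s : (Lp x s *m J <= Lp x s)%MS.
Proof.
apply/rV_subP => v /submxP[w ->]; rewrite mulmxA.
have /LpP[h1 h2] : (w *m Lp x s <= Lp x s)%MS by apply: submxMl.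
by apply/LpP; split; apply: perpTJ.
Qed.

(** [K_w] is [M/4] on the four dimensions of the pair and preserves their orthogonal. Restricting
    the tensor there lowers one multiplicity by 4, the same for every [w], so isospectrality is
    inherited. *)
Lemma rank_Lp_block x s w a : pair x s -> (w <= Lp x s)%MS -> dot w w = 1 ->
  forall r (E : 'M[R]_(r, N)), E *m E^T = 1%:M -> (E :=: Lp x s)%MS ->
  \rank (eigenspace (Kmx w) a) =
  ((a == (M / 4)%R) * 4 + \rank (eigenspace (E *m Kmx w *m E^T) a))%N.
Proof.
move=> ps wL w1 r E EE EL; have [x1 hx s1 hs xs _ _] := ps.
have EK : E *m Kmx w = E *m Kmx w *m E^T *m E.
  have : (E *m Kmx w <= E)%MS.
    apply/rV_subP => v /submxP[c ->]; rewrite mulmxA EL.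
    by apply: Lp_stable => //; rewrite -EL submxMl.
  by case/submxP => D DE; rewrite DE -(mulmxA D) EE mulmx1.
have rE : r = (N - 4)%N.
  by rewrite -(rank_Lp ps) -EL; apply/esym/eqP; exact: row_free_orth.
pose P := col_mx (Lmx x s) E.
have PP : P *m P^T = 1%:M.
  have e : E *m (Lmx x s)^T = 0 by apply/sub_kermxP; rewrite EL.
  have e' : Lmx x s *m E^T = 0.
    by rewrite -[LHS]trmxK trmx_mul trmxK e trmx0.
  by rewrite /P tr_col_mx mul_col_row Lmx_orth // EE e e' -scalar_mx_block.
have PK := col_mx_intertwine (pair_block ps wL w1) EK.
have Pf := row_free_orth PP.
have := eig_transfer a Pf PK.
have full : (1%:M <= P)%MS.
  rewrite sub1mx /row_full; move: Pf; rewrite /row_free => /eqP ->.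
  have := rank_leq_col (Lmx x s).
  have /eqP -> := row_free_orth (Lmx_orth x1 s1 xs) => N2.
  by rewrite rE subnKC.
have -> : \rank (P :&: eigenspace (Kmx w) a)%MS = \rank (eigenspace (Kmx w) a).
  apply/eqmx_rank/andP; rewrite capmxSr sub_capmx submx_refl andbT; split=> //.
  exact: submx_trans (submx1 _) full.
move=> <-; rewrite rank_eigenspace_block rank_eigenspace_scalar.
by case: (a == _); rewrite ?mul1n ?mul0n.
Qed.

Lemma boundary_pair x : dot x x = 1 -> hol x = M -> \rank (U1 x M) != 0%N ->
  exists s, pair x s.
Proof.
move=> x1 hx; rewrite mxrank_eq0 => /rowV0Pn[s0 sU0 s00].
have [a [a0 s1 _]] := normalize s00; set s := a *: s0 in s1.
have sU : (s <= U1 x M)%MS by apply: scalemx_sub.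
have [e1 e2 e3] := U1_boundary x1 hx sU s1.
have /(U1P x1 hx hM)[sT _] := sU.
by exists s.
Qed.

(** The rank of [U1] is even and nonzero, so [U1] already fills the bound 2 of [rank_min_le]. *)
Lemma boundary_rank x : dot x x = 1 -> hol x = M -> \rank (U1 x M) != 0%N ->
  \rank (eigenspace (Kmx x) M) = 1%N /\
  \rank (eigenspace (Kmx x) (- M / 2)) = 2%N.
Proof.
move=> x1 hx r0; split; first exact: rank_eig_top hM hm M0 hmt.
have le := rank_min_le x1 hx t1 ht.
have := mxrankS (U1_low x1 hx); have := even_rank_U1 x1 hx hM.
move: r0 le; case: (\rank (U1 x M)) => [|[|n]] //= _ le _ h.
by apply/eqP; rewrite eqn_leq le /=; apply: leq_trans h.
Qed.

End Boundary.

End Kaehler.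

(** * Classification of isospectral Kaehler tensors in dimension 4m + 2 *)

Lemma eigenspace_opp (R : realType) N (A : 'M[R]_N) a :
  \rank (eigenspace (- A) a) = \rank (eigenspace A (- a)).
Proof.
rewrite !mxrank_ker; congr (_ - _)%N.
by rewrite raddfN /= opprK -opprD mxrank_opp.
Qed.

(** A positive definite space meets trivially the sum of a negative definite one and the kernel
    vector [x], which accounts for the extra unit. *)
Lemma rank_pos_neg (R : realType) N p q (A : 'M[R]_N) (P : 'M[R]_(p, N))
    (Q : 'M[R]_(q, N)) (x : 'rV[R]_N) :
  A^T = A -> x *m A = 0 -> x != 0 ->
  (forall v, (v <= P)%MS -> v != 0 -> 0 < dot (v *m A) v) ->
  (forall v, (v <= Q)%MS -> v != 0 -> dot (v *m A) v < 0) ->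
  (\rank P + (\rank Q).+1 <= N)%N.
Proof.
move=> sA xA x0 pos neg.
have capQ : (x :&: Q = 0)%MS.
  apply/eqP/rowV0P => v; rewrite sub_capmx => /andP[/sub_rVP[a ->] aQ].
  apply/eqP; apply: contraT => a0; have := neg _ aQ a0.
  by rewrite -scalemxAl xA scaler0 dot0l ltxx.
have rQ : \rank (x + Q)%MS = (\rank Q).+1.
  have := mxrank_sum_cap x Q; rewrite capQ mxrank0 addn0 => ->.
  by rewrite rank_rV x0 add1n.
have capP : (P :&: (x + Q) = 0)%MS.
  apply/eqP/rowV0P => v; rewrite sub_capmx => /andP[vP /sub_addsmxP[[a b] /= vE]].
  have qQ : (b *m Q <= Q)%MS by apply: submxMl.
  move: vE; rewrite {1}[a]mx11_scalar mul_scalar_mx => vE.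
  apply/eqP; apply: contraT => v0; have := pos _ vP v0.
  have -> : v *m A = b *m Q *m A by rewrite vE mulmxDl -scalemxAl xA scaler0 add0r.
  rewrite dot_mulmx sA vE mulmxDl -scalemxAl xA scaler0 add0r dotC.
  have [->|b0] := eqVneq (b *m Q) 0; first by rewrite dot0r ltxx.
  by move=> h; have := lt_trans h (neg _ qQ b0); rewrite ltxx.
rewrite -rQ -mxrank_sum_cap capP mxrank0 addn0; exact: rank_leq_col.
Qed.

(* A is the Jacobi operator of a unit vector x on the whole space: the term
   [a == 0] counts x itself, which is not in x^orth. *)
Definition osserman_type (R : realType) N (A : 'M[R]_N) :=
  (exists c : R, forall a, \rank (eigenspace A a) =
    ((a == 0%R) + (a == c) * (N - 1))%N) \/
  (exists c1 c2 : R, c1 <> c2 /\ forall a, \rank (eigenspace A a) =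
    ((a == 0%R) + (a == c1) + (a == c2) * (N - 2))%N).

Lemma osserman_typeN (R : realType) N (A : 'M[R]_N) :
  osserman_type A -> osserman_type (- A).
Proof.
have e (a c : R) : (- a == c) = (a == - c) by rewrite eqr_oppLR.
move=> [[c h]|[c1 [c2 [ne h]]]]; [left; exists (- c)|right; exists (- c1), (- c2)].
  by move=> a; rewrite eigenspace_opp h !e oppr0.
split=> [|a]; first by move/oppr_inj.
by rewrite eigenspace_opp h !e oppr0.
Qed.

Lemma osserman_type_same (R : realType) N (A B : 'M[R]_N) :
  same_eig A B -> osserman_type A -> osserman_type B.
Proof.
move=> AB [[c h]|[c1 [c2 [ne h]]]]; [left; exists c|right; exists c1, c2; split=> //];
  by move=> a; rewrite -AB h.
Qed.

(** All four ranks are even since each sum is [4m]; hence the bound [n3 + l3 <= 4m - 1] improves to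
    [4m - 2]. *)
Lemma even_ranks N m n1 n3 l1 l3 : N = (4 * m + 2)%N ->
  (n1 + n3 = N - 2)%N -> (l1 + l3 = N - 2)%N -> ~~ odd n1 -> ~~ odd l1 ->
  (n3.+1 + l3.+2 <= N)%N ->
  [/\ (n1 + n3 = 4 * m)%N, (l1 + l3 = 4 * m)%N, (n3 + l3 + 2 <= 4 * m)%N & (1 <= m)%N].
Proof. by move=> *; split; lia. Qed.

Lemma six_le N m n1 n3 : N = (4 * m + 2)%N -> (n1 + n3 = N - 2)%N -> n1 != 0%N ->
  (6 <= N)%N.
Proof. by move=> *; lia. Qed.

Lemma six_ne N m r : N = (4 * m + 2)%N -> (r + 4 = N)%N -> 2%N = (r - 2)%N -> False.
Proof. by move=> *; lia. Qed.

Definition osserman_dim (R : realType) N :=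
  forall (J : 'M[R]_N) k, J *m J = - 1%:M -> J *m J^T = 1%:M ->
  kaehler J k -> isospectral k ->
  forall u, dot u u = 1 -> osserman_type (Kmx k u).

Section Main.
Context {R : realType} {N : nat} (J : 'M[R]_N).
Context (JJ : J *m J = - 1%:M) (JT : J *m J^T = 1%:M).
Implicit Types (k : 'rV[R]_N -> 'rV[R]_N -> 'rV[R]_N -> 'rV[R]_N -> R).

Definition kopp k x y z w := - k x y z w.

Lemma kaehler_opp k : kaehler J k -> kaehler J (kopp k).
Proof.
case=> h1 h2 h3 h4 h5; split=> *; rewrite /kopp.
- by rewrite h1; ring.
- by rewrite h2.
- by rewrite h3.
- by rewrite -!opprD h4 oppr0.
- by rewrite h5.
Qed.

Lemma Kmx_opp k x : Kmx (kopp k) x = - Kmx k x.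
Proof. by apply/matrixP => i j; rewrite !mxE. Qed.

Lemma isospectral_opp k : isospectral k -> isospectral (kopp k).
Proof.
by move=> iso x u x1 u1 a; rewrite !Kmx_opp (eigenspace_opp (Kmx k x)) (eigenspace_opp (Kmx k u)); exact: iso.
Qed.

Section Tensor.
Context (k : 'rV[R]_N -> 'rV[R]_N -> 'rV[R]_N -> 'rV[R]_N -> R).
Context (hk : kaehler J k).

Lemma cont_k (T : topologicalType) (f g h l : T -> 'rV[R]_N) :
  (forall i, continuous (fun y => f y 0 i)) ->
  (forall i, continuous (fun y => g y 0 i)) ->
  (forall i, continuous (fun y => h y 0 i)) ->
  (forall i, continuous (fun y => l y 0 i)) ->
  continuous (fun y => k (f y) (g y) (h y) (l y)).
Proof.
move=> cf cg ch cl.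
have -> : (fun y => k (f y) (g y) (h y) (l y)) = fun y =>
    \sum_i f y 0 i * (\sum_j g y 0 j * (\sum_m h y 0 m * (\sum_n l y 0 n *
      k (delta_mx 0 i) (delta_mx 0 j) (delta_mx 0 m) (delta_mx 0 n)))).
  apply/funext => y.
  rewrite (linear_sum_delta (f := fun x => k x _ _ _)); last first.
    by move=> *; rewrite !(kE hk).
  apply: eq_bigr => i _; congr (_ * _).
  rewrite (linear_sum_delta (f := fun x => k _ x _ _)); last first.
    by move=> *; rewrite !(kE hk).
  apply: eq_bigr => j _; congr (_ * _).
  rewrite (linear_sum_delta (f := fun x => k _ _ x _)); last first.
    by move=> *; rewrite !(kE hk).
  apply: eq_bigr => m _; congr (_ * _).
  rewrite (linear_sum_delta (f := fun x => k _ _ _ x)); last first.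
    by move=> *; rewrite !(kE hk).
  by [].
do 4 (apply: cont_sum => ?; apply: cont_mul; first by auto).
by move=> x; exact: cvg_cst.
Qed.

Lemma cont_hol : continuous (hol J k).
Proof.
have cJ i : continuous (fun y : 'rV[R]_N => (y *m J) 0 i).
  have -> : (fun y : 'rV[R]_N => (y *m J) 0 i) = (fun y => \sum_j y 0 j * J j i).
    by apply/funext => y; rewrite mxE.
  apply: cont_sum => j; apply: cont_mul; first exact: cont_coord.
  by move=> z; apply: cst_continuous.
by apply: cont_k => // i; exact: cont_coord.
Qed.

Lemma hol_extremum (s : R) x : (forall y, dot y y = 1 -> s * hol J k y <= s * hol J k x) ->
  forall y, s * hol J k y <= s * hol J k x * dot y y ^+ 2.
Proof.
move=> h y; have [->|y0] := eqVneq y 0.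
  by rewrite dot0l /hol /kap mul0mx (k0 hk); lra.
have [a [a0 a1 a2]] := normalize y0; have := h _ a1.
rewrite (holZ hk) (exprM a 2 2) a2 => e.
have d0 : 0 < dot y y by rewrite dot_gt0.
have := ler_pM2r (exprn_gt0 2 d0) (s * ((dot y y)^-1 ^+ 2 * hol J k y)) (s * hol J k x).
rewrite e; have -> : s * ((dot y y)^-1 ^+ 2 * hol J k y) * dot y y ^+ 2 = s * hol J k y.
  by field; rewrite gt_eqF.
by move=> ->.
Qed.

Context (iso : isospectral k).

(** The even part of [hol_expand] gives [K(v, v) + 3 K(Jv, Jv) = 0], and the same at [Jv] gives
    [3 K(v, v) + K(Jv, Jv) = 0]. *)
Lemma hol0_type : (forall y, hol J k y = 0) -> (0 < N)%N ->
  forall x, osserman_type (Kmx k x).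
Proof.
move=> h0 N0 x.
have h v : kap k x v v + 3 * kap k x (v *m J) (v *m J) = 0.
  have := hol_expand JJ hk x v; have := hol_expand JJ hk x (- v).
  by rewrite !h0 !mulNmx /kap !(kE hk); lra.
have h' v : kap k x v v = 0.
  by have := h v; have := h (v *m J); rewrite (J2 JJ) (kapNN hk); lra.
have -> : Kmx k x = 0.
  apply/rowmul_inj => v; rewrite mulmx0.
  rewrite -(scale0r v); apply: form_max_eigen; first exact: Kmx_sym hk _.
    by move=> y; rewrite (KmxE hk) h' mul0r.
  by rewrite (KmxE hk) h' mul0r.
left; exists 0 => a; rewrite -(raddf0 (@scalar_mx R N)) rank_eigenspace_scalar.
by case: (a == 0); rewrite ?mul1n ?mul0n // add1n subn1 prednK.
Qed.

Context (x xt : 'rV[R]_N) (M mt : R).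
Context (x1 : dot x x = 1) (hx : hol J k x = M).
Context (t1 : dot xt xt = 1) (ht : hol J k xt = mt).
Context (hM : forall y, hol J k y <= M * dot y y ^+ 2).
Context (hm : forall y, mt * dot y y ^+ 2 <= hol J k y).
Context (M0 : 0 < M).

Lemma flat_type : - 2 * M < mt -> \rank (U1 J k x M) = 0%N -> osserman_type (Kmx k x).
Proof.
move=> hmt U10; right; exists M, (M / 4); split; first by move: M0; lra.
move=> a; apply: (rank_eig_split JJ JT hk) => //; first exact: (Kmx_xJ JJ JT hk x1 hx hM).
exact: (flat_T JJ JT hk iso x1 hx hM hm M0 hmt U10).
Qed.

Let hN y : hol J (kopp k) y <= - mt * dot y y ^+ 2.
Proof. by have := hm y; rewrite /hol /kap /kopp; lra. Qed.

Let hNm y : - M * dot y y ^+ 2 <= hol J (kopp k) y.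
Proof. by have := hM y; rewrite /hol /kap /kopp; lra. Qed.

Let hNt : hol J (kopp k) xt = - mt.
Proof. by rewrite -ht. Qed.

Lemma no_strict m : N = (4 * m + 2)%N -> - M <= mt -> mt < - M / 2 -> False.
Proof.
move=> Nm h1 h2.
have hk' := kaehler_opp hk; have iso' := isospectral_opp iso.
have M0' : 0 < - mt by move: M0; lra.
have c1 : - 2 * M < mt by move: M0; lra.
have c2 : - 2 * - mt < - M by move: M0; lra.
have r1 := rank_U13 JJ JT hk iso x1 hx hM hm M0 c1.
have r2 := rank_U13 JJ JT hk' iso' t1 hNt hN hNm M0' c2.
have o1 := even_rank_U1 JJ JT hk x1 hx hM.
have o2 := even_rank_U1 JJ JT hk' t1 hNt hN.
have j1 := rank_JU3 JJ JT hk x1 hx hM.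
have j2 := rank_JU3 JJ JT hk' t1 hNt hN.
have tr1 := trace_le JJ JT hk iso x1 hx hM hm M0 c1.
have tr2 := trace_le JJ JT hk' iso' t1 hNt hN hNm M0' c2.
have p1 := pos_U3 JJ JT hk x1 hx hM hm M0 c1.
have p2 := pos_U3 JJ JT hk' t1 hNt hN hNm M0' c2.
(* [W] conjugates the Jacobi operators at the maximum and at the minimum: their traces agree, and a
   space on which the second is negative is carried to one on which the first is. *)
have [W [WW WE]] := same_eig_orth (Kmx_sym hk x) (Kmx_sym hk xt) (iso x1 t1).
have trE : \tr (Kmx k xt) = \tr (Kmx k x).
  by rewrite WE mxtrace_mulC mulmxA WW mul1mx.
rewrite Kmx_opp raddfN /= trE in tr2.
set P := (x *m J + _)%MS in j1 p1.
set Q := (xt *m J + _)%MS in j2 p2.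
have x0 : x != 0 by rewrite -dot_gt0 x1.
have le := @rank_pos_neg R N _ _ (Kmx k x) P (Q *m W^T) x (Kmx_sym hk x) (Kmx_x0 hk x) x0.
have rQ : \rank (Q *m W^T) = \rank Q.
  by apply: mxrankMfree; apply: row_free_orth; rewrite trmxK (orthT WW).
rewrite rQ j1 j2 in le.
have {}le : ((\rank (U3 J k x M)).+1 + (\rank (U3 J (kopp k) xt (- mt))).+2 <= N)%N.
  apply: le.
    by move=> v vP v0; rewrite (KmxE hk); exact: p1.
  move=> v /submxP[w ->]; rewrite mulmxA => v0.
  have wQ : (w *m Q <= Q)%MS by apply: submxMl.
  have w0 : w *m Q != 0 by apply: contraNneq v0 => ->; rewrite mul0mx.
  have := p2 _ wQ w0; rewrite {1}/kap /kopp -/(kap k xt _ _) -(KmxE hk) WE.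
  by rewrite !mulmxA [dot (_ *m W) _]dot_mulmx oppr_gt0.
move: r1 r2 o1 o2 le tr1 tr2.
set n1 := \rank (U1 J k x M); set n3 := \rank (U3 J k x M).
set l1 := \rank (U1 J (kopp k) xt _); set l3 := \rank (U3 J (kopp k) xt _).
move=> r1 r2 o1 o2 le tr1 tr2.
have [{}r1 {}r2 e3 m1] := even_ranks Nm r1 r2 o1 o2 le.
have {}r1 : n1%:R = 4 * m%:R - n3%:R :> R by rewrite -(natrM _ 4) -r1 natrD addrK.
have {}r2 : l1%:R = 4 * m%:R - l3%:R :> R by rewrite -(natrM _ 4) -r2 natrD addrK.
have {}e3 : n3%:R + l3%:R + 2 <= 4 * m%:R :> R.
  by rewrite -(natrM _ 4) -!natrD ler_nat.
have {}m1 : 1 <= m%:R :> R by rewrite ler1n.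
have n0 : 0 <= n3%:R :> R by rewrite ler0n.
have l0 : 0 <= l3%:R :> R by rewrite ler0n.
rewrite r1 in tr1; rewrite r2 in tr2.
move: (n3%:R) (l3%:R) (m%:R) n0 l0 m1 e3 tr1 tr2 => n l mm n0 l0 m1 e3 tr1 tr2.
(* In these terms the two trace bounds read [2 tr K <= M A] and [- 2 tr K <= - mt B], and the rank
   bound reads [n + l <= q]. *)
pose q := 4 * mm - 2; pose A := 3 / 2 * n - q; pose B := 3 / 2 * l - q.
have s : 0 <= M * A + (- mt) * B by rewrite /A /B /q; lra.
have ab : A + B <= - q / 2 by rewrite /A /B /q; lra.
have q2 : 2 <= q by rewrite /q; lra.
have aq : A <= q / 2 by rewrite /A /q; lra.
have Mq : 0 < M * q by rewrite mulr_gt0 //; lra.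
have k1 : M * (A + B) <= M * (- q / 2) by rewrite ler_pM2l.
have k2 : M * A <= M * (q / 2) by rewrite ler_pM2l.
(* If [B >= 0], then [- mt <= M] bounds the sum by [M (A + B) < 0]. If [B < 0], then [- mt > M/2]
   bounds it strictly by [M/2 (A + (A + B))], which is at most 0. *)
have [B0|B0] := lerP 0 B.
  have : (- mt) * B <= M * B by rewrite ler_wpM2r //; lra.
  by lra.
have : (- mt) * B < M / 2 * B by rewrite ltr_nM2r //; lra.
by lra.
Qed.

Lemma boundary_impossible m : N = (4 * m + 2)%N -> mt = - M / 2 ->
  (forall r, (r + 4)%N = N -> @osserman_dim R r) ->
  \rank (U1 J k x M) = 0%N.
Proof.
move=> Nm mtE IH; apply/eqP; apply: contraT => r0.
have hk' := kaehler_opp hk; have iso' := isospectral_opp iso.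
have M0' : 0 < - mt by move: M0; lra.
have c0 : - 2 * M < mt by move: M0; lra.
(* The opposite tensor has maximum [M/2] and minimum [- M], exactly at the threshold of [half_top]:
   the eigenvalue bound still holds there, but the strict hypothesis of [top_simple] fails. *)
have c2 : - 2 * - mt <= - M by move: M0; lra.
have hup := half_top JJ JT hk iso x1 hx hM hm M0 (ltW c0).
have hlow u y : - M / 2 * dot u u * dot y y <= kap k u y y.
  have := half_top JJ JT hk' iso' t1 hNt hN hNm M0' c2 u y.
  by rewrite mtE /kap /kopp; lra.
have rU := rank_U13 JJ JT hk iso x1 hx hM hm M0 c0.
have hm' y : - M / 2 * dot y y ^+ 2 <= hol J k y by rewrite -mtE.
have ht' : hol J k xt = - M / 2 by rewrite -mtE.
have [rM rm] := boundary_rank JJ JT hk M0 iso hM hm' hup hlow t1 ht' x1 hx r0.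
have [s ps] := boundary_pair JJ JT hk hM hm' x1 hx r0.
have N6 : (6 <= N)%N.
  exact: six_le Nm rU r0.
have [E [EE EL]] := onb (Lp J x s).
have rL := rank_Lp JJ JT ps.
pose r := \rank (Lp J x s); rewrite -/r in E EE EL rL.
have r4 : (r + 4)%N = N by rewrite rL subnK //; apply: leq_trans N6.
pose J' : 'M[R]_r := E *m J *m E^T.
have EJ : E *m J = J' *m E.
  have : (E *m J <= E)%MS.
    by rewrite (eqmxMr J EL) EL; exact: Lp_J.
  by rewrite /J'; case/submxP => D DE; rewrite DE -(mulmxA D) EE mulmx1.
pose k' (u y z w : 'rV[R]_r) := k (u *m E) (y *m E) (z *m E) (w *m E).
have EJv (v : 'rV[R]_r) : v *m J' *m E = v *m E *m J.
  by rewrite -(mulmxA v J') -(mulmxA v E) EJ.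
have JJ' : J' *m J' = - 1%:M.
  by rewrite {2}/J' !mulmxA -EJ -(mulmxA E) JJ mulmxN mulmx1 mulNmx EE.
have JT' : J' *m J'^T = 1%:M.
  rewrite {2}/J' !trmx_mul trmxK !mulmxA -EJ -(mulmxA E J) JT mulmx1 EE //.
have kk' : kaehler J' k'.
  split=> *; rewrite /k' ?mulmxDl -?scalemxAl ?(kE hk) //.
  - exact: k_skew hk _ _ _ _.
  - exact: k_pair hk _ _ _ _.
  - exact: k_bianchi hk _ _ _ _.
  - by rewrite !EJv (k_J hk).
have KE u : Kmx k' u = E *m Kmx k (u *m E) *m E^T.
  apply/rowmul_inj => y; apply: dot_ext => z; rewrite (KmxE kk') !mulmxA.
  by rewrite dot_mulmx trmxK (KmxE hk).
have uE u : dot u u = 1 -> dot (u *m E) (u *m E) = 1.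
  by rewrite dot_mul2 EE mulmx1.
have blk u a : dot u u = 1 -> \rank (eigenspace (Kmx k (u *m E)) a) =
    ((a == (M / 4)%R) * 4 + \rank (eigenspace (Kmx k' u) a))%N.
  move=> u1; rewrite KE.
  apply: (rank_Lp_block JJ JT hk M0 iso hM hm' hup hlow t1 ht' a ps _ (uE _ u1) EE EL).
  by rewrite -EL submxMl.
have iso2 : isospectral k'.
  move=> u v u1 v1 a; apply/eqP; rewrite -(eqn_add2l ((a == (M / 4)%R) * 4)).
  by rewrite -!blk // (iso (uE _ u1) (uE _ v1)).
have r0' : (0 < r)%N by rewrite -(ltn_add2r 4) r4 add0n (leq_trans _ N6).
pose u : 'rV[R]_r := delta_mx 0 (Ordinal r0').
have u1 : dot u u = 1 by rewrite dot_delta mxE !eqxx.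
have IHu := IH _ r4 _ _ JJ' JT' kk' iso2 _ u1.
have e1 := blk u M u1; have e2 := blk u (- M / 2) u1.
rewrite (iso (uE _ u1) x1) rM in e1; rewrite (iso (uE _ u1) x1) rm in e2.
have n1 : (M == M / 4) = false by apply/eqP; move: M0; lra.
have n2 : (- M / 2 == M / 4) = false by apply/eqP; move: M0; lra.
have n3 : (M == 0) = false by apply/eqP; move: M0; lra.
have n4 : (- M / 2 == 0) = false by apply/eqP; move: M0; lra.
have n5 : M != - M / 2 by apply/eqP; move: M0; lra.
rewrite n1 add0n in e1; rewrite n2 add0n in e2.
(* On the smaller space [M] has multiplicity 1 and [- M/2] has multiplicity 2. A single eigenvalue
   is not both; with two, multiplicity 2 can only be that of [c2'], so [r - 2 = 2] and [N = 8]. *)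
case: IHu => [[c h]|[c1 [c2' [ne h]]]]; move: e1 e2; rewrite !h n3 n4 !add0n.
  case: eqP => // Mc; case: eqP => // mc; move: n5.
  by rewrite {1}Mc mc eqxx.
move=> _; case: (@eqP _ (- M / 2) c2') => [mc|_]; last first.
  by rewrite mul0n addn0; case: eqP.
case: eqP => [mc1|_]; first by case: ne; rewrite -mc1 mc.
by rewrite add0n mul1n => h2; case: (six_ne Nm r4 h2).
Qed.

Lemma extremal_type m : N = (4 * m + 2)%N -> - M <= mt ->
  (forall r, (r + 4)%N = N -> @osserman_dim R r) ->
  osserman_type (Kmx k x).
Proof.
move=> Nm h IH; have [h1|h1|h1] := ltgtP mt (- M / 2).
- by case: (no_strict Nm h h1).
- apply: flat_type; first by move: M0; lra.
  by apply: (U1_0 JJ JT hk x1 hx hM hm); lra.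
- apply: flat_type; first by move: M0; lra.
  exact: boundary_impossible Nm h1 IH.
Qed.

End Tensor.

End Main.

Lemma sphere_extremum (R : realType) N (f : 'rV[R]_N -> R) : (0 < N)%N ->
  continuous f -> exists2 x, dot x x = 1 & forall y, dot y y = 1 -> f y <= f x.
Proof. by case: N f => // N f _; exact: sphere_max. Qed.

Lemma osserman_step (R : realType) m N : N = (4 * m + 2)%N ->
  (forall r, (r + 4)%N = N -> @osserman_dim R r) -> @osserman_dim R N.
Proof.
move=> Nm IH J k JJ JT hk iso u u1.
have N0 : (0 < N)%N by rewrite Nm addn2.
have ext (s : R) : exists2 x, dot x x = 1 &
    forall y, s * hol J k y <= s * hol J k x * dot y y ^+ 2.
  have c : continuous (fun y => s * hol J k y).
    by apply: cont_mul; [move=> ?; exact: cst_continuous | exact: (cont_hol hk)].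
  have [x x1 xm] := sphere_extremum N0 c.
  by exists x => //; exact: (hol_extremum hk xm).
have [x x1 hM] := ext 1; have [xt t1 hm] := ext (-1).
have {}hM y : hol J k y <= hol J k x * dot y y ^+ 2 by have := hM y; lra.
have {}hm y : hol J k xt * dot y y ^+ 2 <= hol J k y by have := hm y; lra.
have tx := hM xt; rewrite t1 expr1n mulr1 in tx.
(* If the minimum lies below the opposite of the maximum, the opposite tensor satisfies the
   normalisation [mt >= - M]. *)
have [h|h] := lerP (- hol J k x) (hol J k xt).
  have [M0|M0] := lerP (hol J k x) 0.
    apply: (hol0_type JJ hk) => // y; apply/eqP; rewrite eq_le.
    have e1 : hol J k x = 0 by lra.
    have e2 : hol J k xt = 0 by lra.
    by have := hM y; have := hm y; rewrite e1 e2 mul0r => -> ->.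
  apply: (osserman_type_same (iso x u x1 u1)).
  exact: (extremal_type JJ JT hk iso x1 erefl t1 erefl hM hm M0 Nm h IH).
apply: (osserman_type_same (iso xt u t1 u1)).
rewrite -[Kmx k xt]opprK; apply: osserman_typeN; rewrite -Kmx_opp.
have oE y : hol J (kopp k) y = - hol J k y by [].
have M0 : 0 < hol J (kopp k) xt by rewrite oE; lra.
apply: (extremal_type JJ JT (kaehler_opp hk) (isospectral_opp iso) t1 erefl x1 erefl _ _ M0 Nm _ IH).
- by move=> y; have := hm y; rewrite !oE; lra.
- by move=> y; have := hM y; rewrite !oE; lra.
- by rewrite !oE; lra.
Qed.

(* The only case not settled directly leaves a tensor on a subspace of
   codimension 4 whose multiplicities are impossible by induction. *)
Theorem isospectral_type (R : realType) m N : N = (4 * m + 2)%N -> @osserman_dim R N.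
Proof.
elim: m N => [|m IH] N Nm; apply: (osserman_step Nm) => r rN.
  by move: rN; rewrite Nm !addnS.
apply: IH; move: rN; rewrite Nm mulnS -addnA addnC => /addnI rE; exact: rE.
Qed.

(** * The structure of T_pM *)

Section Form.
Context {R : realType} {N : nat}.
Implicit Types (G : 'M[R]_N) (x y z : 'rV[R]_N).

Definition ip G x y : R := (x *m G *m y^T) 0 0.

Lemma ipDl G x y z : ip G (x + y) z = ip G x z + ip G y z.
Proof. by rewrite /ip !mulmxDl mxE. Qed.

Lemma ipZl G a x z : ip G (a *: x) z = a * ip G x z.
Proof. by rewrite /ip -!scalemxAl mxE. Qed.

Lemma ipDr G x y z : ip G x (y + z) = ip G x y + ip G x z.
Proof. by rewrite /ip linearD mulmxDr mxE. Qed.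

Lemma ipZr G a x z : ip G x (a *: z) = a * ip G x z.
Proof. by rewrite /ip linearZ -scalemxAr mxE. Qed.

Lemma ip0l G z : ip G 0 z = 0.
Proof. by rewrite /ip !mul0mx mxE. Qed.

Lemma ip0r G z : ip G z 0 = 0.
Proof. by rewrite /ip trmx0 mulmx0 mxE. Qed.

Lemma ipNl G x z : ip G (- x) z = - ip G x z.
Proof. by rewrite -scaleN1r ipZl mulN1r. Qed.

Lemma ipNr G x z : ip G x (- z) = - ip G x z.
Proof. by rewrite -scaleN1r ipZr mulN1r. Qed.

Lemma ip_suml G I (r : seq I) (F : I -> 'rV[R]_N) z :
  ip G (\sum_(i <- r) F i) z = \sum_(i <- r) ip G (F i) z.
Proof. by apply: (big_morph (fun x => ip G x z)); [move=> ? ?; exact: ipDl | exact: ip0l]. Qed.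

Lemma ip_sumr G I (r : seq I) (F : I -> 'rV[R]_N) z :
  ip G z (\sum_(i <- r) F i) = \sum_(i <- r) ip G z (F i).
Proof. by apply: (big_morph (ip G z)); [move=> ? ?; exact: ipDr | exact: ip0r]. Qed.

Definition ipE := (ipDl, ipDr, ipZl, ipZr, ipNl, ipNr).

End Form.

(** * The covariant derivatives of [xi] and [phi] from their algebraic identities *)

Section Pointwise.
Context {R : realType} {N s : nat} (G F : 'M[R]_N).
Context (xi : 'I_s -> 'rV[R]_N) (e : 'I_s -> R).
Implicit Types (x y z w : 'rV[R]_N) (a b : 'I_s).

Local Notation g := (ip G).

(** The 1-forms are eliminated through [eta_a = e_a g(., xi_a)]. *)
Record S_frame : Prop := SFrame {
  f_sym : forall x y, g x y = g y x;
  f_nondeg : forall x, (forall y, g x y = 0) -> x = 0;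
  f_e : forall a, e a * e a = 1;
  f_phi2 : forall x, x *m F *m F = - x + \sum_a (e a * g x (xi a)) *: xi a;
  f_xiF : forall a, xi a *m F = 0;
  f_xi : forall a b, g (xi a) (xi b) = e a * (a == b)%:R;
  f_skew : forall x y, g (x *m F) y = - g x (y *m F) }.

Context (hf : S_frame).

Let gC := f_sym hf.

Lemma ip_ext x y : (forall z, g x z = g y z) -> x = y.
Proof.
move=> h; apply/eqP; rewrite -subr_eq0; apply/eqP; apply: (f_nondeg hf) => z.
by rewrite !ipE h subrr.
Qed.

Lemma Fxi x a : g (x *m F) (xi a) = 0.
Proof. by rewrite (f_skew hf) (f_xiF hf) ip0r oppr0. Qed.

Definition xibar := \sum_a xi a.

Lemma xibarF : xibar *m F = 0.
Proof. by rewrite /xibar mulmx_suml big1 // => a _; exact: f_xiF. Qed.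

Lemma Fxibar x : g (x *m F) xibar = 0.
Proof. by rewrite (f_skew hf) xibarF ip0r oppr0. Qed.

Lemma F3 x : x *m F *m F *m F = - (x *m F).
Proof.
rewrite (f_phi2 hf) big1 ?addr0 // => a _.
by rewrite Fxi mulr0 scale0r.
Qed.

Lemma split_frame x : x = - (x *m F *m F) + \sum_a (e a * g x (xi a)) *: xi a.
Proof. by rewrite (f_phi2 hf) opprD opprK subrK. Qed.

Context (A : 'I_s -> 'rV[R]_N -> 'rV[R]_N) (P : 'rV[R]_N -> 'rV[R]_N -> 'rV[R]_N).

(* Satisfied by A a x = nabla_x xi_a and P x y = (nabla_x phi) y. *)
Record S_tensors : Prop := STensors {
  t_Alin : forall a k x y, A a (k *: x + y) = k *: A a x + A a y;
  t_Pl : forall k x y z, P (k *: x + y) z = k *: P x z + P y z;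
  t_contact : forall a x y, g (A a x) y - g (A a y) x = 2 * e a * g x (y *m F);
  t_unit : forall a b x, g (A a x) (xi b) + g (xi a) (A b x) = 0;
  t_skew : forall x y z, g (P x y) z + g y (P x z) = 0;
  t_closed : forall x y z, g y (P x z) + g z (P y x) + g x (P z y) = 0;
  t_phi2 : forall x y, P x (y *m F) + P x y *m F =
    \sum_a e a *: (g (A a x) y *: xi a + g y (xi a) *: A a x);
  t_normal : forall x y, P (x *m F) y - P (y *m F) x + P y x *m F - P x y *m F
    + (2 * g x (y *m F)) *: xibar = 0;
  t_phixi : forall x a, P x (xi a) + A a x *m F = 0 }.

Context (ht : S_tensors).

Lemma A0 a : A a 0 = 0.
Proof. by have := t_Alin ht a (-1) 0 0; rewrite scaler0 addr0 scaleN1r addNr. Qed.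

Lemma AD a x y : A a (x + y) = A a x + A a y.
Proof. by have := t_Alin ht a 1 x y; rewrite !scale1r. Qed.

Lemma AZ a k x : A a (k *: x) = k *: A a x.
Proof. by have := t_Alin ht a k x 0; rewrite !addr0 A0 addr0. Qed.

Lemma AN a x : A a (- x) = - A a x.
Proof. by rewrite -scaleN1r AZ scaleN1r. Qed.

Lemma A_sum a I (r : seq I) (f : I -> 'rV[R]_N) :
  A a (\sum_(i <- r) f i) = \sum_(i <- r) A a (f i).
Proof. by apply: big_morph; [exact: AD | exact: A0]. Qed.

Lemma P0l z : P 0 z = 0.
Proof. by have := t_Pl ht (-1) 0 0 z; rewrite scaler0 addr0 scaleN1r addNr. Qed.

Lemma P_xi x a : P x (xi a) = - (A a x *m F).
Proof. by apply/eqP; rewrite -addr_eq0 (t_phixi ht). Qed.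

(** In the closedness identity for [x], [y], [xi b], the two terms not differentiated along [xi b]
    contain it as an argument of [P], where [P_xi] applies. *)
Lemma P_xi_l b x : P (xi b) x = - (A b x *m F) - A b (x *m F) - (2 * e b) *: (x *m F *m F).
Proof.
apply: ip_ext => y; rewrite !ipE.
have h := t_closed ht x y (xi b); rewrite P_xi ipNr in h.
have h1 := t_skew ht y x (xi b); rewrite P_xi ipNr (gC x) in h1.
rewrite (f_skew hf (A b y)) in h1.
have h2 := t_skew ht (xi b) y x; rewrite (gC _ x) in h2.
have h3 := t_contact ht b (x *m F) y.
rewrite !(f_skew hf) in h h1 h2 h3 *.
have s1 := gC y (A b x *m F); rewrite (f_skew hf) in s1.
have s2 := gC (P y x) (xi b); have s3 := gC y (P (xi b) x).
have s4 := gC (P (xi b) y) x; have s5 := gC (A b y) (x *m F).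
lra.
Qed.

Lemma FAF b x : A b (x *m F) *m F = e b *: (x *m F).
Proof.
have h := t_normal ht x (xi b).
rewrite (f_xiF hf) P0l P_xi subr0 P_xi P_xi_l ip0r mulr0 scale0r addr0 in h.
have h2 := F3 x.
move: h; rewrite !mulmxDl !mulNmx -scalemxAl F3 => h.
apply/rowP => i; have := congr1 (fun A : 'rV[R]_N => A 0 i) h.
rewrite !mxE; lra.
Qed.

Lemma beta_sym a b c : g (A a (xi b)) (xi c) = g (A a (xi c)) (xi b).
Proof.
have := t_contact ht a (xi b) (xi c); rewrite (f_xiF hf) ip0r mulr0; lra.
Qed.

(** The expression is skew in [a], [c] and symmetric in [b], [c]; composing the two exchanges around
    the three indices gives its own opposite. *)
Lemma beta0 a b c : g (A a (xi b)) (xi c) = 0.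
Proof.
have k (u v w : 'I_s) : g (A u (xi v)) (xi w) = - g (A w (xi v)) (xi u).
  by have := t_unit ht u w (xi v); rewrite (gC (xi u)); lra.
have := k a b c; have := beta_sym c b a; have := k c a b.
have := beta_sym b a c; have := k b c a; have := beta_sym a c b; lra.
Qed.

(** [A a (xi b)] is skew in [a], [b], so normality on [xi a], [xi b] kills its horizontal part; its
    vertical part is [beta0]. *)
Lemma A_xi a b : A a (xi b) = 0.
Proof.
have sk c d x : g (A c x) (xi d) = - g (A d x) (xi c).
  by have := t_unit ht c d x; rewrite (gC (xi c)); lra.
have e1 c d x : g (A c x) (xi d) = g (A c (xi d)) x.
  by have := t_contact ht c x (xi d); rewrite (f_xiF hf) ip0r mulr0; lra.
have e2 : A a (xi b) = - A b (xi a).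
  apply: ip_ext => x; rewrite ipE -!e1; exact: sk.
have h := t_normal ht (xi a) (xi b).
rewrite !(f_xiF hf) !P0l subrr add0r !P_xi e2 !mulNmx ip0r mulr0 scale0r addr0 opprK in h.
have h2 : A b (xi a) *m F *m F = 0.
  apply/rowP => i; have := congr1 (fun A : 'rV[R]_N => A 0 i) h; rewrite !mxE; lra.
rewrite e2 (split_frame (A b (xi a))) h2 oppr0 add0r big1 ?oppr0 // => c _.
by rewrite beta0 mulr0 scale0r.
Qed.

Lemma A_phi b x : A b (x *m F) = - e b *: (x *m F *m F).
Proof.
have h := FAF b x.
rewrite (split_frame (A b (x *m F))) h -scalemxAl -scaleNr big1 ?addr0 // => c _.
have := t_contact ht b (x *m F) (xi c).
by rewrite A_xi ip0l (f_xiF hf) ip0r subr0 mulr0 => ->; rewrite mulr0 scale0r.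
Qed.

Theorem A_eq b x : A b x = - e b *: (x *m F).
Proof.
rewrite {1}(split_frame x) AD AN A_phi A_sum big1 => [|a _]; last first.
  by rewrite AZ A_xi scaler0.
by rewrite addr0 -scalerN F3 opprK.
Qed.

Definition covphi x y := g (x *m F) (y *m F) *: xibar + g y xibar *: (x *m F *m F).

Let D x y := P x y - covphi x y.
Let d x y z := g (D x y) z.

Lemma gFF x y : g (x *m F) (y *m F) = - g x (y *m F *m F).
Proof. exact: f_skew. Qed.

Lemma FFr x y : g (x *m F *m F) y = g x (y *m F *m F).
Proof. by rewrite !(f_skew hf) opprK. Qed.

Lemma dE x y z : d x y z = g (P x y) z - g (x *m F) (y *m F) * g xibar z
  - g y xibar * g (x *m F *m F) z.
Proof. by rewrite /d /D /covphi !ipE; ring. Qed.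

Lemma d_skew x y z : d x y z = - d x z y.
Proof.
rewrite !dE !FFr; have := t_skew ht x y z; rewrite (gC y (P x z)) !gFF (gC xibar z) (gC xibar y).
lra.
Qed.

Lemma d_cyc x y z : d x z y + d y x z + d z y x = 0.
Proof.
rewrite !dE; have := t_closed ht x y z.
rewrite (gC y (P x z)) (gC z (P y x)) (gC x (P z y)) !FFr !gFF.
rewrite (gC xibar y) (gC xibar z) (gC xibar x).
have k u v : g u (v *m F *m F) = g v (u *m F *m F) by rewrite -FFr gC.
rewrite (k z x) (k x y) (k z y); lra.
Qed.

Lemma d_xi x a z : d x (xi a) z = 0.
Proof.
rewrite dE P_xi A_eq (f_xiF hf) ip0r -scalemxAl !ipE.
have -> : g (xi a) xibar = e a.
  rewrite /xibar ip_sumr (bigD1 a) //= (f_xi hf) eqxx mulr1 big1 ?addr0 // => b ba.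
  by rewrite (f_xi hf) eq_sym (negbTE ba) mulr0.
ring.
Qed.

Lemma d_xi' x y a : d x y (xi a) = 0.
Proof. by rewrite d_skew d_xi oppr0. Qed.

Lemma d_phi x y z : d x (y *m F) z = d x y (z *m F).
Proof.
rewrite !dE Fxibar mul0r subr0.
have h := congr1 (fun v => g v z) (t_phi2 ht x y).
rewrite ipDl (f_skew hf (P x y)) ip_suml in h.
have e1 : \sum_a g (e a *: (g (A a x) y *: xi a + g y (xi a) *: A a x)) z =
    - g (x *m F) y * g xibar z - g y xibar * g (x *m F) z.
  rewrite /xibar ip_suml ip_sumr mulr_sumr mulr_suml -sumrB; apply: eq_bigr => a _.
  rewrite !A_eq !ipE.
  have := f_e hf a => ea.
  transitivity (- (e a * e a) * (g (x *m F) y * g (xi a) z) -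
     (e a * e a) * (g y (xi a) * g (x *m F) z)); first by ring.
  by rewrite ea; ring.
rewrite e1 in h.
have -> : g xibar (z *m F) = 0 by rewrite gC Fxibar.
rewrite gFF F3 ipNr opprK (FFr x) F3 ipNr.
rewrite !(f_skew hf x) in h *; lra.
Qed.

Lemma d_normal x y z : d (x *m F) y z - d (y *m F) x z - d y x (z *m F) + d x y (z *m F) = 0.
Proof.
have h := congr1 (fun v => g v z) (t_normal ht x y).
rewrite ip0l !ipE !(f_skew hf) in h; rewrite !dE !(f_skew hf) !F3 ?ipNr.
have -> : g xibar (z *m F) = 0 by rewrite gC Fxibar.
have k1 : g y (x *m F) = - g x (y *m F) by rewrite gC (f_skew hf).
rewrite k1; lra.
Qed.

(** The defect [q] is symmetric in its first two arguments and skew in the last two, hence zero. *)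
Lemma d_phi1 x y z : d (x *m F) y z = - d x y (z *m F).
Proof.
pose q u v w := d (u *m F) v w + d u v (w *m F).
have s1 u v w : q u v w = q v u w by have := d_normal u v w; rewrite /q; lra.
have s2 u v w : q u v w = - q u w v.
  by rewrite /q (d_skew (u *m F)) -d_phi (d_skew u (v *m F)); ring.
have := s1 x y z; have := s2 y x z; have := s1 y z x; have := s2 z y x.
have := s1 z x y; have := s2 x z y; rewrite /q; lra.
Qed.

Lemma d_FF x y z : d x y (z *m F *m F) = - d x y z.
Proof.
rewrite (f_phi2 hf) /d ipDr ipNr ip_sumr big1 ?addr0 // => a _.
by rewrite ipZr -/(d x y (xi a)) d_xi' mulr0.
Qed.

(** The behaviour of [d] under [phi] turns the cyclic identity into one with a single sign reversed;
    its three cyclic instances leave only [d = 0]. *)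
Theorem P_eq x y : P x y = covphi x y.
Proof.
apply/eqP; rewrite -subr_eq0; apply/eqP; apply: (f_nondeg hf) => z.
rewrite -/(D x y) -/(d x y z).
have k u v w : d u v w + d v w u - d w u v = 0.
  have := d_cyc (u *m F) w (v *m F).
  have -> : d (u *m F) (v *m F) w = d u v w by rewrite d_phi1 d_phi d_FF opprK.
  have -> : d w (u *m F) (v *m F) = - d w u v by rewrite d_phi d_FF.
  have -> : d (v *m F) w (u *m F) = d v w u by rewrite d_phi1 d_FF opprK.
  by lra.
have := k x y z; have := k y z x; have := k z x y; lra.
Qed.

End Pointwise.

(** * Restrictions of operators and Lorentzian forms *)

Section LinearAlgebra.
Context {R : realType}.

Lemma lin1_mxE m n (f : 'rV[R]_m -> 'rV[R]_n) v :
  (forall a x y, f (a *: x + y) = a *: f x + f y) -> v *m lin1_mx f = f v.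
Proof.
move=> lf.
have f0 : f 0 = 0 by have := lf (-1) 0 0; rewrite scaler0 addr0 scaleN1r addNr.
have fD x y : f (x + y) = f x + f y by have := lf 1 x y; rewrite !scale1r.
have fZ a x : f (a *: x) = a *: f x by have := lf a x 0; rewrite !addr0 f0 addr0.
rewrite [X in f X]row_sum_delta (big_morph f fD f0).
rewrite mulmx_sum_row; apply: eq_bigr => i _; rewrite fZ; congr (_ *: _).
by apply/rowP => j; rewrite !mxE.
Qed.

(** [restrictmx] is expressed in a basis of [V] of its own; multiplicities may be read in any basis
    [P] adapted to the operator. *)
Lemma restrict_eig k m n (V : 'M[R]_(m, n)) (f : 'M[R]_n) (P : 'M[R]_(k, n)) (C : 'M[R]_k) a :
  row_free P -> (P :=: V)%MS -> P *m f = C *m P ->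
  \rank (eigenspace (restrictmx V f) a) = \rank (eigenspace C a).
Proof.
move=> Pf PV PC; rewrite (eig_transfer a Pf PC).
have h : row_base V *m f = restrictmx V f *m row_base V.
  rewrite /conjmx mulmxKpV // eq_row_base -PV.
  have /submxP[D ->] : (row_base V <= P)%MS by rewrite eq_row_base PV.
  by rewrite -mulmxA PC mulmxA submxMl.
rewrite (eig_transfer a (row_base_free V) h); apply: eqmx_rank.
apply/andP; split; apply: capmxS => //; first by rewrite eq_row_base PV.
by rewrite eq_row_base PV.
Qed.

Lemma eigenspace_shift n (C : 'M[R]_n) b a :
  eigenspace (C + b%:M) a = eigenspace C (a - b).
Proof. by rewrite /eigenspace raddfB /= opprB addrA addrAC. Qed.

(** The combination of [x] and [v] without time coordinate has nonnegative square, and orthogonality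
    removes its cross term. As [v] contributes negatively, [x] must contribute positively. *)
Lemma lorentzian_pos n (G : 'M[R]_n) (x v : 'rV[R]_n) : lorentzian G ->
  ip G v v < 0 -> ip G x v = 0 -> x != 0 -> 0 < ip G x x.
Proof.
case=> sG [P Pu PGP] vv xv x0.
pose d : 'rV[R]_n := \row_(i < n) (if val i == 0%N then -1 else 1).
have ipd (a b : 'rV[R]_n) : ip G (a *m P) (b *m P) = \sum_i d 0 i * a 0 i * b 0 i.
  rewrite /ip trmx_mul mulmxA -(mulmxA a) -(mulmxA a) PGP mxE.
  apply: eq_bigr => i _; rewrite mul_mx_diag !mxE; ring.
have [a aE] : exists a, x = a *m P by exists (x *m invmx P); rewrite mulmxKV.
have [b bE] : exists b, v = b *m P by exists (v *m invmx P); rewrite mulmxKV.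
subst x v.
have a0 : a != 0 by apply: contraNneq x0 => ->; rewrite mul0mx.
case: n => [|n] in G sG P Pu PGP d ipd a b vv xv x0 a0 *.
  by move: a0; rewrite [a]thinmx0 eqxx.
(* y has no timelike component *)
pose y := b 0 0 *: a - a 0 0 *: b.
have yy : ip G (y *m P) (y *m P) =
    b 0 0 ^+ 2 * ip G (a *m P) (a *m P) + a 0 0 ^+ 2 * ip G (b *m P) (b *m P).
  have sy : ip G (b *m P) (a *m P) = ip G (a *m P) (b *m P).
    by rewrite !ipd; apply: eq_bigr => i _; ring.
  rewrite /y mulmxBl -!scalemxAl !ipE sy xv; ring.
have y0 : y 0 0 = 0 by rewrite !mxE; ring.
have pos (w : 'rV[R]_n.+1) i : w 0 0 = 0 -> 0 <= d 0 i * w 0 i * w 0 i.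
  move=> w0; rewrite mxE; case: eqP => [i0|_]; last by rewrite mul1r -expr2 sqr_ge0.
  have -> : i = 0 by exact/val_inj.
  by rewrite w0 mulr0.
have ypos : 0 <= ip G (y *m P) (y *m P).
  by rewrite ipd; apply: sumr_ge0 => i _; exact: pos.
have bpos : 0 < b 0 0 ^+ 2.
  rewrite lt_def sqr_ge0 sqrf_eq0 andbT; apply/eqP => b0.
  by move: vv; rewrite ltNge ipd sumr_ge0 // => i _; exact: pos.
have [a00|a00] := eqVneq (a 0 0) 0.
  rewrite lt_def; apply/andP; split; last by rewrite ipd; apply: sumr_ge0 => i _; exact: pos.
  apply: contraNneq a0; rewrite ipd => /eqP; rewrite psumr_eq0 => [/allP h|i _]; last exact: pos.
  apply/eqP/rowP => i; have := h i (mem_index_enum _); rewrite [d 0 i]mxE [RHS]mxE /=.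
  case: (eqVneq (i : nat) 0%N) => [i0 _|_]; first by have -> : i = 0 by exact/val_inj.
  by rewrite mul1r mulf_eq0 orbb => /eqP.
have apos : 0 < a 0 0 ^+ 2 by rewrite lt_def sqr_ge0 sqrf_eq0 a00.
rewrite -(pmulr_rgt0 _ bpos).
have : 0 < a 0 0 ^+ 2 * - ip G (b *m P) (b *m P) by rewrite mulr_gt0 // oppr_gt0.
by move: ypos; rewrite yy; lra.
Qed.

End LinearAlgebra.

(** * The tensor [R - sigma R0] on the image of [phi] *)

Section Link.
Context {R : realType} {N n s : nat} (G F : 'M[R]_N).
Context (xi : 'I_s -> 'rV[R]_N) (e : 'I_s -> R) (hf : S_frame G F xi e).
Context (K : 'rV[R]_N -> 'rV[R]_N -> 'rV[R]_N -> 'rV[R]_N) (sigma : R).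
Implicit Types (x y z w v u : 'rV[R]_N) (a b : 'I_s).

Local Notation g := (ip G).

Definition horizontal x := forall a, g x (xi a) = 0.

(** [c_xi] and [c_phi] are the Ricci identities obtained by differentiating the formulas for the
    derivatives of [xi] and of [phi] once more. *)
Record S_curv : Prop := SCurv {
  c_lin1 : forall (a : R) x x' y z, K (a *: x + x') y z = a *: K x y z + K x' y z;
  c_lin3 : forall (a : R) x y z z', K x y (a *: z + z') = a *: K x y z + K x y z';
  c_skew : forall x y z, K x y z = - K y x z;
  c_bianchi : forall x y z, K x y z + K y z x + K z x y = 0;
  c_metric : forall x y z w, g (K x y z) w + g z (K x y w) = 0;
  c_xi : forall x y a, K x y (xi a) = - e a *:
    (g y (xibar xi) *: (x *m F *m F) - g x (xibar xi) *: (y *m F *m F));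
  c_phi : forall x y z w, horizontal x -> horizontal y -> horizontal z -> horizontal w ->
    g (K x y (z *m F)) w + g (K x y z) (w *m F) =
    sigma * (g x z * g (y *m F) w - g y z * g (x *m F) w
             + g z (x *m F) * g y w - g z (y *m F) * g x w) }.

Context (hK : S_curv).

Let gC := f_sym hf.

Lemma c_linD1 x x' y z : K (x + x') y z = K x y z + K x' y z.
Proof. by have := c_lin1 hK 1 x x' y z; rewrite !scale1r. Qed.

Lemma c_linD3 x y z z' : K x y (z + z') = K x y z + K x y z'.
Proof. by have := c_lin3 hK 1 x y z z'; rewrite !scale1r. Qed.

Lemma c_linD2 x y y' z : K x (y + y') z = K x y z + K x y' z.
Proof. by rewrite !(c_skew hK x) c_linD1 opprD. Qed.

Lemma c_xx x z : K x x z = 0.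
Proof.
apply/rowP => i; have := congr1 (fun A : 'rV[R]_N => A 0 i) (c_skew hK x x z).
by rewrite !mxE; lra.
Qed.

Lemma c_pair x y z w : g (K x y z) w = g (K z w x) y.
Proof.
have s12 p q r : K p q r = - K q p r := c_skew hK p q r.
have B p q r v : g (K p q r) v + g (K q r p) v + g (K r p q) v = 0.
  by rewrite -!ipDl (c_bianchi hK) ip0l.
have s34 p q r v : g (K p q r) v = - g (K p q v) r.
  by have := c_metric hK p q r v; rewrite (gC r); lra.
have t12 p q r v : g (K p q r) v = - g (K q p r) v by rewrite (s12 p) ipNl.
have := B x y z w; have := B y z w x; have := B z w x y; have := B w x y z.
have := s34 y z w x; have := s34 z w y x; have := s34 x z w y; have := t12 x z y w.
have := s34 w x z y; have := s34 x y w z; have := t12 y w x z; have := s34 w y x z.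
lra.
Qed.

Lemma horizontal_FF x : horizontal x -> x *m F *m F = - x.
Proof.
move=> h; rewrite (f_phi2 hf) big1 ?addr0 // => a _.
by rewrite h mulr0 scale0r.
Qed.

Lemma horizontal_xb x : horizontal x -> g x (xibar xi) = 0.
Proof. by move=> h; rewrite /xibar ip_sumr big1. Qed.

Lemma horizontalF x : horizontal (x *m F).
Proof. by move=> a; exact: (Fxi hf). Qed.

Lemma horizontal_curv x y z : horizontal x -> horizontal y -> horizontal z ->
  horizontal (K x y z).
Proof.
move=> hx hy hz a; have := c_metric hK x y z (xi a).
rewrite (c_xi hK) !horizontal_xb // !scale0r subr0 scaler0 ip0r addr0.
by [].
Qed.

Section Slice.
Context (E : 'M[R]_(n, N)) (EE : E *m G *m E^T = 1%:M) (EF : (E :=: F)%MS).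

Lemma ipE_dot (y z : 'rV[R]_n) : g (y *m E) (z *m E) = dot y z.
Proof. by rewrite /ip trmx_mul mulmxA -(mulmxA y) -(mulmxA y) EE mulmx1. Qed.

Lemma E_horizontal (y : 'rV[R]_n) : horizontal (y *m E).
Proof.
have /submxP[D ->] : (y *m E <= F)%MS by rewrite -EF submxMl.
exact: horizontalF.
Qed.

Lemma horizontal_E x : horizontal x -> exists y : 'rV_n, x = y *m E.
Proof.
move=> /horizontal_FF h; have : (x <= E)%MS.
  by rewrite EF -[x]opprK -h -mulNmx submxMl.
by move=> /submxP[y ->]; exists y.
Qed.

Lemma horizontal_ext x y : horizontal x -> horizontal y ->
  (forall z : 'rV_n, g x (z *m E) = g y (z *m E)) -> x = y.
Proof.
move=> /horizontal_E[x' ->] /horizontal_E[y' ->] h; congr (_ *m E).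
by apply: dot_ext => z; have := h z; rewrite !ipE_dot.
Qed.

(** The matrix of [phi] on its image in the orthonormal basis [E]; multiplying by [G *m E^T] reads
    off coordinates. *)
Definition cstr : 'M[R]_n := E *m F *m G *m E^T.

Lemma cstrE (y : 'rV[R]_n) : y *m cstr *m E = y *m E *m F.
Proof.
rewrite -!mulmxA; congr (y *m _); have /submxP[D EFD] : (E *m F <= E)%MS.
  by rewrite EF submxMl.
by rewrite /cstr !mulmxA EFD -(mulmxA D) -(mulmxA D) EE mulmx1.
Qed.

Let E_inj (y z : 'rV[R]_n) : y *m E = z *m E -> y = z.
Proof. by move=> h; apply: dot_ext => w; rewrite -!ipE_dot h. Qed.

Lemma cstr2 : cstr *m cstr = - 1%:M.
Proof.
apply: rowmul_inj => v; apply: E_inj.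
rewrite mulmxA !cstrE horizontal_FF; last exact: E_horizontal.
by rewrite mulmxN mulmx1 mulNmx.
Qed.

Lemma dot_cstr (y z : 'rV[R]_n) : dot (y *m cstr) z = - dot y (z *m cstr).
Proof. by rewrite -!ipE_dot !cstrE (f_skew hf). Qed.

Lemma cstrT : cstr *m cstr^T = 1%:M.
Proof.
apply: rowmul_inj => v; apply: dot_ext => w; rewrite -dot_mul2 dot_cstr.
by rewrite -mulmxA cstr2 mulmxN dotNr opprK !mulmx1.
Qed.

Definition kslice (x y z w : 'rV[R]_n) : R :=
  g (K (x *m E) (y *m E) (z *m E)) (w *m E)
  - sigma * (dot y z * dot x w - dot x z * dot y w).

Lemma kslice_pair (x y z w : 'rV[R]_n) : kslice x y z w = kslice z w x y.
Proof. by rewrite /kslice c_pair (dotC w x) (dotC z y) (dotC z x) (dotC w y); ring. Qed.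

(** The right-hand side of [c_phi] is exactly what [sigma R0] contributes to the commutator with
    [phi], so it cancels in the difference. *)
Lemma kslice_J34 (x y z w : 'rV[R]_n) :
  kslice x y (z *m cstr) w = - kslice x y z (w *m cstr).
Proof.
rewrite /kslice !cstrE.
have := c_phi hK (E_horizontal x) (E_horizontal y) (E_horizontal z) (E_horizontal w).
rewrite -!cstrE !ipE_dot (dot_cstr y w) (dot_cstr x w).
rewrite (dotC z (x *m cstr)) (dotC z (y *m cstr)) (dot_cstr x z) (dot_cstr y z).
lra.
Qed.

Lemma kslice_kaehler : kaehler cstr kslice.
Proof.
split.
- move=> a x x' y z w; rewrite /kslice mulmxDl -scalemxAl (c_lin1 hK) !dotE_lin !ipE.
  by ring.
- by move=> x y z w; rewrite /kslice (c_skew hK) ipNl; ring.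
- exact: kslice_pair.
- move=> x y z w; rewrite /kslice.
  have := congr1 (fun A => g A (w *m E)) (c_bianchi hK (x *m E) (y *m E) (z *m E)).
  by rewrite !ipE ip0l (dotC z y) (dotC x z) (dotC y x); lra.
- move=> x y z w; rewrite kslice_pair kslice_J34 -mulmxA cstr2 mulmxN mulmx1.
  by rewrite (kslice_pair x) /kslice mulNmx !dotE_lin !ipE; lra.
Qed.

End Slice.

End Link.

(** * Jacobi operators of the null vectors [xi_t + x] *)

Section Jacobi.
Context {R : realType} {N n s : nat} (G F : 'M[R]_N).
Context (xi : 'I_s.+1 -> 'rV[R]_N) (e : 'I_s.+1 -> R) (hf : S_frame G F xi e).
Context (K : 'rV[R]_N -> 'rV[R]_N -> 'rV[R]_N -> 'rV[R]_N) (sigma : R).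
Context (hK : S_curv G F xi e K sigma).
Context (E : 'M[R]_(n, N)) (EE : E *m G *m E^T = 1%:M) (EF : (E :=: F)%MS).
Context (t : 'I_s.+1) (eE : forall a, e a = if a == t then -1 else 1).
Context (Nn : N = (n + s.+1)%N) (x0 : 'rV[R]_n) (x01 : dot x0 x0 = 1).
Implicit Types (z w v : 'rV[R]_N) (y : 'rV[R]_n) (a b : 'I_s.+1).

Local Notation g := (ip G).
Local Notation xb := (xibar xi).
Local Notation k := (kslice G K sigma E).
Local Notation horiz := (horizontal G xi).

Let x := x0 *m E.
Let u : 'rV[R]_N := xi t + x.

Let gC := f_sym hf.

Let hx : horiz x. Proof. exact: (E_horizontal hf EF). Qed.

Let hE y : horiz (y *m E). Proof. exact: (E_horizontal hf EF). Qed.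

Let xx : g x x = 1. Proof. by rewrite (ipE_dot EE). Qed.

Let et : e t = -1. Proof. by rewrite eE eqxx. Qed.

Lemma ip_xibar a : g (xi a) xb = e a.
Proof.
rewrite /xibar ip_sumr (bigD1 a) //= (f_xi hf) eqxx mulr1 big1 ?addr0 // => b ba.
by rewrite (f_xi hf) eq_sym (negbTE ba) mulr0.
Qed.

Definition jac : 'M[R]_N := lin1_mx (fun v => K v u u).

Lemma jacE v : v *m jac = K v u u.
Proof. by apply: lin1_mxE => a z w; exact: (c_lin1 hK). Qed.

Lemma jac_expand v : v *m jac = K v (xi t) (xi t) + K v x (xi t) + K v (xi t) x + K v x x.
Proof. by rewrite jacE /u !(c_linD3 hK) !(c_linD2 hK) addrA. Qed.

Lemma curv_horizontal_xi v a : K v x (xi a) = (- e a * g v xb) *: x.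
Proof.
rewrite (c_xi hK) (horizontal_xb hx) scale0r sub0r (horizontal_FF hf hx).
by rewrite (scalerN (g v xb)) opprK scalerA.
Qed.

Lemma curv_xi_horizontal v a : K v (xi a) x = (- (e a * g v x)) *: xb.
Proof.
apply: (ip_ext hf) => w; rewrite (c_pair hf hK).
have := c_metric hK x w v (xi a).
rewrite (c_skew hK x w (xi a)) curv_horizontal_xi !ipE (gC xb w); lra.
Qed.

Lemma jac_u : u *m jac = 0.
Proof. by rewrite jacE (c_xx hK). Qed.

(** The term [y E] is the contribution of [xi t] alone; both mixed terms vanish since [y] is
    horizontal and orthogonal to [x0]. *)
Lemma jac_V y : dot y x0 = 0 -> y *m E *m jac = y *m E + K (y *m E) x x.
Proof.
move=> y0; rewrite jac_expand curv_horizontal_xi curv_xi_horizontal.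
rewrite (horizontal_xb (hE y)) (ipE_dot EE) y0 !mulr0 oppr0 !scale0r !addr0.
congr (_ + _); rewrite (c_xi hK) ip_xibar (horizontal_xb (hE y)) scale0r subr0.
by rewrite et (horizontal_FF hf (hE y)) scalerA opprK mul1r scaleN1r opprK.
Qed.

Let hk := kslice_kaehler hf hK EE EF.

Lemma curv_Kmx y : dot y x0 = 0 -> K (y *m E) x x = (y *m Kmx k x0 + sigma *: y) *m E.
Proof.
move=> y0; apply: (horizontal_ext hf EE EF).
- exact: (horizontal_curv hK).
- exact: hE.
- move=> z; rewrite (ipE_dot EE) dotDl dotZl (KmxE hk) /kap /kslice x01 y0 -/x.
  by ring.
Qed.

Lemma jac_xi a : a != t -> xi a *m jac = u + (xb - xi t).
Proof.
move=> at'; rewrite jac_expand curv_horizontal_xi curv_xi_horizontal.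
rewrite (gC _ x) hx mulr0 oppr0 scale0r addr0 ip_xibar et opprK mul1r.
rewrite (c_xi hK) !(f_xiF hf) !mul0mx !scaler0 subr0 scaler0 add0r.
rewrite (c_skew hK) curv_xi_horizontal xx mulr1 scaleNr opprK !eE (negbTE at') !scale1r.
by rewrite /u [RHS]addrC addrA subrK addrC.
Qed.

Let X : 'M[R]_(s, N) := \matrix_i xi (lift t i).

Lemma jac_X : X *m jac = const_mx 1 *m X + const_mx 1 *m u.
Proof.
apply/row_matrixP => i; rewrite linearD /= !row_mul rowK jac_xi; last first.
  by rewrite eq_sym neq_lift.
rewrite addrC !row_const; congr (_ + _).
  rewrite /xibar (@bigD1_ord _ _ _ _ t) //= addrAC subrr add0r mulmx_sum_row.
  by apply: eq_bigr => j _; rewrite mxE scale1r rowK.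
by rewrite [const_mx 1]mx11_scalar mxE mul1mx.
Qed.

Lemma slice_basis : exists (r : nat) (P : 'M[R]_(r, n)),
  [/\ r.+1 = n, P *m P^T = 1%:M & (P :=: kermx x0^T)%MS].
Proof.
have [P [PP PK]] := onb (kermx x0^T); exists (\rank (kermx x0^T)), P; split=> //.
rewrite mxrank_ker mxrank_tr.
have -> : \rank x0 = 1%N.
  rewrite rank_rV; have -> // : x0 != 0.
  by apply: contra_eq_neq x01 => ->; rewrite dot0l eq_sym oner_eq0.
case: n x0 x01 => [|m'] y; last by rewrite subn1.
by rewrite [y]thinmx0 dot0l => /eqP; rewrite eq_sym oner_eq0.
Qed.

Section Basis.
Context (r : nat) (P : 'M[R]_(r, n)) (rn : r.+1 = n) (PP : P *m P^T = 1%:M).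
Context (PK : (P :=: kermx x0^T)%MS).

Let Px0 : P *m x0^T = 0. Proof. by apply/sub_kermxP; rewrite PK. Qed.

Let Prow i : dot (row i P) x0 = 0.
Proof. by rewrite /dot -row_mul Px0 !mxE. Qed.

Definition Kperp : 'M[R]_r := P *m Kmx k x0 *m P^T.

Lemma P_Kmx : P *m Kmx k x0 = Kperp *m P.
Proof.
have /submxP[D PD] : (P *m Kmx k x0 <= P)%MS.
  rewrite PK; apply/sub_kermxP; rewrite -mulmxA -(Kmx_sym hk) -trmx_mul (Kmx_x0 hk).
  by rewrite trmx0 mulmx0.
by rewrite /Kperp PD -(mulmxA D) PP mulmx1.
Qed.

Lemma rank_Kmx (a : R) : \rank (eigenspace (Kmx k x0) a) =
  ((a == 0%R) + \rank (eigenspace Kperp a))%N.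
Proof.
pose Q := col_mx x0 P.
have QQ : Q *m Q^T = 1%:M.
  have h : x0 *m P^T = 0 by rewrite -[LHS]trmxK trmx_mul trmxK Px0 trmx0.
  have h1 : x0 *m x0^T = 1%:M by rewrite [LHS]mx11_scalar -/(dot x0 x0) x01.
  by rewrite /Q tr_col_mx mul_col_row h1 h Px0 PP -scalar_mx_block.
have QK : Q *m Kmx k x0 = block_mx (0%:M : 'M[R]_1) 0 0 Kperp *m Q.
  by apply: col_mx_intertwine; [rewrite (Kmx_x0 hk) mul_scalar_mx scale0r | exact: P_Kmx].
have Qf := row_free_orth QQ.
have full : (1%:M <= Q)%MS.
  by rewrite sub1mx /row_full; move: Qf; rewrite /row_free => /eqP ->; rewrite add1n rn.
have := eig_transfer a Qf QK; rewrite rank_eigenspace_block rank_eigenspace_scalar.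
have -> : \rank (Q :&: eigenspace (Kmx k x0) a)%MS = \rank (eigenspace (Kmx k x0) a).
  apply/eqmx_rank/andP; rewrite capmxSr sub_capmx submx_refl andbT; split=> //.
  exact: submx_trans (submx1 _) full.
by move=> <-; case: (a == 0).
Qed.

Let B := P *m E.
Let C := Kperp + (sigma + 1)%:M.

Lemma jac_B : B *m jac = C *m B.
Proof.
rewrite /B /C mulmxDl mulmxA -P_Kmx mul_scalar_mx.
apply/row_matrixP => i; rewrite linearD linearZ /= !row_mul.
rewrite (jac_V (Prow i)) (curv_Kmx (Prow i)) mulmxDl scalerDl scale1r -scalemxAl.
by rewrite addrC -addrA.
Qed.

Let BX := col_mx B X.
(** [D] and [- z0] are dual to [BX] and [u]: they witness the independence of these rows and
    separate [u] from the rest. *)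
Let D : 'M[R]_(N, r + s) := G *m BX^T.
Let z0 : 'cV[R]_N := G *m (xi t)^T.
Let q := qproj u.

Let mulG p p' (A : 'M[R]_(p, N)) (A' : 'M[R]_(p', N)) i j :
  (A *m (G *m A'^T)) i j = g (row i A) (row j A').
Proof.
rewrite /ip mulmxA -row_mul !mxE; apply: eq_bigr => l _.
by rewrite !mxE.
Qed.

Let rB i : row i B = row i P *m E. Proof. exact: row_mul. Qed.

Let rX i : row i X = xi (lift t i). Proof. exact: rowK. Qed.

Let row0 (w : 'rV[R]_N) i : row i w = w. Proof. by rewrite row_id. Qed.

Let g_xt i : g (xi t) (xi (lift t i)) = 0.
Proof. by rewrite (f_xi hf) (negbTE (neq_lift _ _)) mulr0. Qed.

Let uu : g u u = 0.
Proof. by rewrite /u !ipE (gC _ x) hx xx (f_xi hf) eqxx mulr1 et; ring. Qed.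

Let uxt : g u (xi t) = -1.
Proof. by rewrite /u !ipE hx (f_xi hf) eqxx mulr1 et; ring. Qed.

Let uz0 : u *m z0 = (-1)%:M.
Proof. by rewrite [LHS]mx11_scalar mulG !row0 uxt. Qed.

Let BXe i : (exists i', row i BX = row i' P *m E) \/ (exists i', row i BX = xi (lift t i')).
Proof.
rewrite -[i]splitK; case: (fintype.split i) => j; [left|right]; exists j.
  by rewrite /= rowKu.
by rewrite /= rowKd.
Qed.

Let Bu i : g (row i P *m E) u = 0.
Proof. by rewrite /u ipDr hE (ipE_dot EE) Prow addr0. Qed.

Let Xu i : g (xi (lift t i)) u = 0.
Proof. by rewrite /u ipDr (gC _ x) hx gC g_xt addr0. Qed.

Let BXu : BX *m (G *m u^T) = 0.
Proof.
apply/matrixP => i j; rewrite mulG row0 mxE.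
by case: (BXe i) => [[i' ->]|[i' ->]].
Qed.

Let uD : u *m D = 0.
Proof.
apply/matrixP => j i; rewrite mulG row0 mxE gC.
by case: (BXe i) => [[i' ->]|[i' ->]].
Qed.

Let BXz0 : BX *m z0 = 0.
Proof.
apply/matrixP => i j; rewrite mulG row0 mxE.
by case: (BXe i) => [[i' ->]|[i' ->]]; [exact: hE | rewrite gC].
Qed.

Let BB : B *m (G *m B^T) = 1%:M.
Proof. by rewrite /B trmx_mul !mulmxA -(mulmxA P) -(mulmxA P) EE mulmx1. Qed.

Let BXD : BX *m D = 1%:M.
Proof.
rewrite /D tr_col_mx mul_mx_row mul_col_row BB (scalar_mx_block r s 1); congr block_mx.
- by apply/matrixP => i j; rewrite mulG rB rX mxE; exact: hE.
- by apply/matrixP => i j; rewrite mulG rB rX gC mxE; exact: hE.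
- apply/matrixP => i j; rewrite mulG !rX (f_xi hf) eE eq_sym (negbTE (neq_lift _ _)) mul1r mxE.
  by rewrite (inj_eq (@lift_inj _ t)).
Qed.

Let orth_u : (col_mx u BX :=: kermx (G *m u^T))%MS.
Proof.
have sub : (col_mx u BX <= kermx (G *m u^T))%MS.
  apply/sub_kermxP; rewrite mul_col_mx BXu.
  have -> : u *m (G *m u^T) = 0; last exact: col_mx0.
  by rewrite [LHS]mx11_scalar mulG !row0 uu raddf0.
apply/eqmxP; rewrite -(geq_leqif (mxrank_leqif_eq sub)).
have free : row_free (col_mx u BX).
  apply/row_freeP; exists (row_mx (- z0) D); rewrite mul_col_row !mulmxN uz0 uD BXz0 BXD.
  by rewrite oppr0 -raddfN opprK -scalar_mx_block.
move: free; rewrite /row_free => /eqP ->; rewrite mxrank_ker.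
have nz : G *m u^T != 0.
  apply/eqP => h; have := mulG (xi t) u 0 0.
  rewrite h mulmx0 mxE !row0 gC uxt => /eqP.
  by rewrite eq_sym oppr_eq0 oner_eq0.
rewrite -(mxrank_tr (G *m u^T)) rank_rV -trmx_eq0 trmxK nz /= {1}Nn -rn.
by clear; lia.
Qed.

Lemma Vspace_slice : (B :=: kermx (G *m (u - xi t)^T) :&: F)%MS.
Proof.
have -> : u - xi t = x by rewrite /u addrC addKr.
apply/eqmxP/andP; split.
  rewrite sub_capmx -EF submxMl andbT; apply/sub_kermxP/matrixP => i j.
  by rewrite mulG row0 rB (ipE_dot EE) Prow mxE.
apply/rV_subP => v; rewrite sub_capmx -EF => /andP[/sub_kermxP vx /submxP[y vE]].
have y0 : dot y x0 = 0.
  by rewrite -(ipE_dot EE) -vE -[v](row0 _ 0) -[x0 *m E](row0 _ 0) -mulG vx mxE.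
rewrite vE submxMr // PK; apply/sub_kermxP.
by rewrite [LHS]mx11_scalar -/(dot y x0) y0 raddf0.
Qed.

Let W := (kermx (G *m (u - xi t)^T) :&: F + \sum_(a < s.+1 | a != t) <<xi a>>)%MS.

(** The product with [xi t] vanishes on [W] and is [-1] on [u]. *)
Let Wu : (W :&: <<u>> = 0)%MS.
Proof.
have Wz : (W <= kermx z0)%MS.
  rewrite addsmx_sub -Vspace_slice; apply/andP; split.
    apply/sub_kermxP/matrixP => i j; rewrite mulG row0 rB mxE; exact: hE.
  apply/sumsmx_subP => a at'; rewrite genmxE; apply/sub_kermxP/matrixP => i j.
  by rewrite mulG !row0 (f_xi hf) (negbTE at') mulr0 mxE.
apply/eqP; rewrite -submx0; apply/rV_subP => v; rewrite sub_capmx genmxE.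
case/andP => /submx_trans/(_ Wz)/sub_kermxP vz /sub_rVP[d vE].
move: vz; rewrite vE -scalemxAl uz0 scale_scalar_mx => /matrixP/(_ 0 0).
rewrite !mxE eqxx mulr1n mulrN1 => /eqP; rewrite oppr_eq0 => /eqP ->.
by rewrite scale0r sub0mx.
Qed.

Lemma jacobi_phi_rank (a : R) :
  \rank (eigenspace (restrictmx (kermx (G *m (u - xi t)^T) :&: F)%MS
    (jac *m proj_mx W <<u>>%MS)) a) = \rank (eigenspace Kperp (a - (sigma + 1))).
Proof.
rewrite -eigenspace_shift -/C; apply: restrict_eig Vspace_slice _.
  by apply/row_freeP; exists (G *m B^T); exact: BB.
rewrite mulmxA jac_B -mulmxA (proj_mx_id Wu) //.
by rewrite Vspace_slice addsmxSl.
Qed.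

Let q0 (A : 'rV[R]_N) : A *m q = 0 -> (A <= u)%MS.
Proof.
move=> Aq; rewrite submxE -(mulmx_base (cokermx u)) mulmxA.
by rewrite -/(qproj u) -/q Aq mul0mx.
Qed.

Let uq : u *m q = 0.
Proof.
have : u *m cokermx u = 0 by exact: mulmx_coker.
by rewrite -{1}(mulmx_base (cokermx u)) mulmxA => /eqP; rewrite mulmx_free_eq0 ?row_base_free // => /eqP.
Qed.

(** In the basis [BX] of the quotient the operator is block diagonal, with an all-ones block on the
    remaining [xi]. That block does not depend on [x0], so the Osserman condition bears on the other
    one. *)
Lemma jacobi_bar_rank (a : R) :
  \rank (eigenspace (restrictmx (kermx (G *m u^T) *m q) (pinvmx q *m jac *m q)) a) =
  (\rank (eigenspace Kperp (a - (sigma + 1))%R) +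
   \rank (eigenspace (const_mx 1%R : 'M[R]_s) a))%N.
Proof.
rewrite -eigenspace_shift -/C -rank_eigenspace_block.
have BXf : row_free (BX *m q).
  rewrite -kermx_eq0; apply/rowV0P => v /sub_kermxP; rewrite mulmxA => /q0/sub_rVP[d h].
  by rewrite -[v]mulmx1 -BXD mulmxA h -scalemxAl uD scaler0.
apply: restrict_eig BXf _ _.
  apply: eqmx_trans (eqmxMr q orth_u); rewrite (mul_col_mx u BX q).
  have -> : u *m q = 0 := uq.
  by apply: eqmx_trans (addsmxE _ _); apply: eqmx_sym; exact: adds0mx.
(* [pinvmx q] lifts a class only up to a multiple of [u], which the Jacobi operator kills. *)
have h : BX *m q *m pinvmx q *m jac = BX *m jac.
  apply/eqP; rewrite -subr_eq0 -mulmxBl; apply/eqP/row_matrixP => i.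
  rewrite row_mul [RHS]linear0.
  have /sub_rVP[d ->] : (row i (BX *m q *m pinvmx q - BX) <= u)%MS.
    by apply: q0; rewrite -row_mul mulmxBl mulmxKpV ?submxMl // subrr linear0.
  by rewrite -scalemxAl jac_u scaler0.
transitivity (BX *m jac *m q); first by rewrite -h !mulmxA.
have -> : BX *m jac = block_mx C 0 0 (const_mx 1) *m BX + col_mx 0 (const_mx 1) *m u.
  rewrite mul_col_mx jac_B jac_X mul_block_col !mul0mx addr0 add0r.
  by rewrite (mul_col_mx 0 (const_mx 1) u) mul0mx add_col_mx addr0.
by rewrite mulmxDl -(mulmxA _ u) uq mulmx0 addr0 mulmxA.
Qed.

End Basis.

End Jacobi.

Local Open Scope classical_set_scope.
Local Open Scope ring_scope.

(** * Calculus in charts *)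

Section Calculus.
Context {R : realType} {N : nat}.
Implicit Types (f g : 'rV[R]_N -> R) (x v w : 'rV[R]_N) (O : set 'rV[R]_N).

Lemma is_derive_line f x v (t : R) : derivable f (x + t *: v) v ->
  is_derive t (1 : R) (fun s : R => f (x + s *: v)) ('D_v f (x + t *: v)).
Proof.
move=> df.
have e : (fun h : R => h^-1 *: (((fun s : R => f (x + s *: v)) \o shift t) (h *: 1)
    - f (x + t *: v))) =
  (fun h : R => h^-1 *: ((f \o shift (x + t *: v)) (h *: v) - f (x + t *: v))).
  apply/funext => h /=; congr (_ *: (f _ - _)).
  by rewrite [h%:A]mulr1 scalerDl addrCA.
by split; rewrite /derivable /derive e.
Qed.

Lemma mvt_line f x v (h : R) :
  (forall t, `|t| <= `|h| -> derivable f (x + t *: v) v) ->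
  exists2 t, `|t| <= `|h| & f (x + h *: v) - f x = h * 'D_v f (x + t *: v).
Proof.
move=> df; pose F (s : R) := f (x + s *: v).
have dF s : `|s| <= `|h| -> is_derive s (1 : R) F ('D_v f (x + s *: v)).
  by move=> sh; apply: is_derive_line; exact: df.
have cF a b : (forall s, s \in `[a, b]%R -> `|s| <= `|h|) ->
    {within `[a, b], continuous F}.
  move=> sab; apply: derivable_within_continuous => s /sab/dF hs; exact: (@ex_derive _ _ _ _ _ _ _ hs).
have F0 : F 0 = f x by rewrite /F scale0r addr0.
have [h0|h0] := lerP 0 h.
  have b s : s \in `[0, h]%R -> `|s| <= `|h|.
    by rewrite in_itv /= => /andP[s0 sh]; rewrite !ger0_norm.
  have [|c ch e] := @MVT_segment R F (fun s => 'D_v f (x + s *: v)) _ _ h0 _ (cF _ _ b).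
    by move=> s sh; apply: dF; apply: b; exact: subset_itv_oo_cc.
  by exists c; [exact: b | rewrite -F0 -/(F h) e subr0 mulrC].
have b s : s \in `[h, 0]%R -> `|s| <= `|h|.
  by rewrite in_itv /= => /andP[s0 sh]; rewrite !ler0_norm ?lerN2 // ltW.
have [|c ch e] := @MVT_segment R F (fun s => 'D_v f (x + s *: v)) _ _ (ltW h0) _ (cF _ _ b).
  by move=> s sh; apply: dF; apply: b; exact: subset_itv_oo_cc.
exists c; first exact: b.
by rewrite -F0 -/(F h) -opprB e sub0r mulrN opprK mulrC.
Qed.

Let E (i : 'I_N) : 'rV[R]_N := delta_mx 0 i.

Definition grad f x : 'cV[R]_N := \col_i 'D_(E i) f x.

Lemma norm_coord x i : `|x 0 i| <= `|x|.
Proof.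
rewrite [leRHS]/Num.Def.normr/= mx_normrE.
exact: (le_bigmax _ (fun ij => `|x ij.1 ij.2|) (0, i)).
Qed.

Lemma norm_le x (e : R) : 0 <= e -> (forall i, `|x 0 i| <= e) -> `|x| <= e.
Proof.
move=> e0 h; rewrite [leLHS]/Num.Def.normr/= mx_normrE.
by apply: bigmax_le => // -[i j] _ /=; rewrite ord1.
Qed.

(** The increment telescopes along the points [p k], which keep the first [k] coordinates of [h];
    the mean value theorem applies to each step. *)
Lemma C1_estimate f x (d : R) (e : R) h :
  (forall y, `|y - x| < d -> forall i, derivable f y (E i) /\
     `|'D_(E i) f y - 'D_(E i) f x| <= e) ->
  `|h| < d -> `|f (x + h) - f x - (h *m grad f x) 0 0| <= N%:R * e * `|h|.
Proof.
move=> H hd.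
pose p (k : nat) : 'rV[R]_N := \row_i (if (i < k)%N then h 0 i else 0).
have p0 : p 0%N = 0 by apply/rowP => i; rewrite !mxE.
have pN : p N = h by apply/rowP => i; rewrite !mxE ltn_ord.
have pS (i : 'I_N) : p i.+1 = p i + h 0 i *: E i.
  apply/rowP => j; rewrite !mxE ltnS leq_eqVlt.
  have [->|ij] := eqVneq j i; first by rewrite !eqxx ltnn add0r mulr1.
  have -> : (j == i :> nat) = false by exact: negbTE.
  by rewrite andbF mulr0 addr0.
have tele : f (x + h) - f x = \sum_(i < N) (f (x + p i.+1) - f (x + p i)).
  by rewrite -(big_mkord xpredT (fun i => f (x + p i.+1) - f (x + p i)))
    telescope_sumr // p0 pN addr0.
have -> : (h *m grad f x) 0 0 = \sum_i h 0 i * 'D_(E i) f x.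
  by rewrite mxE; apply: eq_bigr => i _; rewrite !mxE.
rewrite tele -sumrB; apply: le_trans (ler_norm_sum _ _ _) _.
have -> : N%:R * e * `|h| = \sum_(i < N) e * `|h|.
  by rewrite sumr_const card_ord -mulrA mulr_natl.
apply: ler_sum => i _.
have near t : `|t| <= `|h 0 i| -> `|x + p i + t *: E i - x| < d.
  move=> th; apply: le_lt_trans hd; rewrite addrC -!addrA addKr.
  apply: norm_le => // j; rewrite !mxE.
  have [->|ji] := eqVneq j i.
    by rewrite ltnn !eqxx mulr1 add0r (le_trans th) ?norm_coord.
  by rewrite eqxx /= mulr0 addr0; case: ifP => _; rewrite ?normr0 ?norm_coord.
have [t th eq] : exists2 t, `|t| <= `|h 0 i| & f (x + p i + h 0 i *: E i) - f (x + p i) =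
    h 0 i * 'D_(E i) f (x + p i + t *: E i).
  by apply: mvt_line => t /near/H /(_ i) [].
rewrite pS addrA eq -mulrBr normrM mulrC.
apply: ler_pM => //; last exact: norm_coord.
by have [_ ->] := H _ (near _ th) i.
Qed.

(** [smooth_on] speaks of partial derivatives only; the total differential obtained here is what the
    chain rule requires. *)
Lemma C1_differentiable f x :
  (forall i, {for x, continuous ('D_(E i) f)}) ->
  (\forall y \near x, forall i, derivable f y (E i)) ->
  differentiable f x /\ forall v, 'D_v f x = (v *m grad f x) 0 0.
Proof.
move=> cd dn.
have lin : linear (fun v : 'rV[R]_N => (v *m grad f x) 0 0).
  by move=> a u v; rewrite mulmxDl -scalemxAl !mxE.
pose gM := GRing.isLinear.Build _ _ _ _ _ lin.
pose L : {linear 'rV[R]_N -> R} := HB.pack (fun v : 'rV[R]_N => (v *m grad f x) 0 0) gM.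
have Lc : continuous L.
  have -> : (L : _ -> _) = fun v => \sum_i v 0 i * grad f x i 0.
    by apply/funext => v; rewrite /= mxE.
  apply: cont_sum => i; apply: cont_mul; first exact: cont_coord.
  by move=> ?; exact: cst_continuous.
have key := @diff_unique _ _ _ f L x Lc.
have est : ltac:(match type of key with ?P -> _ => exact P end).
  apply/eqaddoP => e e0.
  pose e' := e / (N%:R + 1).
  have Np : 0 < N%:R + 1 :> R by have := ler0n R N; lra.
  have e'0 : 0 < e' by rewrite divr_gt0.
  have [d d0 H] : exists2 d, 0 < d & forall y, `|y - x| < d -> forall i,
      derivable f y (E i) /\ `|'D_(E i) f y - 'D_(E i) f x| <= e'.
    have : \forall y \near x, forall i,
        derivable f y (E i) /\ `|'D_(E i) f y - 'D_(E i) f x| <= e'.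
      near=> y => i; split; first by move: i; near: y.
      move: i; near: y; apply: filter_forall => i.
      have := cd i; move/cvgrPdist_le => /(_ _ e'0); apply: filterS => y.
      by rewrite distrC.
    move=> /nbhs_normP[d /= d0 hd]; exists d => // y yx; apply: hd => /=.
    by rewrite distrC.
  suff : \forall h \near (0 : 'rV[R]_N), `|f (h + x) - (f x + L h)| <= e * `|h| by [].
  apply/nbhs_normP; exists d => //= h /=; rewrite sub0r normrN => hd.
  have := C1_estimate H hd; rewrite [X in f X](addrC x) opprD addrA => /le_trans -> //.
  rewrite ler_wpM2r // /e' mulrA ler_pdivrMr // mulrC ler_pM2l //.
  by lra.
have dE : 'd f x = L :> (_ -> _) by exact: key.
have df : differentiable f x by apply/diff_locallyP; rewrite dE.
by split=> // v; rewrite deriveE // dE.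
Unshelve. all: by end_near. Qed.

(** Two mean value theorems, in either order, express the same second difference as [h^2] times
    either mixed derivative at some point near [x]. *)
Lemma schwarz f x u v :
  (\forall y \near x, [/\ derivable f y u, derivable f y v,
     derivable ('D_u f) y v & derivable ('D_v f) y u]) ->
  {for x, continuous ('D_v ('D_u f))} -> {for x, continuous ('D_u ('D_v f))} ->
  'D_v ('D_u f) x = 'D_u ('D_v f) x.
Proof.
move=> hn c1 c2; apply/eqP; rewrite -subr_eq0 -normr_le0.
apply/ler_addgt0Pr => e e0; rewrite add0r.
have e2 : 0 < e / 2 by rewrite divr_gt0.
have h1 : \forall y \near x, `|'D_v ('D_u f) x - 'D_v ('D_u f) y| <= e / 2.
  by move/cvgrPdist_le : c1 => /(_ _ e2).
have h2 : \forall y \near x, `|'D_u ('D_v f) x - 'D_u ('D_v f) y| <= e / 2.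
  by move/cvgrPdist_le : c2 => /(_ _ e2).
have : \forall y \near x, [/\ derivable f y u, derivable f y v,
     derivable ('D_u f) y v & derivable ('D_v f) y u] /\
   (`|'D_v ('D_u f) x - 'D_v ('D_u f) y| <= e / 2 /\
    `|'D_u ('D_v f) x - 'D_u ('D_v f) y| <= e / 2).
  by apply: filterS3 hn h1 h2 => y a b c; exact: (conj a (conj b c)).
move=> /nbhs_normP[d /= d0 hd].
have {}hd y : `|y - x| < d -> _ := fun h => hd y (eq_rect _ (fun z => z < d) h _ (distrC _ _)).
pose h := d / (2 * (`|u| + `|v| + 1)).
have D0 : 0 < `|u| + `|v| + 1 by have := normr_ge0 u; have := normr_ge0 v; lra.
have h0 : 0 < h by rewrite divr_gt0 // mulr_gt0.
have hD : h * (`|u| + `|v|) < d.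
  have : h * (2 * (`|u| + `|v| + 1)) = d by rewrite divfK // gt_eqF // mulr_gt0.
  have := mulr_ge0 (ltW h0) (normr_ge0 u); have := mulr_ge0 (ltW h0) (normr_ge0 v).
  by rewrite !mulrDr; lra.
have near s t : `|s| <= `|h| -> `|t| <= `|h| -> `|x + s *: u + t *: v - x| < d.
  rewrite [`|h|]gtr0_norm // => sh th; apply: le_lt_trans hD.
  rewrite addrC -!addrA addKr; apply: le_trans (ler_normD _ _) _.
  by rewrite !normrZ mulrDr lerD // ler_wpM2r.
have n0 : `|0 : R| <= `|h| by rewrite normr0.
have nh : `|h| <= `|h| by [].
have key (a b : 'rV[R]_N) :
    (forall s t, `|s| <= `|h| -> `|t| <= `|h| -> `|x + s *: a + t *: b - x| < d) ->
    (forall y, `|y - x| < d -> derivable f y a /\ derivable ('D_a f) y b) ->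
    exists s t, [/\ `|s| <= `|h|, `|t| <= `|h| &
      f (x + h *: a + h *: b) - f (x + h *: a) - f (x + h *: b) + f x =
      h * (h * 'D_b ('D_a f) (x + s *: a + t *: b))].
  move=> nab dab.
  pose g y := f (y + h *: b) - f y.
  have dsh y : derivable f (y + h *: b) a ->
      is_derive y a (fun z => f (z + h *: b)) ('D_a f (y + h *: b)).
    move=> dy.
    have e' : (fun t : R => t^-1 *: (((fun z => f (z + h *: b)) \o shift y) (t *: a) -
        f (y + h *: b))) = (fun t : R => t^-1 *: ((f \o shift (y + h *: b)) (t *: a) -
        f (y + h *: b))).
      by apply/funext => t /=; rewrite addrA.
    by split; rewrite /derivable /derive e'.
  have dg s : `|s| <= `|h| -> is_derive (x + s *: a) a g
      ('D_a f (x + s *: a + h *: b) - 'D_a f (x + s *: a)).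
    move=> sh; have [d1 _] := dab _ (nab _ _ sh nh).
    have n2 := nab _ _ sh n0; rewrite scale0r addr0 in n2.
    have [d2 _] := dab _ n2.
    have b1 := dsh _ d1; have b2 := derivableP d2.
    exact: (@is_deriveB _ _ _ _ _ _ _ _ _ b1 b2).
  have [s sh e1] : exists2 s, `|s| <= `|h| & g (x + h *: a) - g x =
      h * 'D_a g (x + s *: a).
    by apply: mvt_line => s sh; have dh := dg _ sh; exact: (@ex_derive _ _ _ _ _ _ _ dh).
  rewrite (@derive_val _ _ _ _ _ _ _ (dg _ sh)) in e1.
  have [t th e3] : exists2 t, `|t| <= `|h| &
      'D_a f (x + s *: a + h *: b) - 'D_a f (x + s *: a) =
      h * 'D_b ('D_a f) (x + s *: a + t *: b).
    apply: (@mvt_line ('D_a f) (x + s *: a) b h) => t th.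
    by have [_ h3] := dab _ (nab _ _ sh th); exact: h3.
  exists s, t; split=> //; rewrite -e3 -e1 /g; ring.
have [s [t [sh th e1]]] := key u v near (fun y hy => let: conj (And4 a _ b _) _ := hd y hy in conj a b).
have near2 s' t' : `|s'| <= `|h| -> `|t'| <= `|h| -> `|x + s' *: v + t' *: u - x| < d.
  by move=> sh' th'; rewrite [x + s' *: v + _]addrAC; exact: near th' sh'.
have [s' [t' [sh' th' e2']]] := key v u near2
  (fun y hy => let: conj (And4 _ a _ b) _ := hd y hy in conj a b).
have e12 : 'D_v ('D_u f) (x + s *: u + t *: v) = 'D_u ('D_v f) (x + s' *: v + t' *: u).
  have hh : h * h != 0 by rewrite mulf_neq0 // gt_eqF.
  move: e1 e2'; rewrite [x + h *: v + h *: u]addrAC.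
  move: ('D_v _ _) ('D_u _ _) (f _) (f _) (f _) (f _) => A B F1 F2 F3 F4.
  move=> e1 e2'; apply: (mulfI hh).
  rewrite -[LHS]mulrA -[RHS]mulrA -e1 -e2'; congr (_ + _); exact: addrAC.
have [_ [b1 _]] := hd _ (near _ _ sh th).
have [_ [_ b2]] := hd _ (near2 _ _ sh' th').
rewrite -(subrKA ('D_v ('D_u f) (x + s *: u + t *: v))) (splitr e).
apply: le_trans (ler_normD _ _) (lerD b1 _).
by rewrite e12 distrC; exact: b2.
Unshelve. all: by end_near. Qed.

End Calculus.

(** * Closure properties of smooth functions *)

Section SmoothClosure.
Context {R : realType} {N : nat}.
Implicit Types (f g : 'rV[R]_N -> R) (O : set 'rV[R]_N).

Lemma Ck_S k O f : Ck_on k.+1 O f -> Ck_on k O f.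
Proof.
elim: k f => [|k IH] f /= [cf h]; split=> // i.
by have [d1 [c1 d2]] := h i; split=> //; apply: IH.
Qed.

Lemma Ck_sub k (O O' : set 'rV[R]_N) f : O' `<=` O -> Ck_on k O f -> Ck_on k O' f.
Proof.
move=> OO; elim: k f => [|k IH] f /= [cf h]; split=> //; first by move=> x /OO/cf.
  by move=> x /OO/cf.
by move=> i; have [d1 d2] := h i; split=> [x /OO/d1|]//; apply: IH.
Qed.

Lemma near_open O x (P : 'rV[R]_N -> Prop) : open O -> O x ->
  (forall y, O y -> P y) -> \forall y \near x, P y.
Proof. by move=> oO Ox h; apply: filterS h _; exact: open_nbhs_nbhs. Qed.

Lemma near_continuous f g x : (\forall y \near x, f y = g y) ->
  {for x, continuous f} -> {for x, continuous g}.
Proof.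
move=> e cf; rewrite /prop_for /continuous_at -(nbhs_singleton e).
exact: cvg_trans (near_eq_cvg e) cf.
Qed.

Lemma Ck_congr k O f g : open O -> (forall x, O x -> f x = g x) ->
  Ck_on k O f -> Ck_on k O g.
Proof.
move=> oO; elim: k f g => [|k IH] f g fg.
  move=> [cf _]; split=> // x Ox.
  exact: (near_continuous (near_open oO Ox fg) (cf _ Ox)).
have fg' x : O x -> \forall y \near x, f y = g y by move=> Ox; exact: near_open fg.
move=> [cf h]; split=> [x Ox|i].
  exact: (near_continuous (fg' _ Ox) (cf _ Ox)).
have [d1 d2] := h i; split=> [x Ox|].
  by apply: near_eq_derivable (d1 _ Ox); exact: fg'.
by apply: IH d2 => x Ox; apply: near_eq_derive; exact: fg'.
Qed.

Lemma Ck_cst k O (c : R) : open O -> Ck_on k O (fun=> c).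
Proof.
move=> oO; elim: k c => [|k IH] c /=; split=> //; try by move=> x _; exact: cst_continuous.
move=> i; split=> [x _|]; first exact: derivable_cst.
apply: Ck_congr (IH 0) => // x _; exact/esym/derive_cst.
Qed.

Lemma Ck_add k O f g : open O -> Ck_on k O f -> Ck_on k O g ->
  Ck_on k O (fun x => f x + g x).
Proof.
move=> oO; elim: k f g => [|k IH] f g /=.
  move=> [cf _] [cg _]; split=> // x Ox.
  exact: (continuousD (cf _ Ox) (cg _ Ox)).
move=> [cf hf] [cg hg]; split=> [x Ox|i].
  exact: (continuousD (cf _ Ox) (cg _ Ox)).
have [f1 f2] := hf i; have [g1 g2] := hg i; split=> [x Ox|].
  by apply: derivableD; [exact: f1 | exact: g1].
apply: Ck_congr (IH _ _ f2 g2) => // x Ox.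
by rewrite -(deriveD (f1 _ Ox) (g1 _ Ox)).
Qed.

Lemma Ck_mul k O f g : open O -> Ck_on k O f -> Ck_on k O g ->
  Ck_on k O (fun x => f x * g x).
Proof.
move=> oO; elim: k f g => [|k IH] f g.
  move=> /= [cf _] [cg _]; split=> // x Ox.
  exact: (continuousM (cf _ Ox) (cg _ Ox)).
move=> hf hg; have kf := Ck_S hf; have kg := Ck_S hg.
move: hf hg => /= [cf hf] [cg hg]; split=> [x Ox|i].
  exact: (continuousM (cf _ Ox) (cg _ Ox)).
have [f1 f2] := hf i; have [g1 g2] := hg i; split=> [x Ox|].
  by apply: derivableM; [exact: f1 | exact: g1].
apply: Ck_congr (Ck_add oO (IH _ _ kf g2) (IH _ _ kg f2)) => // x Ox.
by rewrite -[RHS]/('D_(delta_mx 0 i) (f * g) x) deriveM //; [exact: f1 | exact: g1].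
Qed.

Lemma smooth_sub (O O' : set 'rV[R]_N) f : O' `<=` O -> smooth_on O f -> smooth_on O' f.
Proof. by move=> h sf k; apply: Ck_sub (sf k). Qed.

Lemma smooth_congr O f g : open O -> (forall x, O x -> f x = g x) ->
  smooth_on O f -> smooth_on O g.
Proof. by move=> oO h sf k; apply: Ck_congr (sf k). Qed.

Lemma smooth_cst O (c : R) : open O -> smooth_on O (fun=> c).
Proof. by move=> oO k; exact: Ck_cst. Qed.

Lemma smooth_add O f g : open O -> smooth_on O f -> smooth_on O g ->
  smooth_on O (fun x => f x + g x).
Proof. by move=> oO sf sg k; apply: Ck_add. Qed.

Lemma smooth_mul O f g : open O -> smooth_on O f -> smooth_on O g ->
  smooth_on O (fun x => f x * g x).
Proof. by move=> oO sf sg k; apply: Ck_mul. Qed.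

Lemma smooth_sum O I (r : seq I) (f : I -> 'rV[R]_N -> R) : open O ->
  (forall i, smooth_on O (f i)) -> smooth_on O (fun x => \sum_(i <- r) f i x).
Proof.
move=> oO h; elim: r => [|i r IH].
  by under eq_fun do rewrite big_nil; exact: smooth_cst.
by under eq_fun do rewrite big_cons; exact: smooth_add.
Qed.

Lemma smooth_D O f i : smooth_on O f -> smooth_on O ('D_(delta_mx 0 i) f).
Proof. by move=> sf k; have [_ /(_ i)[]] := sf k.+1. Qed.

Lemma smooth_cont O f x : smooth_on O f -> O x -> {for x, continuous f}.
Proof. by move=> sf Ox; have [h _] := sf 0%N; exact: h. Qed.

Lemma smooth_C1 O f x : open O -> smooth_on O f -> O x ->
  differentiable f x /\ forall v, 'D_v f x = (v *m grad f x) 0 0.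
Proof.
move=> oO sf Ox; apply: C1_differentiable.
  by move=> i; apply: smooth_cont Ox; exact: smooth_D.
by apply: (near_open oO Ox) => y Oy i; have [_ /(_ i)[h _]] := sf 1%N; exact: h.
Qed.

Lemma smooth_diff O f x : open O -> smooth_on O f -> O x -> differentiable f x.
Proof. by move=> oO sf Ox; have [] := smooth_C1 oO sf Ox. Qed.

Lemma smooth_derivable O f x v : open O -> smooth_on O f -> O x -> derivable f x v.
Proof. by move=> oO sf Ox; apply: diff_derivable; exact: (smooth_diff oO sf Ox). Qed.

Lemma smooth_deriveE O f x v : open O -> smooth_on O f -> O x ->
  'D_v f x = \sum_i v 0 i * 'D_(delta_mx 0 i) f x.
Proof.
move=> oO sf Ox; have [_ ->] := smooth_C1 oO sf Ox.
by rewrite mxE; apply: eq_bigr => i _; rewrite mxE.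
Qed.

Lemma smooth_derive O f v : open O -> smooth_on O f -> smooth_on O ('D_v f).
Proof.
move=> oO sf; apply: (@smooth_congr O (fun x => \sum_i v 0 i * 'D_(delta_mx 0 i) f x)) => //.
  by move=> x Ox; rewrite (smooth_deriveE v oO sf Ox).
apply: smooth_sum => // i; apply: smooth_mul => //; first exact: smooth_cst.
exact: smooth_D.
Qed.

Lemma smooth_schwarz O f x u v : open O -> smooth_on O f -> O x ->
  'D_v ('D_u f) x = 'D_u ('D_v f) x.
Proof.
move=> oO sf Ox; have su := smooth_derive u oO sf; have sv := smooth_derive v oO sf.
apply: schwarz.
- apply: (near_open oO Ox) => y Oy.
  by split; [exact: smooth_derivable sf _ | exact: smooth_derivable sf _ |
    exact: smooth_derivable su _ | exact: smooth_derivable sv _].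
- by apply: (smooth_cont _ Ox); exact: smooth_derive.
- by apply: (smooth_cont _ Ox); exact: smooth_derive.
Qed.

End SmoothClosure.

Section Composition.
Context {R : realType} {M N : nat}.
Implicit Types (T : 'rV[R]_M -> 'rV[R]_N) (O : set 'rV[R]_M).

Definition smooth_map O T := forall i, smooth_on O (fun x => T x 0 i).

Lemma smooth_map_diff O T x : open O -> smooth_map O T -> O x -> differentiable T x.
Proof.
move=> oO sT Ox.
have -> : T = \sum_(i < N) (fun x => T x 0 i *: (delta_mx 0 i : 'rV[R]_N)).
  apply/funext => y; rewrite fct_sumE {1}[T y]row_sum_delta; exact: eq_bigr.
apply: differentiable_sum => i; apply: differentiableZl.
exact: smooth_diff (sT i) Ox.
Qed.

Lemma smooth_map_D O T x v i : open O -> smooth_map O T -> O x ->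
  ('D_v T x : 'rV[R]_N) 0 i = 'D_v (fun y => T y 0 i) x.
Proof.
move=> oO sT Ox; rewrite derive_mx ?mxE //.
exact/diff_derivable/(smooth_map_diff oO sT Ox).
Qed.

Lemma derive_lin (f : 'rV[R]_M -> 'rV[R]_N) x a u v : differentiable f x ->
  'D_(a *: u + v) f x = a *: 'D_u f x + 'D_v f x.
Proof. by move=> df; rewrite !deriveE // linearP. Qed.

Lemma chain (g : 'rV[R]_N -> R) T x v :
  differentiable T x -> differentiable g (T x) ->
  'D_v (g \o T) x = 'D_('D_v T x) g (T x).
Proof.
move=> dT dg; rewrite !deriveE //; last exact: differentiable_comp.
by rewrite diff_comp.
Qed.

Lemma chain_map P (g : 'rV[R]_N -> 'rV[R]_P) T x v :
  differentiable T x -> differentiable g (T x) ->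
  'D_v (g \o T) x = 'D_('D_v T x) g (T x).
Proof.
move=> dT dg; rewrite !deriveE //; last exact: differentiable_comp.
by rewrite diff_comp.
Qed.

(** Induction on the order: by the chain rule a derivative of [g \o T] is a sum of derivatives of
    [T] times compositions known to one order less. *)
Lemma smooth_comp O (O' : set 'rV[R]_N) T g : open O -> open O' ->
  (forall x, O x -> O' (T x)) -> smooth_map O T -> smooth_on O' g ->
  smooth_on O (g \o T).
Proof.
move=> oO oO' TO sT sg k; elim: k g sg => [|k IH] g sg.
  split=> // x Ox; apply: continuous_comp; last exact: smooth_cont sg (TO _ Ox).
  exact/differentiable_continuous/(smooth_map_diff oO sT Ox).
split=> [x Ox|i].
  apply: continuous_comp; last exact: smooth_cont sg (TO _ Ox).
  exact/differentiable_continuous/(smooth_map_diff oO sT Ox).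
split=> [x Ox|].
  apply/diff_derivable/differentiable_comp; first exact: smooth_map_diff sT Ox.
  exact: smooth_diff sg (TO _ Ox).
pose h x := \sum_j 'D_(delta_mx 0 i) (fun y => T y 0 j) x *
  (('D_(delta_mx 0 j) g) \o T) x.
apply: (@Ck_congr _ _ k O h) => //.
  move=> x Ox; rewrite chain; first last.
  - exact: smooth_diff sg (TO _ Ox).
  - exact: smooth_map_diff sT Ox.
  rewrite (smooth_deriveE _ oO' sg (TO _ Ox)); apply: eq_bigr => j _.
  by rewrite (smooth_map_D _ _ oO sT Ox).
rewrite /h; elim: (index_enum _) => [|j r IHr].
  by under eq_fun do rewrite big_nil; exact: Ck_cst.
under eq_fun do rewrite big_cons; apply: Ck_add => //; apply: Ck_mul => //.
  exact: (smooth_D i (sT j)).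
by apply: IH; exact: smooth_D.
Qed.

End Composition.

(** * Tangent vectors, smooth fields and brackets in a chart *)

Section Charts.
Context {R : realType} {N : nat} (M : manifold R N).
Implicit Types (c d e : chart R N M) (q : M) (U : set M) (v w : 'rV[R]_N).

Definition img c U := cmap c @` (cdom c `&` U).

Lemma img_mem c U q : cdom c q -> U q -> img c U (cmap c q).
Proof. by move=> dq Uq; exists q. Qed.

Lemma img_open c U : open U -> open (img c U).
Proof.
move=> oU; rewrite openE => _ [q [dq Uq] <-].
have nD : \forall x \near cmap c q, (cmap c @` cdom c) x.
  by apply: open_nbhs_nbhs; split; [exact: cimg_open | exists q].
have nU : \forall x \near cmap c q, U (cinv c x).
  have cc : {for cmap c q, continuous (cinv c)} by apply: cinv_continuous; exists q.
  apply: cc; rewrite cmapK //; exact: open_nbhs_nbhs.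
suff : nbhs (cmap c q) (img c U) by [].
apply: filterS2 nD nU => x [r dr <-]; rewrite cmapK // => Ur.
by exists r.
Qed.

Definition trans c d := cmap d \o cinv c.

Section Two.
Context (c d : chart R N M) (ac : @atlas _ _ M c) (ad : @atlas _ _ M d).

Lemma trans_smooth : smooth_map (img c (cdom d)) (trans c d).
Proof. by move=> i; exact: atlas_compat. Qed.

Lemma transE q : cdom c q -> trans c d (cmap c q) = cmap d q.
Proof. by move=> dq; rewrite /trans /= cmapK. Qed.

Lemma trans_diff q : cdom c q -> cdom d q -> differentiable (trans c d) (cmap c q).
Proof.
move=> cq dq; apply: (smooth_map_diff _ trans_smooth); last exact: img_mem.
exact/img_open/cdom_open.
Qed.

Lemma trans_near q (P : 'rV[R]_N -> Prop) : cdom c q -> cdom d q ->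
  (forall r, cdom c r -> cdom d r -> P (cmap c r)) -> \forall x \near cmap c q, P x.
Proof.
move=> cq dq h; apply: (@near_open _ _ (img c (cdom d))).
- exact/img_open/cdom_open.
- exact: img_mem.
- by move=> _ [r [cr dr] <-]; exact: h.
Qed.

End Two.

Section Tangent.
Context (c : chart R N M) (ac : @atlas _ _ M c) (q : M) (cq : cdom c q).

Let d := chart_at q.
Let ad : @atlas _ _ M d := chart_at_atlas q.
Let dq : cdom d q := chart_at_dom q.

Lemma tcoordK v : tcoord c q (tvec c v q) = v.
Proof.
have h := chain_map v (trans_diff ac ad cq dq) (_ : differentiable (trans d c) (trans c d (cmap c q))).
rewrite transE // in h; rewrite /tcoord /tvec -h; last exact: trans_diff.
rewrite -[RHS](derive_id (cmap c q) v); apply: near_eq_derive.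
by apply: (trans_near cq dq) => r cr dr; rewrite /= /trans /= !cmapK.
Qed.

Lemma tvecK v : tvec c (tcoord c q v) q = v.
Proof.
have h := chain_map v (trans_diff ad ac dq cq) (_ : differentiable (trans c d) (trans d c (cmap d q))).
rewrite transE // in h; rewrite /tcoord /tvec -h; last exact: trans_diff.
rewrite -[RHS](derive_id (cmap d q) v); apply: near_eq_derive.
by apply: (trans_near dq cq) => r cr dr; rewrite /= /trans /= !cmapK.
Qed.

Lemma tcoord_lin a v w : tcoord c q (a *: v + w) = a *: tcoord c q v + tcoord c q w.
Proof. by apply: derive_lin; exact: trans_diff. Qed.

Lemma tvec_lin a v w : tvec c (a *: v + w) q = a *: tvec c v q + tvec c w q.
Proof. by apply: derive_lin; exact: trans_diff. Qed.

Lemma tcoord0 : tcoord c q 0 = 0.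
Proof. by have := tcoord_lin (-1) 0 0; rewrite scaler0 addr0 scaleN1r addNr. Qed.

Lemma tcoordD v w : tcoord c q (v + w) = tcoord c q v + tcoord c q w.
Proof. by have := tcoord_lin 1 v w; rewrite !scale1r. Qed.

Lemma tcoordZ a v : tcoord c q (a *: v) = a *: tcoord c q v.
Proof. by have := tcoord_lin a v 0; rewrite !addr0 tcoord0 addr0. Qed.

Lemma tcoord_sum I (r : seq I) (F : I -> 'rV[R]_N) :
  tcoord c q (\sum_(i <- r) F i) = \sum_(i <- r) tcoord c q (F i).
Proof. by apply: big_morph; [exact: tcoordD | exact: tcoord0]. Qed.

Lemma tvec0 : tvec c 0 q = 0.
Proof. by have := tvec_lin (-1) 0 0; rewrite scaler0 addr0 scaleN1r addNr. Qed.

Lemma tvecD v w : tvec c (v + w) q = tvec c v q + tvec c w q.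
Proof. by have := tvec_lin 1 v w; rewrite !scale1r. Qed.

Lemma tvecZ a v : tvec c (a *: v) q = a *: tvec c v q.
Proof. by have := tvec_lin a v 0; rewrite !addr0 tvec0 addr0. Qed.

Lemma tvec_sum I (r : seq I) (F : I -> 'rV[R]_N) :
  tvec c (\sum_(i <- r) F i) q = \sum_(i <- r) tvec c (F i) q.
Proof.
by apply: (big_morph (fun v => tvec c v q)); [exact: tvecD | exact: tvec0].
Qed.

Lemma tvec_expand v : v = \sum_i tcoord c q v 0 i *: tvec c (delta_mx 0 i) q.
Proof.
rewrite -{1}[v]tvecK {1}[tcoord c q v]row_sum_delta tvec_sum.
by apply: eq_bigr => i _; rewrite tvecZ.
Qed.

Lemma tcoord_change e v : @atlas _ _ M e -> cdom e q ->
  tcoord e q v = 'D_(tcoord c q v) (trans c e) (cmap c q).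
Proof.
move=> ae eq.
have h := chain_map v (trans_diff ad ac dq cq) (_ : differentiable (trans c e) (trans d c (cmap d q))).
rewrite transE // in h; rewrite -h; last exact: trans_diff.
apply: near_eq_derive.
by apply: (trans_near dq cq) => r cr dr; rewrite /= /trans /= !cmapK.
Qed.

Lemma vderE X (f : M -> R) : differentiable (f \o cinv c) (cmap c q) ->
  vder X f q = 'D_(tcoord c q (X q)) (f \o cinv c) (cmap c q).
Proof.
move=> df.
have h := chain (X q) (trans_diff ad ac dq cq) (_ : differentiable (f \o cinv c) (trans d c (cmap d q))).
rewrite transE // in h; rewrite -h //.
apply: near_eq_derive.
by apply: (trans_near dq cq) => r cr dr; rewrite /= /trans /= !cmapK.
Qed.

End Tangent.

Section Local.
Context (c : chart R N M) (ac : @atlas _ _ M c).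

Lemma smooth_in_local U (f : M -> R) : open U -> U `<=` cdom c -> smooth_in U c f ->
  smooth_fun U f.
Proof.
move=> oU Uc sf e ae.
apply: (@smooth_congr _ _ _ ((f \o cinv c) \o trans e c)).
- exact: img_open.
- move=> _ [r [er Ur] <-]; rewrite /trans /= !cmapK //; exact: Uc.
- apply: (@smooth_comp _ _ _ _ (img c U)).
  + exact: img_open.
  + exact: img_open.
  + move=> _ [r [er Ur] <-]; rewrite transE //; apply: img_mem => //; exact: Uc.
  + move=> i; apply: smooth_sub (trans_smooth ae ac i) => _ [r [er Ur] <-].
    by apply: img_mem => //; exact: Uc.
  + exact: sf.
Qed.

Lemma smooth_vfield_local U (X : vfield M) : open U -> U `<=` cdom c ->
  (forall i, smooth_in U c (fun q => tcoord c q (X q) 0 i)) -> smooth_vfield U X.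
Proof.
move=> oU Uc sX e ae i.
pose U' := U `&` cdom e.
have oU' : open U' by apply: openI => //; exact: cdom_open.
have UU' : img e U = img e U'.
  apply/seteqP; split=> x [r [er Ur] <-]; first exact: img_mem.
  by case: Ur => Ur _; exact: img_mem.
suff : smooth_fun U' (fun q => tcoord e q (X q) 0 i).
  by move/(_ e ae); rewrite /smooth_in -/(img e U) -/(img e U') UU'.
apply: smooth_in_local => //; first by move=> r [/Uc].
have sub : img c U' `<=` img c (cdom e).
  by move=> _ [r [cr [Ur er]] <-]; exact: img_mem.
apply: (@smooth_congr _ _ _ (fun x => \sum_j tcoord c (cinv c x) (X (cinv c x)) 0 j *
   'D_(delta_mx 0 j) (fun y => trans c e y 0 i) x)).
- exact: img_open.
- move=> _ [r [cr [Ur er]] <-]; rewrite /= !cmapK //.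
  rewrite (tcoord_change ac cr _ ae er).
  have oe := img_open (c := c) (cdom_open e); have me := img_mem cr er.
  rewrite (smooth_map_D _ _ oe (trans_smooth ac ae) me).
  exact: (esym (smooth_deriveE _ oe (trans_smooth ac ae i) me)).
apply: smooth_sum; first exact: img_open.
move=> j; apply: smooth_mul; first exact: img_open.
  apply: smooth_sub (sX j) => _ [r [cr [Ur er]] <-]; exact: img_mem.
apply: smooth_D; apply: smooth_sub (trans_smooth ac ae i); exact: sub.
Qed.

End Local.

Fact vd_key : unit. Proof. by []. Qed.
(* Locked, to keep unification from unfolding derivatives. *)
Definition vd : vfield M -> (M -> R) -> M -> R := locked_with vd_key (@vder R N M).

Lemma vdE : vd = @vder R N M.
Proof. by rewrite /vd unlock. Qed.

Section Calculus.
Context (c : chart R N M) (ac : @atlas _ _ M c).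
Let U := cdom c.
Let O := img c U.

Let oU : open U. Proof. exact: cdom_open. Qed.
Let oO : open O. Proof. exact: img_open. Qed.

(* Wrapped in records so that unification does not unfold them. *)
Record sfun (f : M -> R) : Prop := Sfun { sfunW : smooth_fun U f }.
Record svf (X : vfield M) : Prop := Svf { svfW : smooth_vfield U X }.
Definition ev : 'rV[R]_N -> vfield M := locked_with vd_key (tvec c).

Lemma evE v q : ev v q = tvec c v q.
Proof. by rewrite /ev unlock. Qed.

Lemma sfunP f : sfun f <-> smooth_on O (f \o cinv c).
Proof.
split=> [[h]|sf]; first exact: h c ac.
split; exact: (smooth_in_local ac oU (fun _ h => h) sf).
Qed.

Lemma svfP X : svf X <->
  forall i, smooth_on O ((fun q => tcoord c q (X q) 0 i) \o cinv c).
Proof.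
split=> [[h]|sX]; first exact: h c ac.
split; exact: (smooth_vfield_local ac oU (fun _ h => h) sX).
Qed.

Lemma imgU q : U q -> O (cmap c q).
Proof. by move=> Uq; exact: img_mem. Qed.

Lemma near_U q (P : 'rV[R]_N -> Prop) : U q ->
  (forall r, U r -> P (cmap c r)) -> \forall x \near cmap c q, P x.
Proof.
move=> Uq h; apply: (near_open oO (imgU Uq)) => _ [r [Ur _] <-]; exact: h.
Qed.

Lemma sfun_congr f g : (forall q, U q -> f q = g q) -> sfun f -> sfun g.
Proof.
move=> fg /sfunP sf; apply/sfunP; apply: (smooth_congr oO _ sf).
by move=> _ [r [Ur _] <-]; rewrite /= (cmapK Ur); exact: fg.
Qed.

Lemma svf_congr X Y : (forall q, U q -> X q = Y q) -> svf X -> svf Y.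
Proof.
move=> XY /svfP sX; apply/svfP => i; apply: (smooth_congr oO _ (sX i)).
by move=> _ [r [Ur _] <-]; rewrite /= (cmapK Ur) XY.
Qed.

Lemma sfun_cst (a : R) : sfun (fun=> a).
Proof. by apply/sfunP; exact: smooth_cst. Qed.

Lemma sfun_add f g : sfun f -> sfun g -> sfun (fun q => f q + g q).
Proof. by move=> /sfunP sf /sfunP sg; apply/sfunP; exact: smooth_add sf sg. Qed.

Lemma sfun_mul f g : sfun f -> sfun g -> sfun (fun q => f q * g q).
Proof. by move=> /sfunP sf /sfunP sg; apply/sfunP; exact: smooth_mul sf sg. Qed.

Lemma sfun_sum I (r : seq I) (F : I -> M -> R) : (forall i, sfun (F i)) ->
  sfun (fun q => \sum_(i <- r) F i q).
Proof.
move=> sF; apply/sfunP; apply: (@smooth_sum _ _ _ _ r (fun i => F i \o cinv c)) => // i.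
exact/sfunP.
Qed.

Lemma sfun_coord X i : svf X -> sfun (fun q => tcoord c q (X q) 0 i).
Proof. by move=> /svfP sX; apply/sfunP. Qed.

Lemma svf_add X Y : svf X -> svf Y -> svf (fun q => X q + Y q).
Proof.
move=> sX sY; apply/svfP => i; apply/sfunP.
apply: sfun_congr (sfun_add (sfun_coord i sX) (sfun_coord i sY)) => q Uq.
by rewrite tcoordD // mxE.
Qed.

Lemma svf_scale f X : sfun f -> svf X -> svf (fun q => f q *: X q).
Proof.
move=> sf sX; apply/svfP => i; apply/sfunP.
apply: sfun_congr (sfun_mul sf (sfun_coord i sX)) => q Uq.
by rewrite tcoordZ // mxE.
Qed.

Lemma svf_ev v : svf (ev v).
Proof.
apply/svfP => i; apply/sfunP; apply: sfun_congr (sfun_cst (v 0 i)) => q Uq.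
by rewrite evE tcoordK.
Qed.

Lemma sfun_diff f q : sfun f -> U q -> differentiable (f \o cinv c) (cmap c q).
Proof. by move=> /sfunP sf Uq; exact: smooth_diff sf (imgU Uq). Qed.

Lemma vderE' X f q : sfun f -> U q ->
  vd X f q = 'D_(tcoord c q (X q)) (f \o cinv c) (cmap c q).
Proof. by move=> sf Uq; rewrite vdE; apply: vderE => //; exact: sfun_diff. Qed.

Lemma vder_congr X f g q : U q -> sfun f -> (forall r, U r -> f r = g r) ->
  vd X f q = vd X g q.
Proof.
move=> Uq sf fg; rewrite !vderE' //; last exact: sfun_congr sf.
apply: near_eq_derive; apply: (near_U Uq) => r Ur.
by rewrite /= cmapK // fg.
Qed.

Lemma vderD X f g q : U q -> sfun f -> sfun g ->
  vd X (fun r => f r + g r) q = vd X f q + vd X g q.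
Proof.
move=> Uq sf sg; rewrite !vderE' //; last exact: sfun_add.
have df := sfun_diff sf Uq; have dg := sfun_diff sg Uq.
by rewrite -deriveD //; exact: diff_derivable.
Qed.

Lemma vderM X f g q : U q -> sfun f -> sfun g ->
  vd X (fun r => f r * g r) q = f q * vd X g q + g q * vd X f q.
Proof.
move=> Uq sf sg; rewrite !vderE' //; last exact: sfun_mul.
have df := sfun_diff sf Uq; have dg := sfun_diff sg Uq.
have := deriveM (diff_derivable (v := tcoord c q (X q)) df)
  (diff_derivable (v := tcoord c q (X q)) dg).
by rewrite /= cmapK.
Qed.

Lemma vder_cst X (a : R) q : U q -> vd X (fun=> a) q = 0.
Proof. by move=> Uq; rewrite vderE' //; [exact: derive_cst | exact: sfun_cst]. Qed.

Lemma vderN X f q : U q -> sfun f -> vd X (fun r => - f r) q = - vd X f q.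
Proof.
move=> Uq sf; have s1 := sfun_cst (-1).
have := vderM X Uq s1 sf; rewrite vder_cst // mulr0 addr0 mulN1r => <-.
apply: vder_congr => // [|r _]; last by rewrite mulN1r.
by apply: sfun_congr (sfun_mul s1 sf) => r _; rewrite mulN1r.
Qed.

Lemma sfun_vder X f : svf X -> sfun f -> sfun (vd X f).
Proof.
move=> sX sf; have /sfunP sf' := sf.
apply: (@sfun_congr (fun q => \sum_i tcoord c q (X q) 0 i *
    'D_(delta_mx 0 i) (f \o cinv c) (cmap c q))).
  by move=> q Uq; rewrite vderE' // (smooth_deriveE _ oO sf' (imgU Uq)).
apply: sfun_sum => i; apply: sfun_mul; first exact: sfun_coord.
apply/sfunP; apply: (smooth_congr oO _ (smooth_D i sf')) => _ [r [Ur _] <-].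
by rewrite /= (cmapK Ur).
Qed.

Lemma vder_comm v w f q : U q -> sfun f ->
  vd (ev v) (vd (ev w) f) q = vd (ev w) (vd (ev v) f) q.
Proof.
move=> Uq sf; have /sfunP sf' := sf.
have key a b : vd (ev a) (vd (ev b) f) q = 'D_a ('D_b (f \o cinv c)) (cmap c q).
  have svb := sfun_vder (svf_ev b) sf.
  rewrite (vderE' _ svb Uq) evE (tcoordK ac Uq); apply: near_eq_derive.
  apply: (near_U Uq) => r Ur.
  by rewrite /= (cmapK Ur) (vderE' _ sf Ur) evE (tcoordK ac Ur).
by rewrite !key; exact: smooth_schwarz sf' (imgU Uq).
Qed.

(** The bracket is computed in [chart_at q], where the components of [ev w] are the derivative of
    the transition map along [w]. Its two terms are thus mixed second derivatives of that map. *)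
Lemma bracket_ev v w q : U q -> bracket (ev v) (ev w) q = 0.
Proof.
move=> Uq; have -> : ev = tvec c by rewrite /ev unlock.
rewrite /bracket; set d := chart_at q.
have ad : @atlas _ _ M d := chart_at_atlas q.
have dq : cdom d q := chart_at_dom q.
have oe := img_open (c := c) (cdom_open d); have me := img_mem Uq dq.
have [F [key sym]] : exists F : 'rV[R]_N -> 'rV[R]_N -> 'I_N -> R,
    (forall a b, 'D_(tvec c a q) (vlocal d (tvec c b)) (cmap d q) = \row_i F a b i) /\
    (forall a b i, F a b i = F b a i).
  exists (fun a b i => 'D_a ('D_b (fun x => trans c d x 0 i)) (cmap c q)).
  split; last first.
    by move=> a b i; exact: (smooth_schwarz _ _ oe (trans_smooth ac ad i) me).
  move=> a b.
  pose G x := 'D_b (trans c d) x.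
  have sG : smooth_map (img c (cdom d)) G.
    move=> i; apply: smooth_congr (smooth_derive b oe (trans_smooth ac ad i)) => //.
    by move=> x Ox; rewrite /G (smooth_map_D _ _ oe (trans_smooth ac ad) Ox).
  have dG := smooth_map_diff oe sG me.
  have dT := trans_diff ad ac dq Uq.
  have -> : 'D_(tvec c a q) (vlocal d (tvec c b)) (cmap d q) =
      'D_(tvec c a q) (G \o trans d c) (cmap d q).
    apply: near_eq_derive; apply: (trans_near dq Uq) => r dr Ur.
    rewrite /vlocal cmapK // (tcoord_change ac Ur _ ad dr) tcoordK //.
    by rewrite /G /= transE.
  rewrite (chain_map _ dT); last by rewrite transE.
  rewrite transE //.
  have -> : 'D_(tvec c a q) (trans d c) (cmap d q) = a.
    change (tcoord c q (tvec c a q) = a); exact: (tcoordK ac Uq).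
  apply/rowP => i.
  rewrite (smooth_map_D _ _ oe sG me) mxE; apply: near_eq_derive.
  apply: (near_open oe me) => x Ox.
  by rewrite /G (smooth_map_D _ _ oe (trans_smooth ac ad) Ox).
have e0 : \row_i F v w i = \row_i F w v i by apply/rowP => i; rewrite !mxE sym.
apply/eqP; rewrite subr_eq0; apply/eqP.
exact: (etrans (key v w) (etrans e0 (esym (key w v)))).
Qed.

End Calculus.

End Charts.

(** * Tensoriality and locality of the connection *)

Section Fields.
Context {R : realType} {N : nat} (M : manifold R N).
Context (c : chart R N M) (ac : @atlas _ _ M c).
Let U := cdom c.
Implicit Types (X Y Z : vfield M) (f : M -> R) (q : M) (v w : 'rV[R]_N).

Local Notation sfun := (sfun c).
Local Notation svf := (svf c).
Local Notation ev := (ev c).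

Let oU : open U. Proof. exact: cdom_open. Qed.

Lemma sfun_T f : smooth_in setT c f -> sfun f.
Proof.
move=> sf; apply/(sfunP ac); apply: smooth_sub sf => _ [r [Ur _] <-].
exact: img_mem.
Qed.

Lemma svf_T X : smooth_vfield setT X -> svf X.
Proof.
by move=> sX; apply/(svfP ac) => i; apply/(sfunP ac); apply: sfun_T; exact: sX.
Qed.

Lemma svf_eapp (F : endofield M) X : smooth_endofield F -> svf X -> svf (eapp F X).
Proof.
move=> sF sX; apply/(svfP ac) => j; apply/(sfunP ac).
pose h q := \sum_i tcoord c q (X q) 0 i *
  tcoord c q (tvec c (delta_mx 0 i) q *m F q) 0 j.
apply: (@sfun_congr _ _ _ _ ac h) => [q Uq|].
  rewrite /h /eapp {2}(tvec_expand ac Uq (X q)) mulmx_suml (tcoord_sum ac Uq) summxE.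
  by apply: eq_bigr => i _; rewrite -scalemxAl (tcoordZ ac Uq) [RHS]mxE.
apply: (sfun_sum ac) => i; apply: (sfun_mul ac); first exact: sfun_coord.
by apply: sfun_T; exact: sF.
Qed.

Lemma sfun_fapp (w : oneform M) X : smooth_form w -> svf X -> sfun (fapp w X).
Proof.
move=> sw sX.
pose h q := \sum_i tcoord c q (X q) 0 i * (tvec c (delta_mx 0 i) q *m w q) 0 0.
apply: (@sfun_congr _ _ _ _ ac h) => [q Uq|].
  rewrite /h /fapp {2}(tvec_expand ac Uq (X q)) mulmx_suml summxE.
  by apply: eq_bigr => i _; rewrite -scalemxAl [RHS]mxE.
apply: (sfun_sum ac) => i; apply: (sfun_mul ac); first exact: sfun_coord.
by apply: sfun_T; exact: sw.
Qed.

Lemma bappE (G : bilfield M) X Y q : bapp G X Y q = ip (G q) (X q) (Y q).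
Proof. by []. Qed.

Lemma sfun_bapp (G : bilfield M) X Y : smooth_bilfield G -> svf X -> svf Y ->
  sfun (bapp G X Y).
Proof.
move=> sG sX sY.
pose h q := \sum_i tcoord c q (X q) 0 i * \sum_j tcoord c q (Y q) 0 j *
  (tvec c (delta_mx 0 i) q *m G q *m (tvec c (delta_mx 0 j) q)^T) 0 0.
apply: (@sfun_congr _ _ _ _ ac h) => [q Uq|].
  rewrite /h bappE {2}(tvec_expand ac Uq (X q)) ip_suml.
  apply: eq_bigr => i _; rewrite ipZl; congr (_ * _).
  rewrite {2}(tvec_expand ac Uq (Y q)) ip_sumr.
  by apply: eq_bigr => j _; rewrite ipZr.
apply: (sfun_sum ac) => i; apply: (sfun_mul ac); first exact: sfun_coord.
apply: (sfun_sum ac) => j; apply: (sfun_mul ac); first exact: sfun_coord.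
by apply: sfun_T; exact: sG.
Qed.

Lemma svf_zero : svf (fun=> 0).
Proof.
apply: (@svf_congr _ _ _ _ ac (ev 0)) (svf_ev ac 0) => q Uq.
by rewrite evE (tvec0 ac Uq).
Qed.

Lemma svf_sum I (s : seq I) (F : I -> vfield M) : (forall i, svf (F i)) ->
  svf (fun q => \sum_(i <- s) F i q).
Proof.
move=> sF; elim: s => [|i s IH].
  by under eq_fun do rewrite big_nil; exact: svf_zero.
by under eq_fun do rewrite big_cons; apply: (svf_add ac).
Qed.

Section Tensor.
Context (K : nat) (T : vfield M -> 'rV[R]_K) (q : M) (Uq : U q).
Context (Tc : forall X Y, svf X -> svf Y -> (forall r, U r -> X r = Y r) -> T X = T Y).
Context (Ta : forall X Y, svf X -> svf Y -> T (fun r => X r + Y r) = T X + T Y).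
Context (Ts : forall f X, sfun f -> svf X -> T (fun r => f r *: X r) = f q *: T X).

Lemma tensor_sum I (s : seq I) (f : I -> M -> R) (X : I -> vfield M) :
  (forall i, sfun (f i)) -> (forall i, svf (X i)) ->
  T (fun r => \sum_(i <- s) f i r *: X i r) = \sum_(i <- s) f i q *: T (X i).
Proof.
move=> sf sX; elim: s => [|i s IH].
  rewrite big_nil; under eq_fun do rewrite big_nil.
  have -> : (fun=> 0) = (fun r : M => (0 : R) *: (0 : 'rV[R]_N)).
    by apply/funext => r; rewrite scaler0.
  by rewrite (Ts (sfun_cst ac 0) svf_zero) scale0r.
rewrite big_cons -IH -Ts // -Ta.
- by congr T; apply/funext => r; rewrite big_cons.
- by apply: (svf_scale ac).
- by apply: svf_sum => j; apply: (svf_scale ac).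
Qed.

Lemma tensor_expand X : svf X ->
  T X = \sum_i tcoord c q (X q) 0 i *: T (ev (delta_mx 0 i)).
Proof.
move=> sX; rewrite -(tensor_sum _ (f := fun i r => tcoord c r (X r) 0 i)
   (X := fun i => ev (delta_mx 0 i))); first last.
- by move=> i; exact: svf_ev.
- by move=> i; exact: sfun_coord.
apply: Tc => //.
  apply: svf_sum => i; apply: (svf_scale ac); first exact: sfun_coord.
  exact: svf_ev.
move=> r Ur; rewrite {1}(tvec_expand ac Ur (X r)).
by apply: eq_bigr => i _; rewrite evE.
Qed.

(** Expanding [X] in coordinate fields, linearity over functions leaves only its components at
    [q]. *)
Lemma tensor_pt X : svf X -> T X = T (ev (tcoord c q (X q))).
Proof.
move=> sX; rewrite tensor_expand // [RHS]tensor_expand; last exact: svf_ev.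
by rewrite evE (tcoordK ac Uq).
Qed.

Lemma tensor_lin a v w : T (ev (a *: v + w)) = a *: T (ev v) + T (ev w).
Proof.
rewrite -(Ts (sfun_cst ac a) (svf_ev ac v)) -Ta; first last.
- exact: svf_ev.
- by apply: (svf_scale ac); [exact: sfun_cst | exact: svf_ev].
apply: Tc; first exact: svf_ev.
  apply: (svf_add ac); last exact: svf_ev.
  by apply: (svf_scale ac); [exact: sfun_cst | exact: svf_ev].
by move=> r Ur; rewrite !evE (tvec_lin ac Ur).
Qed.

End Tensor.

Context (g : bilfield M) (nabla : vfield M -> vfield M -> vfield M).
Context (lc : levi_civita g nabla).

Lemma svf_nabla X Y : svf X -> svf Y -> svf (nabla X Y).
Proof. by move=> [sX] [sY]; split; exact: (lc_smooth lc oU sX sY). Qed.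

(** A field vanishing on [U] equals its product with the indicator of the complement, which is
    smooth on [U] because it is zero there. Linearity and the Leibniz rule then make [nabla]
    insensitive to values outside of [U]. *)
Lemma vanish X : svf X -> (forall r, U r -> X r = 0) ->
  exists f, [/\ sfun f, forall r, U r -> f r = 0 & X = fun r => f r *: X r].
Proof.
move=> sX X0; exists (fun r => if `[< U r >] then 0 else 1); split.
- apply: (@sfun_congr _ _ _ _ ac (fun=> 0)) (sfun_cst ac 0) => r Ur.
  by rewrite asboolT.
- by move=> r Ur; rewrite asboolT.
apply/funext => r; case: asboolP => [Ur|_]; last by rewrite scale1r.
by rewrite scale0r X0.
Qed.

Lemma nablaDl X X' Y q : U q -> svf X -> svf X' -> svf Y ->
  nabla (fun r => X r + X' r) Y q = nabla X Y q + nabla X' Y q.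
Proof. by move=> Uq [sX] [sX'] [sY]; exact: (lc_addl lc oU sX sX' sY Uq). Qed.

Lemma nablaZl f X Y q : U q -> sfun f -> svf X -> svf Y ->
  nabla (fun r => f r *: X r) Y q = f q *: nabla X Y q.
Proof. by move=> Uq [sf] [sX] [sY]; exact: (lc_scalel lc oU sf sX sY Uq). Qed.

Lemma nablaDr X Y Y' q : U q -> svf X -> svf Y -> svf Y' ->
  nabla X (fun r => Y r + Y' r) q = nabla X Y q + nabla X Y' q.
Proof. by move=> Uq [sX] [sY] [sY']; exact: (lc_addr lc oU sX sY sY' Uq). Qed.

Lemma nablaM X f Y q : U q -> sfun f -> svf X -> svf Y ->
  nabla X (fun r => f r *: Y r) q = vd X f q *: Y q + f q *: nabla X Y q.
Proof. by move=> Uq [sf] [sX] [sY]; rewrite vdE; exact: (lc_leibniz lc oU sf sX sY Uq). Qed.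

Lemma svf_opp X : svf X -> svf (fun r => - X r).
Proof.
move=> sX; apply: (@svf_congr _ _ _ _ ac (fun r => -1 *: X r)) => [r _|].
  by rewrite scaleN1r.
by apply: (svf_scale ac) => //; exact: sfun_cst.
Qed.

Lemma nabla_congr_l X X' Y q : U q -> svf X -> svf X' -> svf Y ->
  (forall r, U r -> X r = X' r) -> nabla X Y q = nabla X' Y q.
Proof.
move=> Uq sX sX' sY XX'.
pose Z := fun r => X r - X' r.
have sZ : svf Z by apply: (svf_add ac) => //; exact: svf_opp.
have Z0 r : U r -> Z r = 0 by move=> Ur; rewrite /Z XX' // subrr.
have [f [sf f0 fZ]] := vanish sZ Z0.
have -> : X = fun r => X' r + Z r by apply/funext => r; rewrite /Z subrKC.
by rewrite nablaDl // fZ nablaZl // f0 // scale0r addr0.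
Qed.

Lemma nabla_congr_r X Y Y' q : U q -> svf X -> svf Y -> svf Y' ->
  (forall r, U r -> Y r = Y' r) -> nabla X Y q = nabla X Y' q.
Proof.
move=> Uq sX sY sY' YY'.
pose Z := fun r => Y r - Y' r.
have sZ : svf Z by apply: (svf_add ac) => //; exact: svf_opp.
have Z0 r : U r -> Z r = 0 by move=> Ur; rewrite /Z YY' // subrr.
have [f [sf f0 fZ]] := vanish sZ Z0.
have -> : Y = fun r => Y' r + Z r by apply/funext => r; rewrite /Z subrKC.
by rewrite nablaDr // fZ nablaM // f0 // Z0 // scaler0 scale0r !addr0.
Qed.

Lemma nabla_tens_c Y q : U q -> svf Y -> forall X X', svf X -> svf X' ->
  (forall r, U r -> X r = X' r) -> nabla X Y q = nabla X' Y q.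
Proof. by move=> Uq sY X X' *; exact: nabla_congr_l. Qed.

Lemma nabla_pt X Y q : U q -> svf X -> svf Y ->
  nabla X Y q = nabla (ev (tcoord c q (X q))) Y q.
Proof.
move=> Uq sX sY; apply: (tensor_pt (T := fun X => nabla X Y q)) => //.
- exact: nabla_tens_c.
- by move=> *; exact: nablaDl.
- by move=> *; exact: nablaZl.
Qed.

Lemma nabla_evlin a v w Y q : U q -> svf Y ->
  nabla (ev (a *: v + w)) Y q = a *: nabla (ev v) Y q + nabla (ev w) Y q.
Proof.
move=> Uq sY; apply: (tensor_lin (T := fun X => nabla X Y q)) => //.
- exact: nabla_tens_c.
- by move=> *; exact: nablaDl.
- by move=> *; exact: nablaZl.
Qed.

Lemma nabla0r X q : U q -> svf X -> nabla X (fun=> 0) q = 0.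
Proof.
move=> Uq sX; have -> : (fun=> 0) = (fun r : M => (0 : R) *: (0 : 'rV[R]_N)).
  by apply/funext => r; rewrite scaler0.
by rewrite (nablaM Uq (sfun_cst ac 0) sX svf_zero) scaler0 scale0r addr0.
Qed.

Lemma nablaN X Y q : U q -> svf X -> svf Y ->
  nabla X (fun r => - Y r) q = - nabla X Y q.
Proof.
move=> Uq sX sY; have := nablaM Uq (sfun_cst ac (-1)) sX sY.
rewrite (vder_cst ac _ _ Uq) scale0r add0r scaleN1r => <-; congr (nabla X _ q).
by apply/funext => r; rewrite scaleN1r.
Qed.

Lemma nabla_cst X (a : R) Y q : U q -> svf X -> svf Y ->
  nabla X (fun r => a *: Y r) q = a *: nabla X Y q.
Proof.
move=> Uq sX sY; have := nablaM Uq (sfun_cst ac a) sX sY.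
by rewrite (vder_cst ac _ _ Uq) scale0r add0r.
Qed.

Lemma nabla_sum X I (s : seq I) (F : I -> vfield M) q : U q -> svf X ->
  (forall i, svf (F i)) ->
  nabla X (fun r => \sum_(i <- s) F i r) q = \sum_(i <- s) nabla X (F i) q.
Proof.
move=> Uq sX sF; elim: s => [|i s IH].
  by rewrite big_nil; under eq_fun do rewrite big_nil; exact: nabla0r.
rewrite big_cons -IH -nablaDr //; last exact: svf_sum.
by congr (nabla X _ q); apply/funext => r; rewrite big_cons.
Qed.

Lemma nabla_ev_sym v w q : U q -> nabla (ev v) (ev w) q = nabla (ev w) (ev v) q.
Proof.
move=> Uq; have := lc_torsion_free lc oU (svfW (svf_ev ac v)) (svfW (svf_ev ac w)) Uq.
by rewrite (bracket_ev ac v w Uq) => /eqP; rewrite subr_eq0 => /eqP.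
Qed.

Lemma nabla_metric X Y Z q : U q -> svf X -> svf Y -> svf Z ->
  vd X (bapp g Y Z) q = ip (g q) (nabla X Y q) (Z q) + ip (g q) (Y q) (nabla X Z q).
Proof. by move=> Uq [sX] [sY] [sZ]; rewrite vdE; exact: (lc_metric lc oU sX sY sZ Uq). Qed.

End Fields.

(** * Curvature of S-manifolds *)

(** By duality [F^2] kills the [xi], and its formula gives it rank at least [N - s], hence at least
    that of [F]: so [F] and [F^2] have the same kernel. The forms are then treated by comparing the
    two expansions of [F^3]. *)
Lemma phi_kernel (R : realType) N s (F : 'M[R]_N) (xi : 'I_s -> 'rV[R]_N)
    (eta : 'I_s -> 'cV[R]_N) :
  F *m F = - 1%:M + \sum_a eta a *m xi a ->
  (forall a b, (xi b *m eta a) 0 0 = (a == b)%:R) ->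
  (\rank F + s <= N)%N ->
  (forall a, xi a *m F = 0) /\ (forall a, F *m eta a = 0).
Proof.
move=> F2 dual rk.
have xe a b : xi b *m eta a = ((a == b)%:R)%:M by rewrite [LHS]mx11_scalar dual.
have xF2 b : xi b *m F *m F = 0.
  rewrite -mulmxA F2 mulmxDr mulmxN mulmx1 mulmx_sumr (bigD1 b) //= big1 => [|a ab].
    by rewrite mulmxA xe eqxx mul1mx addr0 addNr.
  by rewrite mulmxA xe (negbTE ab) mul_scalar_mx scale0r.
have kk : (kermx (F *m F) <= kermx F)%MS.
  have sub : (kermx F <= kermx (F *m F))%MS.
    by apply/sub_kermxP; rewrite mulmxA mulmx_ker mul0mx.
  have [_ <-] := mxrank_leqif_sup sub.
  rewrite eqn_leq mxrankS //= !mxrank_ker leq_subLR.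
  pose B : 'M[R]_(s, N) := \matrix_a xi a.
  pose C : 'M[R]_(N, s) := \matrix_(i, a) eta a i 0.
  have CB : \sum_a eta a *m xi a = C *m B.
    apply/matrixP => i j; rewrite summxE mxE; apply: eq_bigr => a _.
    by rewrite !mxE big_ord1.
  have : (N <= \rank (F *m F) + s)%N.
    have : (\rank (1%:M : 'M[R]_N) <= \rank (- (F *m F)) + \rank (C *m B))%N.
      have -> : (1%:M : 'M[R]_N) = - (F *m F) + C *m B.
        by rewrite F2 CB opprD opprK addrNK.
      exact: mxrank_add.
    rewrite mxrank1 mxrank_opp => /leq_trans; apply; rewrite leq_add2l.
    by apply: leq_trans (mxrankM_maxl _ _) (rank_leq_col _).
  have := rank_leq_row F; move: rk; move: (\rank F) (\rank (F *m F)) => r1 r2.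
  by clear; lia.
have xF b : xi b *m F = 0.
  apply/sub_kermxP; apply: submx_trans kk.
  by apply/sub_kermxP; rewrite mulmxA.
split=> // b.
have e1 : F *m F *m F = - F.
  rewrite F2 mulmxDl mulNmx mul1mx mulmx_suml big1 ?addr0 // => a _.
  by rewrite -mulmxA xF mulmx0.
have e2 : F *m (F *m F) = - F + \sum_a F *m eta a *m xi a.
  rewrite F2 mulmxDr mulmxN mulmx1 mulmx_sumr; congr (_ + _).
  by apply: eq_bigr => a _; rewrite mulmxA.
have : \sum_a F *m eta a *m xi a = 0.
  by apply: (addrI (- F)); rewrite -e2 mulmxA e1 addr0.
move/(congr1 (mulmx^~ (eta b))); rewrite mul0mx mulmx_suml (bigD1 b) //= big1.
  by rewrite -mulmxA xe eqxx mulmx1 addr0.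
by move=> a ab; rewrite -mulmxA xe eq_sym (negbTE ab) mul_mx_scalar scale0r.
Qed.

(** * Structure tensors of an S-manifold *)

Section SManifold.
Context {R : realType} {N s : nat} (M : manifold R N).
Context (phi : endofield M) (xi : 'I_s -> vfield M) (eta : 'I_s -> oneform M).
Context (g : bilfield M) (t : 'I_s).
Context (hM : lorentzian_S_manifold phi xi eta g t).

Definition sg (a : 'I_s) : R := if a == t then -1 else 1.

Lemma sg2 a : sg a * sg a = 1.
Proof. by rewrite /sg; case: eqP => _; ring. Qed.

Let gff := lS_gff hM.

Lemma kernel q : (forall a, xi a q *m phi q = 0) /\ (forall a, phi q *m eta a q = 0).
Proof.
apply: phi_kernel (gff_phi2 gff q) _ _.
  by move=> a b; have := gff_dual gff q a b.
by have [n [_ Nn ->]] := gff_rank gff; rewrite -Nn.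
Qed.

Lemma ip_sym q x y : ip (g q) x y = ip (g q) y x.
Proof.
have [sG _] := lS_lorentzian hM q.
by rewrite /ip -{1}sG -[in LHS](trmxK x) -!trmx_mul mulmxA mxE.
Qed.

(** This is compatibility evaluated at [xi a], which [phi] annihilates. *)
Lemma eta_ip q a x : (x *m eta a q) 0 0 = sg a * ip (g q) x (xi a q).
Proof.
have [_ /(_ q) h] := lS_compatible hM.
have := congr1 (fun A => xi a q *m A) h.
rewrite mulmxA mulmxA (kernel q).1 !mul0mx mulmxBr mulmx_sumr (bigD1 a) //= big1.
  rewrite addr0 -scalemxAr mulmxA.
  have -> : xi a q *m eta a q = 1%:M.
    by rewrite [LHS]mx11_scalar; have := gff_dual gff q a a; rewrite /fapp eqxx => ->.
  rewrite mul1mx (lS_timelike hM) -/(sg a) => /esym/eqP; rewrite subr_eq0 => /eqP e.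
  rewrite ip_sym /ip e -scalemxAl [X in _ = _ * X]mxE mulrA sg2 mul1r.
  by rewrite -trmx_mul [RHS]mxE.
move=> b ba; rewrite -scalemxAr mulmxA.
have -> : xi a q *m eta b q = 0.
  by rewrite [LHS]mx11_scalar; have := gff_dual gff q b a; rewrite /fapp (negbTE ba) => ->; rewrite raddf0.
by rewrite mul0mx scaler0.
Qed.

Lemma frame q : S_frame (g q) (phi q) (fun a => xi a q) sg.
Proof.
have [_ /(_ q) hc] := lS_compatible hM.
have e0 x a : ip (g q) (x *m phi q) (xi a q) = 0.
  have := eta_ip q a (x *m phi q); rewrite -mulmxA (kernel q).2 mulmx0 mxE => /esym/eqP.
  rewrite mulf_eq0; case/orP => [|/eqP //] /eqP h.
  by have := sg2 a; rewrite h mul0r => /eqP; rewrite eq_sym oner_eq0.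
have phi2 x : x *m phi q *m phi q = - x + \sum_a (sg a * ip (g q) x (xi a q)) *: xi a q.
  rewrite -mulmxA (gff_phi2 gff) mulmxDr mulmxN mulmx1 mulmx_sumr; congr (_ + _).
  apply: eq_bigr => a _; rewrite mulmxA -eta_ip {1}[x *m eta a q]mx11_scalar.
  by rewrite mul_scalar_mx.
split.
- exact: ip_sym.
- move=> x h; have [sG [P Pu PGP]] := lS_lorentzian hM q.
  have xG : x *m g q = 0.
    apply/rowP => i; rewrite [RHS]mxE -(h (delta_mx 0 i)) /ip trmx_delta -colE.
    by rewrite [RHS]mxE.
  have d : (diag_mx (\row_(i < N) if val i == 0%N then -1 else 1) : 'M[R]_N) \in unitmx.
    rewrite unitmxE det_diag unitfE; apply/prodf_neq0 => i _; rewrite mxE.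
    by case: ifP => _; apply/eqP => /eqP; rewrite ?oppr_eq0 (oner_eq0 R).
  have : g q \in unitmx.
    by move: d; rewrite -PGP !unitmx_mul => /andP[/andP[]].
  move=> gu; by rewrite -[x](mulmxK gu) xG mul0mx.
- exact: sg2.
- exact: phi2.
- exact: (kernel q).1.
- move=> a b; have := eta_ip q b (xi a q); have := gff_dual gff q b a; rewrite /fapp => -> h.
  transitivity (sg b * (b == a)%:R); first by rewrite h mulrA sg2 mul1r.
  rewrite eq_sym.
  by case: eqP => [->|_]; rewrite ?mulr0.
- move=> x y.
  have h u v : ip (g q) (u *m phi q) (v *m phi q) =
      ip (g q) u v - \sum_a sg a * ((u *m eta a q) 0 0 * (v *m eta a q) 0 0).
    have := congr1 (fun A => (u *m A *m v^T) 0 0) hc.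
    rewrite /ip trmx_mul !mulmxA => ->; rewrite mulmxBr mulmxBl mxE; congr (_ + _).
    rewrite [LHS]mxE mulmx_sumr mulmx_suml summxE; congr (- _).
    apply: eq_bigr => a _; rewrite (lS_timelike hM) -/(sg a) -scalemxAr -scalemxAl mxE.
    congr (_ * _); rewrite mulmxA {1}[u *m eta a q]mx11_scalar mul_scalar_mx -scalemxAl mxE.
    by rewrite -trmx_mul; congr (_ * _); rewrite mxE.
  have := h x (y *m phi q).
  rewrite big1 ?subr0 => [|a _]; last by rewrite -(mulmxA y) (kernel q).2 mulmx0 [X in _ * (_ * X)]mxE !mulr0.
  rewrite phi2 ipDr ipNr ip_sumr big1 ?addr0 => [<-|a _]; first by rewrite opprK.
  by rewrite ipZr e0 mulr0.
Qed.

(** * The identities satisfied by the derivatives of [xi] and [phi] *)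

Section Connection.
Context (c : chart R N M) (ac : @atlas _ _ M c).
Context (nabla : vfield M -> vfield M -> vfield M) (lc : levi_civita g nabla).
Let U := cdom c.
Local Notation sfun := (sfun c).
Local Notation svf := (svf c).
Local Notation ev := (ev c).
Implicit Types (X Y Z : vfield M) (q r : M) (x y z v w : 'rV[R]_N).

Let oU : open U. Proof. exact: cdom_open. Qed.

Lemma svf_xi a : svf (xi a).
Proof. by apply: (svf_T ac); exact: (gff_xi_smooth gff). Qed.

Lemma svf_phi X : svf X -> svf (eapp phi X).
Proof. exact: (svf_eapp ac (gff_phi_smooth gff)). Qed.

Lemma sfun_eta a X : svf X -> sfun (fapp (eta a) X).
Proof. exact: (sfun_fapp ac (gff_eta_smooth gff a)). Qed.

Lemma sfun_g X Y : svf X -> svf Y -> sfun (bapp g X Y).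
Proof. exact: (sfun_bapp ac (lS_metric_smooth hM)). Qed.

Lemma fappE a Y r : fapp (eta a) Y r = sg a * bapp g (xi a) Y r.
Proof. by rewrite /fapp eta_ip bappE ip_sym. Qed.

Lemma eappE F X q : eapp F X q = X q *m F q.
Proof. by []. Qed.

(** [At] is the derivative of [xi a] and [Pf] that of [phi], on fields; [Pt] is the latter on
    vectors, extended as coordinate fields. *)
Definition At q a v := nabla (ev (tcoord c q v)) (xi a) q.
Definition Pf X Y q := nabla X (eapp phi Y) q - nabla X Y q *m phi q.
Definition Pt q v w := Pf (ev (tcoord c q v)) (ev (tcoord c q w)) q.

Lemma nabla_phi X Y q : nabla X (eapp phi Y) q = Pf X Y q + nabla X Y q *m phi q.
Proof. by rewrite /Pf subrK. Qed.

Lemma Pf_addl X X' Y q : U q -> svf X -> svf X' -> svf Y ->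
  Pf (fun r => X r + X' r) Y q = Pf X Y q + Pf X' Y q.
Proof.
move=> Uq sX sX' sY; rewrite /Pf !(nablaDl lc Uq) //; last exact: svf_phi.
by rewrite mulmxDl opprD addrACA.
Qed.

Lemma Pf_scalel f X Y q : U q -> sfun f -> svf X -> svf Y ->
  Pf (fun r => f r *: X r) Y q = f q *: Pf X Y q.
Proof.
move=> Uq sf sX sY; rewrite /Pf !(nablaZl lc Uq) //; last exact: svf_phi.
by rewrite -scalemxAl scalerBr.
Qed.

Lemma Pf_addr X Y Y' q : U q -> svf X -> svf Y -> svf Y' ->
  Pf X (fun r => Y r + Y' r) q = Pf X Y q + Pf X Y' q.
Proof.
move=> Uq sX sY sY'; rewrite /Pf (nablaDr lc Uq) //.
have -> : eapp phi (fun r => Y r + Y' r) = fun r => eapp phi Y r + eapp phi Y' r.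
  by apply/funext => r; rewrite /eapp mulmxDl.
rewrite (nablaDr lc Uq) //; try exact: svf_phi.
by rewrite mulmxDl opprD addrACA.
Qed.

Lemma Pf_scaler X f Y q : U q -> sfun f -> svf X -> svf Y ->
  Pf X (fun r => f r *: Y r) q = f q *: Pf X Y q.
Proof.
move=> Uq sf sX sY; rewrite /Pf (nablaM lc Uq) //.
have -> : eapp phi (fun r => f r *: Y r) = fun r => f r *: eapp phi Y r.
  by apply/funext => r; rewrite /eapp -scalemxAl.
rewrite (nablaM lc Uq) //; last exact: svf_phi.
by rewrite mulmxDl -!scalemxAl scalerBr opprD addrACA /eapp subrr add0r.
Qed.

Lemma Pf_congr_l X X' Y q : U q -> svf X -> svf X' -> svf Y ->
  (forall r, U r -> X r = X' r) -> Pf X Y q = Pf X' Y q.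
Proof.
move=> Uq sX sX' sY h; rewrite /Pf (nabla_congr_l ac lc Uq sX sX' (svf_phi sY) h).
by rewrite (nabla_congr_l ac lc Uq sX sX' sY h).
Qed.

Lemma Pf_congr_r X Y Y' q : U q -> svf X -> svf Y -> svf Y' ->
  (forall r, U r -> Y r = Y' r) -> Pf X Y q = Pf X Y' q.
Proof.
move=> Uq sX sY sY' h; rewrite /Pf (nabla_congr_r ac lc Uq sX sY sY' h).
rewrite (nabla_congr_r ac lc Uq sX (svf_phi sY) (svf_phi sY')) //.
by move=> r Ur; rewrite /eapp h.
Qed.

Lemma Pf_pt X Y q : U q -> svf X -> svf Y -> Pf X Y q = Pt q (X q) (Y q).
Proof.
move=> Uq sX sY.
have sv := svf_ev ac (tcoord c q (X q)).
rewrite (tensor_pt ac (T := fun X => Pf X Y q) Uq) //; first last.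
- by move=> *; exact: Pf_scalel.
- by move=> *; exact: Pf_addl.
- by move=> *; exact: Pf_congr_l.
apply: (tensor_pt ac (T := fun Y => Pf _ Y q)) => //.
- by move=> *; exact: Pf_congr_r.
- by move=> *; exact: Pf_addr.
- by move=> *; exact: Pf_scaler.
Qed.

Lemma At_pt X a q : U q -> svf X -> nabla X (xi a) q = At q a (X q).
Proof. by move=> Uq sX; apply: (nabla_pt ac lc Uq sX); exact: svf_xi. Qed.

Lemma bapp_const_vder X a b q : U q -> vd X (bapp g (xi a) (xi b)) q = 0.
Proof.
move=> Uq; rewrite -(vder_cst ac X (sg a * (a == b)%:R) Uq).
by congr (vd X _ q); apply/funext => r; rewrite bappE (f_xi (frame r)).
Qed.

Lemma vder_eta X Y a q : U q -> svf X -> svf Y ->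
  vd X (fapp (eta a) Y) q = sg a * (ip (g q) (nabla X (xi a) q) (Y q) +
    ip (g q) (xi a q) (nabla X Y q)).
Proof.
move=> Uq sX sY; rewrite -(nabla_metric lc Uq sX (svf_xi a) sY).
have -> : fapp (eta a) Y = fun r => sg a * bapp g (xi a) Y r.
  by apply/funext => r; exact: fappE.
rewrite (vderM ac _ Uq (sfun_cst ac (sg a)) (sfun_g (svf_xi a) sY)).
by rewrite (vder_cst ac _ _ Uq) mulr0 addr0.
Qed.

Lemma ext_der_ev v w a q : U q -> ext_der (eta a) (ev v) (ev w) q =
  2^-1 * (vd (ev v) (fapp (eta a) (ev w)) q - vd (ev w) (fapp (eta a) (ev v)) q).
Proof.
move=> Uq; rewrite /ext_der -vdE; congr (_ * _).
have -> : fapp (eta a) (bracket (ev v) (ev w)) q = 0; last exact: subr0.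
by rewrite /fapp (bracket_ev ac v w Uq) mul0mx mxE.
Qed.

Lemma ext_der_ev' X Y v w a q : U q -> ev v = X -> ev w = Y ->
  ext_der (eta a) X Y q = 2^-1 * (vd X (fapp (eta a) Y) q - vd Y (fapp (eta a) X) q).
Proof. by move=> Uq <- <-; exact: ext_der_ev. Qed.

Lemma contact X Y a q : U q -> svf X -> svf Y ->
  ext_der (eta a) X Y q = bapp g X (eapp phi Y) q.
Proof. by move=> Uq [sX] [sY]; exact: (lS_contact hM a oU sX sY Uq). Qed.

Let cK q x : U q -> ev (tcoord c q x) q = x.
Proof. by move=> Uq; rewrite evE; exact: tvecK. Qed.

Lemma evP q x : U q -> exists X, [/\ svf X, X q = x & ev (tcoord c q x) = X].
Proof.
by move=> Uq; exists (ev (tcoord c q x)); split=> //; [exact: svf_ev | exact: cK].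
Qed.

Lemma ev_sym q x y X Y : U q -> ev (tcoord c q x) = X -> ev (tcoord c q y) = Y ->
  nabla X Y q = nabla Y X q.
Proof. by move=> Uq <- <-; exact: (nabla_ev_sym ac lc). Qed.

Lemma T_contact q a x y : U q ->
  ip (g q) (At q a x) y - ip (g q) (At q a y) x =
  2 * sg a * ip (g q) x (y *m phi q).
Proof.
move=> Uq; have [X [sX Xq XE]] := evP x Uq; have [Y [sY Yq YE]] := evP y Uq.
have := ext_der_ev' a Uq XE YE.
rewrite (contact a Uq sX sY) (vder_eta a Uq sX sY) (vder_eta a Uq sY sX).
rewrite (At_pt a Uq sX) (At_pt a Uq sY) Xq Yq bappE eappE Xq Yq.
rewrite (ev_sym Uq XE YE) => ->.
have := sg2 a => s2.
transitivity ((sg a * sg a) * (ip (g q) (At q a x) y - ip (g q) (At q a y) x)).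
  by rewrite s2 mul1r.
by field.
Qed.

Lemma T_unit q a b x : U q ->
  ip (g q) (At q a x) (xi b q) + ip (g q) (xi a q) (At q b x) = 0.
Proof.
move=> Uq; have sX := svf_ev ac (tcoord c q x).
by have := nabla_metric lc Uq sX (svf_xi a) (svf_xi b); rewrite bapp_const_vder.
Qed.

Lemma g_skew q x y : ip (g q) (x *m phi q) y = - ip (g q) x (y *m phi q).
Proof. exact: (f_skew (frame q)). Qed.

Lemma Pt_Pf q x y X Y : U q -> svf X -> svf Y -> X q = x -> Y q = y -> Pt q x y = Pf X Y q.
Proof. by move=> Uq sX sY <- <-; rewrite Pf_pt. Qed.

Lemma skew_alg q py pz ny nz y z :
  - (ip (g q) ny (z *m phi q) + ip (g q) y (pz + nz *m phi q)) =
  ip (g q) (py + ny *m phi q) z + ip (g q) (y *m phi q) nz ->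
  ip (g q) py z + ip (g q) y pz = 0.
Proof. by rewrite !ipE !g_skew; lra. Qed.

Lemma T_skew q x y z : U q -> ip (g q) (Pt q x y) z + ip (g q) y (Pt q x z) = 0.
Proof.
move=> Uq; have [X [sX Xq XE]] := evP x Uq; have [Y [sY Yq YE]] := evP y Uq.
have [Z [sZ Zq ZE]] := evP z Uq.
have h1 := nabla_metric lc Uq sX (svf_phi sY) sZ.
have h2 := nabla_metric lc Uq sX sY (svf_phi sZ).
have e : bapp g (eapp phi Y) Z = fun r => - bapp g Y (eapp phi Z) r.
  by apply/funext => r; rewrite !bappE /eapp g_skew.
rewrite e (vderN ac _ Uq (sfun_g sY (svf_phi sZ))) h2 !nabla_phi !eappE Yq Zq in h1.
by rewrite (Pt_Pf Uq sX sY Xq Yq) (Pt_Pf Uq sX sZ Xq Zq); exact: skew_alg h1.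
Qed.

Lemma vd_contact vA vB vC q : U q ->
  vd (ev vA) (bapp g (ev vB) (eapp phi (ev vC))) q = 2^-1 *
    (vd (ev vA) (vd (ev vB) (fapp (eta t) (ev vC))) q -
     vd (ev vA) (vd (ev vC) (fapp (eta t) (ev vB))) q).
Proof.
move=> Uq; have sA := svf_ev ac vA; have sB := svf_ev ac vB; have sC := svf_ev ac vC.
have s1 := sfun_vder ac sB (sfun_eta t sC).
have s2 := sfun_vder ac sC (sfun_eta t sB).
have s3 := sfun_mul ac (sfun_cst ac (-1)) s2.
have s4 := sfun_add ac s1 s3.
have e r : U r -> 2^-1 * (vd (ev vB) (fapp (eta t) (ev vC)) r +
    -1 * vd (ev vC) (fapp (eta t) (ev vB)) r) = bapp g (ev vB) (eapp phi (ev vC)) r.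
  by move=> Ur; rewrite -(contact t Ur sB sC) (ext_der_ev _ _ _ Ur) mulN1r.
rewrite -(vder_congr ac _ Uq (sfun_mul ac (sfun_cst ac 2^-1) s4) e).
rewrite (vderM ac _ Uq (sfun_cst ac _) s4) (vder_cst ac _ _ Uq) mulr0 addr0.
rewrite (vderD ac _ Uq s1 s3) (vderM ac _ Uq (sfun_cst ac _) s2) (vder_cst ac _ _ Uq).
by rewrite mulr0 addr0 mulN1r.
Qed.

Lemma vd_contact' X Y Z vA vB vC q : U q -> ev vA = X -> ev vB = Y -> ev vC = Z ->
  vd X (bapp g Y (eapp phi Z)) q =
  2^-1 * (vd X (vd Y (fapp (eta t) Z)) q - vd X (vd Z (fapp (eta t) Y)) q).
Proof. by move=> Uq <- <- <-; exact: vd_contact. Qed.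

(** This is [d Phi = d (d eta) = 0]: the second derivatives of [eta t] cancel in the cyclic sum
    because coordinate fields commute. *)
Lemma T_closed q x y z : U q ->
  ip (g q) y (Pt q x z) + ip (g q) z (Pt q y x) + ip (g q) x (Pt q z y) = 0.
Proof.
move=> Uq; have [X [sX Xq XE]] := evP x Uq; have [Y [sY Yq YE]] := evP y Uq.
have [Z [sZ Zq ZE]] := evP z Uq.
have h1 := vd_contact' Uq XE YE ZE; have h2 := vd_contact' Uq YE ZE XE.
have h3 := vd_contact' Uq ZE XE YE.
have cm A B (vA vB : 'rV[R]_N) C : svf C -> ev vA = A -> ev vB = B ->
    vd A (vd B (fapp (eta t) C)) q = vd B (vd A (fapp (eta t) C)) q.
  by move=> sC <- <-; exact: (vder_comm ac _ _ Uq (sfun_eta t sC)).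
have c1 := cm X Y _ _ Z sZ XE YE; have c2 := cm Y Z _ _ X sX YE ZE.
have c3 := cm Z X _ _ Y sY ZE XE.
rewrite (nabla_metric lc Uq sX sY (svf_phi sZ)) nabla_phi in h1.
rewrite (nabla_metric lc Uq sY sZ (svf_phi sX)) nabla_phi in h2.
rewrite (nabla_metric lc Uq sZ sX (svf_phi sY)) nabla_phi in h3.
have n1 := ev_sym Uq XE YE; have n2 := ev_sym Uq YE ZE; have n3 := ev_sym Uq ZE XE.
have sk u v : ip (g q) u (v *m phi q) = - ip (g q) v (u *m phi q).
  by rewrite ip_sym g_skew.
rewrite (Pt_Pf Uq sX sZ Xq Zq) (Pt_Pf Uq sY sX Yq Xq) (Pt_Pf Uq sZ sY Zq Yq).
move: h1 h2 h3; rewrite !eappE Xq Yq Zq !ipDr -n1 -n2 -n3.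
rewrite (sk (nabla X Y q)) (sk (nabla Y Z q)) (sk (nabla Z X q)) c1 c2 c3.
move: (vd Y (vd X _) q) (vd Z (vd Y _) q) (vd X (vd Z _) q) => d1 d2 d3.
lra.
Qed.

Lemma vec_move (a b d p1 p2 : 'rV[R]_N) : - a + b = p1 + (p2 + (- a + d)) ->
  p1 + p2 = b - d.
Proof.
move=> h; apply/rowP => i; have := congr1 (fun A : 'rV[R]_N => A 0 i) h.
by rewrite !mxE; lra.
Qed.

(** The covariant derivative of the formula for [phi^2]. *)
Lemma T_phi2 q x y : U q -> Pt q x (y *m phi q) + Pt q x y *m phi q =
  \sum_a sg a *: (ip (g q) (At q a x) y *: xi a q + ip (g q) y (xi a q) *: At q a x).
Proof.
move=> Uq; have [X [sX Xq XE]] := evP x Uq; have [Y [sY Yq YE]] := evP y Uq.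
have e : eapp phi (eapp phi Y) = fun r => - Y r + \sum_a fapp (eta a) Y r *: xi a r.
  apply/funext => r; rewrite /eapp (f_phi2 (frame r)); congr (_ + _).
  by apply: eq_bigr => a _; rewrite fappE bappE ip_sym.
have h := nabla_phi X (eapp phi Y) q.
rewrite (nabla_phi X Y q) mulmxDl (f_phi2 (frame q)) in h.
have sa a : svf (fun r => fapp (eta a) Y r *: xi a r).
  by apply: (svf_scale ac); [exact: sfun_eta | exact: svf_xi].
rewrite e (nablaDr lc Uq sX (svf_opp ac sY) (svf_sum ac _ sa)) in h.
rewrite (nablaN ac lc Uq sX sY) (nabla_sum ac lc _ Uq sX sa) in h.
rewrite (Pf_pt Uq sX (svf_phi sY)) (Pf_pt Uq sX sY) Xq {1}/eapp Yq in h.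
rewrite (vec_move h) -sumrB; apply: eq_bigr => a _.
rewrite (nablaM lc Uq (sfun_eta a sY) sX (svf_xi a)) (vder_eta a Uq sX sY) fappE bappE.
rewrite (At_pt a Uq sX) Xq Yq; have s2 := sg2 a.
rewrite (ip_sym _ y) (ip_sym _ (nabla X Y q)).
by apply/rowP => i; rewrite !mxE; ring.
Qed.

Lemma torsion X Y q : U q -> svf X -> svf Y -> bracket X Y q = nabla X Y q - nabla Y X q.
Proof. by move=> Uq [sX] [sY]; rewrite (lc_torsion_free lc oU sX sY Uq). Qed.

Lemma nijE X Y q : U q -> svf X -> svf Y -> bracket X Y q = 0 -> nijenhuis phi X Y q =
  nabla (eapp phi X) (eapp phi Y) q - nabla (eapp phi Y) (eapp phi X) q
  - (nabla (eapp phi X) Y q - nabla Y (eapp phi X) q) *m phi q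
  - (nabla X (eapp phi Y) q - nabla (eapp phi Y) X q) *m phi q.
Proof.
move=> Uq sX sY b0; have pX := svf_phi sX; have pY := svf_phi sY.
rewrite -(torsion Uq pX pY) -(torsion Uq pX sY) -(torsion Uq sX pY).
by rewrite /nijenhuis /eapp b0 !mul0mx add0r.
Qed.

Lemma vec_normal (F : 'M[R]_N) (a1 a2 b1 b2 k f1 f2 f3 : 'rV[R]_N) :
  a1 + f1 *m F - (a2 + f2 *m F) - (f1 - (b1 + f3 *m F)) *m F
    - (b2 + f3 *m F - f2) *m F + k = 0 ->
  a1 - a2 + b1 *m F - b2 *m F + k = 0.
Proof.
rewrite !mulmxBl !mulmxDl; move: (f1 *m F) (f2 *m F) (b1 *m F) (b2 *m F) (f3 *m F *m F).
move=> F1 F2 B1 B2 F3 h; apply/rowP => i.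
by have := congr1 (fun A : 'rV[R]_N => A 0 i) h; rewrite !mxE; lra.
Qed.

Lemma T_normal q x y : U q ->
  Pt q (x *m phi q) y - Pt q (y *m phi q) x + Pt q y x *m phi q - Pt q x y *m phi q
    + (2 * ip (g q) x (y *m phi q)) *: xibar (fun a => xi a q) = 0.
Proof.
move=> Uq; have [X [sX Xq XE]] := evP x Uq; have [Y [sY Yq YE]] := evP y Uq.
have pX := svf_phi sX; have pY := svf_phi sY.
have h := lS_normal hM oU (svfW sX) (svfW sY) Uq.
have e : \sum_a ext_der (eta a) X Y q *: xi a q =
    ip (g q) x (y *m phi q) *: xibar (fun a => xi a q).
  rewrite /xibar scaler_sumr; apply: eq_bigr => a _.
  by rewrite contact // bappE eappE Xq Yq.
have b0 : bracket X Y q = 0 by rewrite -XE -YE; exact: (bracket_ev ac _ _ Uq).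
rewrite e scalerA (nijE Uq sX sY b0) !nabla_phi in h.
rewrite (Pf_pt Uq pX sY) (Pf_pt Uq pY sX) (Pf_pt Uq sX sY) (Pf_pt Uq sY sX) in h.
rewrite (eappE phi X q) (eappE phi Y q) Xq Yq (ev_sym Uq YE XE) in h.
exact: (vec_normal h).
Qed.

Lemma T_phixi q x a : U q -> Pt q x (xi a q) + At q a x *m phi q = 0.
Proof.
move=> Uq; have sX := svf_ev ac (tcoord c q x); have sa := svf_xi a.
have h := nabla_phi (ev (tcoord c q x)) (xi a) q.
have e : eapp phi (xi a) = fun=> 0.
  by apply/funext => r; rewrite /eapp (f_xiF (frame r)).
have Xq : ev (tcoord c q x) q = x by exact: cK.
by rewrite e (nabla0r ac lc Uq sX) (Pf_pt Uq sX sa) Xq in h; rewrite [RHS]h.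
Qed.

Lemma tensors q : U q -> S_tensors (g q) (phi q) (fun a => xi a q) sg
  (At q) (Pt q).
Proof.
move=> Uq; split.
- move=> a k x y; rewrite /At (tcoord_lin ac Uq); apply: (nabla_evlin ac lc) => //.
  exact: svf_xi.
- move=> k x y z; rewrite /Pt (tcoord_lin ac Uq).
  have sZ := svf_ev ac (tcoord c q z).
  apply: (tensor_lin ac (T := fun X => Pf X _ q)).
  + by move=> *; exact: Pf_congr_l.
  + by move=> *; exact: Pf_addl.
  + by move=> *; exact: Pf_scalel.
- by move=> a x y; exact: T_contact.
- by move=> a b x; exact: T_unit.
- by move=> x y z; exact: T_skew.
- by move=> x y z; exact: T_closed.
- by move=> x y; exact: T_phi2.
- by move=> x y; exact: T_normal.
- by move=> x a; exact: T_phixi.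
Qed.

Lemma nabla_xi X a q : U q -> svf X -> nabla X (xi a) q = - sg a *: (X q *m phi q).
Proof. by move=> Uq sX; rewrite At_pt // (A_eq (frame q) (tensors Uq)). Qed.

Lemma Pf_eq X Y q : U q -> svf X -> svf Y ->
  Pf X Y q = covphi (g q) (phi q) (fun a => xi a q) (X q) (Y q).
Proof. by move=> Uq sX sY; rewrite Pf_pt // (P_eq (frame q) (tensors Uq)). Qed.

End Connection.

End SManifold.

(** * Curvature on coordinate fields *)

Section Curvature.
Context {R : realType} {N s : nat} (M : manifold R N).
Context (phi : endofield M) (xi : 'I_s -> vfield M) (eta : 'I_s -> oneform M).
Context (g : bilfield M) (t : 'I_s).
Context (hM : lorentzian_S_manifold phi xi eta g t).
Context (c : chart R N M) (ac : @atlas _ _ M c).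
Context (nabla : vfield M -> vfield M -> vfield M) (lc : levi_civita g nabla).
Let U := cdom c.
Local Notation sfun := (sfun c).
Local Notation svf := (svf c).
Local Notation ev := (ev c).
Local Notation sg := (@sg R s t).
Implicit Types (X Y Z : vfield M) (q r : M) (x y z v w : 'rV[R]_N).

(** The bracket term is absent because [ev v] and [ev w] commute. *)
Definition curv v w Z q :=
  nabla (ev v) (nabla (ev w) Z) q - nabla (ev w) (nabla (ev v) Z) q.

Let nsv v Z : svf Z -> svf (nabla (ev v) Z).
Proof. by move=> sZ; apply: (svf_nabla lc) => //; exact: svf_ev. Qed.

Lemma curv_congr v w Z Z' q : U q -> svf Z -> svf Z' ->
  (forall r, U r -> Z r = Z' r) -> curv v w Z q = curv v w Z' q.
Proof.
move=> Uq sZ sZ' h; have e a r : U r -> nabla (ev a) Z r = nabla (ev a) Z' r.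
  by move=> Ur; exact: (nabla_congr_r ac lc Ur (svf_ev ac a) sZ sZ' h).
have k a b : nabla (ev a) (nabla (ev b) Z) q = nabla (ev a) (nabla (ev b) Z') q.
  exact: (nabla_congr_r ac lc Uq (svf_ev ac a) (nsv b sZ) (nsv b sZ') (e b)).
by rewrite /curv !k.
Qed.

Lemma curv_add v w Z Z' q : U q -> svf Z -> svf Z' ->
  curv v w (fun r => Z r + Z' r) q = curv v w Z q + curv v w Z' q.
Proof.
move=> Uq sZ sZ'.
have k a b : nabla (ev a) (nabla (ev b) (fun r => Z r + Z' r)) q =
    nabla (ev a) (nabla (ev b) Z) q + nabla (ev a) (nabla (ev b) Z') q.
  rewrite -(nablaDr lc Uq (svf_ev ac a) (nsv b sZ) (nsv b sZ')).
  apply: (nabla_congr_r ac lc Uq (svf_ev ac a)).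
  - by apply: nsv; exact: svf_add.
  - by apply: (svf_add ac); exact: nsv.
  - by move=> r Ur; exact: (nablaDr lc Ur (svf_ev ac b)).
by rewrite /curv !k opprD addrACA.
Qed.

Lemma curv_scale v w f Z q : U q -> sfun f -> svf Z ->
  curv v w (fun r => f r *: Z r) q = f q *: curv v w Z q.
Proof.
move=> Uq sf sZ.
have k a b : nabla (ev a) (nabla (ev b) (fun r => f r *: Z r)) q =
    vd (ev a) (vd (ev b) f) q *: Z q + vd (ev b) f q *: nabla (ev a) Z q +
    (vd (ev a) f q *: nabla (ev b) Z q + f q *: nabla (ev a) (nabla (ev b) Z) q).
  have sv := sfun_vder ac (svf_ev ac b) sf.
  rewrite -(nablaM lc Uq sv (svf_ev ac a) sZ).
  rewrite -(nablaM lc Uq sf (svf_ev ac a) (nsv b sZ)).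
  rewrite -(nablaDr lc Uq (svf_ev ac a) (svf_scale ac sv sZ) (svf_scale ac sf (nsv b sZ))).
  apply: (nabla_congr_r ac lc Uq (svf_ev ac a)).
  - by apply: nsv; exact: svf_scale.
  - by apply: (svf_add ac); apply: (svf_scale ac) => //; exact: nsv.
  - by move=> r Ur; exact: (nablaM lc Ur sf (svf_ev ac b)).
rewrite /curv !k (vder_comm ac v w Uq sf); apply/rowP => i; rewrite !mxE; ring.
Qed.

Lemma curv_pt v w Z q : U q -> svf Z ->
  curv v w Z q = curv v w (ev (tcoord c q (Z q))) q.
Proof.
move=> Uq sZ; apply: (tensor_pt ac (T := fun Z => curv v w Z q)) => //.
- by move=> *; exact: curv_congr.
- by move=> *; exact: curv_add.
- by move=> *; exact: curv_scale.
Qed.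

Lemma curv_ev_lin v w a z z' q : U q ->
  curv v w (ev (a *: z + z')) q = a *: curv v w (ev z) q + curv v w (ev z') q.
Proof.
move=> Uq; apply: (tensor_lin ac (T := fun Z => curv v w Z q)) => //.
- by move=> *; exact: curv_congr.
- by move=> *; exact: curv_add.
- by move=> *; exact: curv_scale.
Qed.

Lemma curv_skew v w Z q : curv v w Z q = - curv w v Z q.
Proof. by rewrite /curv opprB. Qed.

Lemma curv_linl a v v' w Z q : U q -> svf Z ->
  curv (a *: v + v') w Z q = a *: curv v w Z q + curv v' w Z q.
Proof.
move=> Uq sZ; rewrite /curv (nabla_evlin ac lc _ _ _ Uq (nsv w sZ)).
have -> : nabla (ev w) (nabla (ev (a *: v + v')) Z) q =
    a *: nabla (ev w) (nabla (ev v) Z) q + nabla (ev w) (nabla (ev v') Z) q.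
  have s1 := svf_scale ac (sfun_cst ac a) (nsv v sZ).
  rewrite -(nabla_cst ac lc a Uq (svf_ev ac w) (nsv v sZ)).
  rewrite -(nablaDr lc Uq (svf_ev ac w) s1 (nsv v' sZ)).
  apply: (nabla_congr_r ac lc Uq (svf_ev ac w)).
  - exact: nsv.
  - by apply: (svf_add ac) => //; exact: nsv.
  - by move=> r Ur; exact: (nabla_evlin ac lc).
by apply/rowP => i; rewrite !mxE; ring.
Qed.

Lemma curv_bianchi u v w q : U q ->
  curv u v (ev w) q + curv v w (ev u) q + curv w u (ev v) q = 0.
Proof.
move=> Uq; have k a b d : nabla (ev a) (nabla (ev b) (ev d)) q =
    nabla (ev a) (nabla (ev d) (ev b)) q.
  have sb := svf_ev ac b; have sd := svf_ev ac d.
  apply: (nabla_congr_r ac lc Uq (svf_ev ac a) (nsv b sd) (nsv d sb)).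
  by move=> r Ur; exact: (nabla_ev_sym ac lc).
rewrite /curv (k u v w) (k v w u) (k w u v).
by apply/rowP => i; rewrite !mxE; ring.
Qed.

Lemma curv_metric v w Y Z q : U q -> svf Y -> svf Z ->
  ip (g q) (curv v w Y q) (Z q) + ip (g q) (Y q) (curv v w Z q) = 0.
Proof.
move=> Uq sY sZ.
have sb Y' Z' : svf Y' -> svf Z' -> sfun (bapp g Y' Z').
  by move=> *; exact: (sfun_g hM ac).
have k a b : vd (ev a) (vd (ev b) (bapp g Y Z)) q =
    ip (g q) (nabla (ev a) (nabla (ev b) Y) q) (Z q)
    + ip (g q) (nabla (ev b) Y q) (nabla (ev a) Z q)
    + (ip (g q) (nabla (ev a) Y q) (nabla (ev b) Z q)
    + ip (g q) (Y q) (nabla (ev a) (nabla (ev b) Z) q)).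
  have s1 := sb _ _ (nsv b sY) sZ; have s2 := sb _ _ sY (nsv b sZ).
  rewrite -(nabla_metric lc Uq (svf_ev ac a) (nsv b sY) sZ).
  rewrite -(nabla_metric lc Uq (svf_ev ac a) sY (nsv b sZ)).
  rewrite -(vderD ac (ev a) Uq s1 s2); apply/esym.
  apply: (vder_congr ac _ Uq (sfun_add ac s1 s2)) => r Ur.
  by rewrite (nabla_metric lc Ur (svf_ev ac b) sY sZ).
have := vder_comm ac v w Uq (sb _ _ sY sZ); rewrite !k /curv !ipE.
by move=> h; lra.
Qed.

(** Differentiate [nabla_X xi_a = - e_a phi X] again: the terms in the second derivative of
    coordinates and the symmetric part of [covphi] cancel. *)
Lemma curv_xi v w a q : U q -> curv v w (xi a) q = - sg a *:
  (ip (g q) (ev w q) (xibar (fun a => xi a q)) *: (ev v q *m phi q *m phi q)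
   - ip (g q) (ev v q) (xibar (fun a => xi a q)) *: (ev w q *m phi q *m phi q)).
Proof.
move=> Uq.
have k b d : nabla (ev b) (nabla (ev d) (xi a)) q = - sg a *:
    (covphi (g q) (phi q) (fun a => xi a q) (ev b q) (ev d q) + nabla (ev b) (ev d) q *m phi q).
  have sb := svf_ev ac b; have sd := svf_ev ac d; have pd := svf_phi hM ac sd.
  rewrite -(Pf_eq hM ac lc Uq sb sd) -nabla_phi.
  rewrite -(nabla_cst ac lc _ Uq sb pd).
  apply: (nabla_congr_r ac lc Uq sb).
  - by apply: nsv; exact: (svf_xi hM ac).
  - by apply: (svf_scale ac) => //; exact: sfun_cst.
  - by move=> r Ur; rewrite (nabla_xi hM ac lc a Ur sd).
rewrite /curv !k -scalerBr (nabla_ev_sym ac lc v w Uq) /covphi.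
rewrite (ip_sym hM _ (ev w q *m _)).
by congr (_ *: _); apply/rowP => i; rewrite !mxE; ring.
Qed.

Definition sigma : R := \sum_a sg a.

Let xb r : 'rV[R]_N := xibar (fun a => xi a r).

Let svf_xb : svf xb.
Proof. by apply: (svf_sum ac) => a; exact: (svf_xi hM ac). Qed.

Lemma nabla_xibar v q : U q -> nabla (ev v) xb q = - sigma *: (ev v q *m phi q).
Proof.
move=> Uq; rewrite /xb /xibar (nabla_sum ac lc _ Uq (svf_ev ac v) (svf_xi hM ac)).
rewrite /sigma -sumrN scaler_suml; apply: eq_bigr => a _.
exact: (nabla_xi hM ac lc a Uq (svf_ev ac v)).
Qed.

Local Notation horiz q := (horizontal (g q) (fun a => xi a q)).

(** The field [(nabla_Y phi) Z], in the form given by [P_eq], ready to be differentiated. *)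
Let Tf Y Z r : 'rV[R]_N :=
  bapp g (eapp phi Y) (eapp phi Z) r *: xb r
  + bapp g Z xb r *: eapp phi (eapp phi Y) r.

Let svf_Tf Y Z : svf Y -> svf Z -> svf (Tf Y Z).
Proof.
move=> sY sZ; have pY := svf_phi hM ac sY; have pZ := svf_phi hM ac sZ.
apply: (svf_add ac); apply: (svf_scale ac) => //; try exact: (sfun_g hM ac).
exact: (svf_phi hM ac).
Qed.

Lemma ip_diff (G : 'M[R]_N) (n1 n2 t1 t2 c1 c2 u : 'rV[R]_N) :
  ip G (n1 + (t1 + c1) - (n2 + (t2 + c2))) u - ip G (c1 - c2) u =
  ip G n1 u + ip G t1 u - (ip G n2 u + ip G t2 u).
Proof. by rewrite !ipE; ring. Qed.

Let Tf_nabla v w Z q u : U q -> svf Z -> horiz q (Z q) -> horiz q (ev w q) -> horiz q u ->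
  ip (g q) (nabla (ev v) (Tf (ev w) Z) q) u =
    - sigma * ip (g q) (ev w q) (Z q) * ip (g q) (ev v q *m phi q) u
    - (ip (g q) (nabla (ev v) Z q) (xb q)
       - sigma * ip (g q) (Z q) (ev v q *m phi q)) * ip (g q) (ev w q) u.
Proof.
move=> Uq sZ hZ hw hu; have sv := svf_ev ac v; have sw := svf_ev ac w.
have pw := svf_phi hM ac sw; have pZ := svf_phi hM ac sZ.
have ppw := svf_phi hM ac pw.
have f1 := sfun_g hM ac pw pZ; have f2 := sfun_g hM ac sZ svf_xb.
rewrite /Tf (nablaDr lc Uq sv (svf_scale ac f1 svf_xb) (svf_scale ac f2 ppw)).
rewrite (nablaM lc Uq f1 sv svf_xb) (nablaM lc Uq f2 sv ppw).
rewrite (nabla_metric lc Uq sv sZ svf_xb) (nabla_xibar v Uq).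
rewrite !bappE (horizontal_xb hZ) scale0r addr0 !eappE.
rewrite (horizontal_FF (frame hM q) hw) (f_skew (frame hM q)) (horizontal_FF (frame hM q) hZ) !ipE.
have -> : ip (g q) (xb q) u = 0 by rewrite (ip_sym hM) horizontal_xb.
by ring.
Qed.

(** The Ricci identity for [phi]. The factor [sigma] comes from the derivative of [xibar], which is
    [- sigma phi]; horizontality discards the terms along [xibar]. *)
Lemma curv_phi v w Z q u : U q -> svf Z -> horiz q (Z q) -> horiz q (ev v q) ->
  horiz q (ev w q) -> horiz q u ->
  ip (g q) (curv v w (eapp phi Z) q) u - ip (g q) (curv v w Z q *m phi q) u =
  sigma * (ip (g q) (ev v q) (Z q) * ip (g q) (ev w q *m phi q) u
           - ip (g q) (ev w q) (Z q) * ip (g q) (ev v q *m phi q) u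
           + ip (g q) (Z q) (ev v q *m phi q) * ip (g q) (ev w q) u
           - ip (g q) (Z q) (ev w q *m phi q) * ip (g q) (ev v q) u).
Proof.
move=> Uq sZ hZ hv hw hu.
have k a b : nabla (ev a) (nabla (ev b) (eapp phi Z)) q =
    nabla (ev a) (Tf (ev b) Z) q
    + (covphi (g q) (phi q) (fun a => xi a q) (ev a q) (nabla (ev b) Z q)
       + nabla (ev a) (nabla (ev b) Z) q *m phi q).
  have sa := svf_ev ac a; have sb := svf_ev ac b; have pZ := svf_phi hM ac sZ.
  have nb := nsv b sZ; have pn := svf_phi hM ac nb.
  rewrite -(Pf_eq hM ac lc Uq sa nb) -nabla_phi.
  rewrite -(nablaDr lc Uq sa (svf_Tf sb sZ) pn).
  apply: (nabla_congr_r ac lc Uq sa).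
  - exact: nsv.
  - by apply: (svf_add ac) => //; exact: svf_Tf.
  - by move=> r Ur; rewrite nabla_phi (Pf_eq hM ac lc Ur sb sZ).
have xbu : ip (g q) (xb q) u = 0 by rewrite (ip_sym hM) horizontal_xb.
have Tu b (y : 'rV[R]_N) : horiz q (ev b q) ->
    ip (g q) (covphi (g q) (phi q) (fun a => xi a q) (ev b q) y) u =
    - ip (g q) y (xb q) * ip (g q) (ev b q) u.
  by move=> hb; rewrite /covphi !ipE xbu (horizontal_FF (frame hM q) hb) mulr0 add0r ipNl mulrN mulNr.
rewrite /curv !k mulmxBl ip_diff (Tu v _ hv) (Tu w _ hw).
rewrite (Tf_nabla v Uq sZ hZ hw hu) (Tf_nabla w Uq sZ hZ hv hu).
by ring.
Qed.

End Curvature.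

(** * From multiplicities to the two cases *)

Lemma eigenvalueE (R : fieldType) n (A : 'M[R]_n) a :
  eigenvalue A a = (0 < \rank (eigenspace A a))%N.
Proof. by rewrite lt0n mxrank_eq0. Qed.

Lemma eigenvalue_dichotomy (R : realType) m n (A : 'M[R]_n) :
  (exists c : R, forall a, \rank (eigenspace A a) = ((a == c) * (4 * m + 1))%N) \/
  (exists c1 c2 : R, c1 <> c2 /\
     forall a, \rank (eigenspace A a) = ((a == c1) + (a == c2) * (4 * m))%N) ->
  (one_eigenvalue (4 * m + 1) A /\ ~ two_eigenvalues 1 (4 * m) A) \/
  (~ one_eigenvalue (4 * m + 1) A /\ two_eigenvalues 1 (4 * m) A).
Proof.
have one c : (forall a, \rank (eigenspace A a) = ((a == c) * (4 * m + 1))%N) ->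
    one_eigenvalue (4 * m + 1) A /\ ~ two_eigenvalues 1 (4 * m) A.
  move=> h; have ev a : eigenvalue A a <-> a = c.
    by rewrite eigenvalueE h addn1; case: eqP.
  split; first by exists c; split=> //; rewrite h eqxx mul1n.
  move=> [c1 [c2 [/eqP c12 ev2 _ _]]]; apply: c12.
  have /ev -> : eigenvalue A c1 by apply/ev2; left.
  by have /ev -> : eigenvalue A c2 by apply/ev2; right.
case=> [[c /one]|[c1 [c2 [c12 h]]]]; first by left.
(* For [m = 0] the second value has multiplicity 0 and is no eigenvalue, so this falls under the
   first case. *)
have [m0|m0] := posnP m.
  left; apply: (one c1) => a; by rewrite h m0 !muln0 addn0 add0n muln1.
have ev a : eigenvalue A a <-> a = c1 \/ a = c2.
  rewrite eigenvalueE h; case: eqP => [->|n1]; first by split=> //; left.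
  case: eqP => [->|n2]; last by split=> // - [].
  by rewrite mul1n; split=> [_|_]; [right | rewrite muln_gt0].
right; split.
  move=> [c [ev1 _]]; apply: c12.
  have /ev1 -> : eigenvalue A c1 by apply/ev; left.
  by have /ev1 -> : eigenvalue A c2 by apply/ev; right.
exists c1, c2; split=> //; first exact/eqP.
  by rewrite h eqxx (_ : c1 == c2 = false) //; apply/eqP.
by rewrite h eqxx (_ : c2 == c1 = false) ?mul1n //; apply/eqP => e; apply: c12.
Qed.

(** * The curvature tensor at the given point *)

Section Point.
Context {R : realType} {N s : nat} (M : manifold R N).
Context (phi : endofield M) (xi : 'I_s -> vfield M) (eta : 'I_s -> oneform M).
Context (g : bilfield M) (t : 'I_s).
Context (hM : lorentzian_S_manifold phi xi eta g t).
Context (nabla : vfield M -> vfield M -> vfield M) (lc : levi_civita g nabla).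
Context (p : M).
Let c := chart_at p.
Let ac : @atlas _ _ M c := chart_at_atlas p.
Let Up : cdom c p := chart_at_dom p.
Local Notation K := (curvature_at nabla p).

Lemma tcoord_at v : tcoord c p v = v.
Proof.
rewrite /tcoord -/c -[RHS](derive_id (cmap c p) v); apply: near_eq_derive.
apply: (near_U (P := fun x => (cmap c \o cinv c) x = x) Up) => r Ur /=.
by rewrite cmapK.
Qed.

Lemma ev_at v : ev c v p = v.
Proof. by rewrite evE -[v in tvec c v]tcoord_at (tvecK ac). Qed.

Lemma curvature_curv x y z : K x y z = curv c nabla x y (ev c z) p.
Proof.
have -> : ev c = tvec c by rewrite /ev unlock.
rewrite /curvature_at /curvature /curv -/c.
have -> : ev c = tvec c by rewrite /ev unlock.
rewrite -[RHS]subr0; congr (_ - _).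
have e : tvec c = ev c by rewrite /ev unlock.
rewrite e; have sz := svf_ev ac z.
have b0 r : cdom c r -> bracket (ev c x) (ev c y) r = 0 by move=> Ur; exact: (bracket_ev ac).
have s0 := svf_zero ac.
have sb : svf c (bracket (ev c x) (ev c y)).
  by apply: (svf_congr ac _ s0) => r Ur; rewrite b0.
rewrite (nabla_congr_l ac lc Up sb s0 sz b0).
have := nablaZl lc Up (sfun_cst ac 0) s0 sz; rewrite !scale0r.
by [].
Qed.

Lemma curvature_tensor : S_curv (g p) (phi p) (fun a => xi a p) (@sg R s t) K (@sigma R s t).
Proof.
have xb_at := ev_at.
split.
- by move=> a x x' y z; rewrite !curvature_curv (curv_linl ac lc) //; exact: svf_ev.
- by move=> a x y z z'; rewrite !curvature_curv (curv_ev_lin ac lc).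
- by move=> x y z; rewrite !curvature_curv curv_skew.
- by move=> x y z; rewrite !curvature_curv (curv_bianchi ac lc).
- move=> x y z w; rewrite !curvature_curv.
  have := curv_metric hM ac lc x y Up (svf_ev ac z) (svf_ev ac w).
  by rewrite !ev_at.
- move=> x y a; rewrite curvature_curv.
  have := curv_pt ac lc x y Up (svf_xi hM ac a); rewrite tcoord_at => <-.
  by rewrite (curv_xi hM ac lc) // !ev_at.
- move=> x y z w hx hy hz hw; rewrite !curvature_curv.
  have h := @curv_phi _ _ _ _ _ _ _ _ _ hM _ ac _ lc x y (ev c z) p w Up (svf_ev ac z).
  rewrite !ev_at in h; rewrite -h //.
  have sz := svf_phi hM ac (svf_ev ac z).
  have := curv_pt ac lc x y Up sz; rewrite tcoord_at eappE ev_at => ->.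
  by rewrite (f_skew (frame hM p)) opprK.
Qed.

(** The image of [phi] is orthogonal to the timelike [xi t], so the metric is positive definite on
    it. *)
Lemma phi_basis : exists E : 'M[R]_(\rank (phi p), N),
  E *m g p *m E^T = 1%:M /\ (E :=: phi p)%MS.
Proof.
have hf := frame hM p.
have [sG _] := lS_lorentzian hM p.
apply: orthonormal_basis => // v /submxP[w vE] v0.
apply: (lorentzian_pos (v := xi t p) (lS_lorentzian hM p)) => //.
  by rewrite (f_xi hf) eqxx mulr1 /sg eqxx ltrN10.
by rewrite vE (Fxi hf).
Qed.

End Point.

(** * The null Osserman condition on the slice *)

Section Osserman.
Context {R : realType} {n N s m : nat} (M : manifold R N).
Context (phi : endofield M) (xi : 'I_s.+1 -> vfield M) (eta : 'I_s.+1 -> oneform M).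
Context (g : bilfield M) (t : 'I_s.+1).
Context (hM : lorentzian_S_manifold phi xi eta g t).
Context (nabla : vfield M -> vfield M -> vfield M) (lc : levi_civita g nabla).
Context (p : M) (hOss : phi_null_osserman phi xi g nabla t p).
Context (nm : n = (4 * m + 2)%N) (Nn : N = (n + s.+1)%N).
Context (E : 'M[R]_(n, N)) (EE : E *m g p *m E^T = 1%:M) (EF : (E :=: phi p)%MS).

Let hf := frame hM p.
Let hK := curvature_tensor hM lc p.
Let k := kslice (g p) (curvature_at nabla p) (@sigma R s.+1 t) E.
Let eE a : @sg R s.+1 t a = if a == t then -1 else 1. Proof. by []. Qed.

Lemma null_congruence_slice (x0 : 'rV[R]_n) : dot x0 x0 = 1 ->
  null_congruence phi xi g t p (xi t p + x0 *m E).
Proof.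
move=> x01; exists (x0 *m E) => //; split; first by rewrite -EF submxMl.
by rewrite -/(ip (g p) _ _) (ipE_dot EE).
Qed.

(** The shift by [sigma + 1] and the all-ones block are common to all null vectors, so they drop out
    of the comparison. *)
Lemma slice_isospectral : isospectral k.
Proof.
move=> x u x1 u1 a; pose b := @sigma R s.+1 t + 1.
have [r [P [rn PP PK]]] := slice_basis x1.
have [r' [P' [rn' PP' PK']]] := slice_basis u1.
rewrite (rank_Kmx hf hK EE EF x1 rn PP PK) (rank_Kmx hf hK EE EF u1 rn' PP' PK').
have := hOss (null_congruence_slice x1) (null_congruence_slice u1) (a + b).
rewrite (jacobi_bar_rank hf hK EE EF eE Nn x1 rn PP PK (a + b)).
rewrite (jacobi_bar_rank hf hK EE EF eE Nn u1 rn' PP' PK' (a + b)).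
by rewrite addrK => /addIn ->.
Qed.

Lemma jacobi_phi_dichotomy u : null_congruence phi xi g t p u ->
  let A := jacobi_phi phi xi g nabla t p u in
  (one_eigenvalue (4 * m + 1) A /\ ~ two_eigenvalues 1 (4 * m) A) \/
  (~ one_eigenvalue (4 * m + 1) A /\ two_eigenvalues 1 (4 * m) A).
Proof.
move=> [x [xF x1] ->] A; rewrite {}/A; move: xF; rewrite -EF => /submxP[x0 xE].
subst x; have x01 : dot x0 x0 = 1 by rewrite -(ipE_dot EE).
have [r [P [rn PP PK]]] := slice_basis x01.
have := isospectral_type nm (cstr2 hf EE EF) (cstrT hf EE EF)
  (kslice_kaehler hf hK EE EF) slice_isospectral x01.
pose b := @sigma R s.+1 t + 1 => h; apply: eigenvalue_dichotomy.
(* The extra unit at [a = b] is [x0] itself, on which its own Jacobi operator vanishes;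
   [osserman_type] counts it too, so it cancels. *)
have rk a : ((a - b == 0)%R + \rank (eigenspace (jacobi_phi phi xi g nabla t p
    (xi t p + x0 *m E)) a))%N = \rank (eigenspace (Kmx k x0) (a - b)).
  rewrite (rank_Kmx hf hK EE EF x01 rn PP PK); congr (_ + _)%N.
  exact: (jacobi_phi_rank hf hK EE EF eE x01 PP PK a).
have n1 : (n - 1 = 4 * m + 1)%N by rewrite nm addn2 subn1 addn1.
have n2 : (n - 2 = 4 * m)%N by rewrite nm addnK.
case: h => [[c0 h]|[c1 [c2 [c12 h]]]]; [left|right].
  exists (c0 + b) => a; apply: (@addnI (a - b == 0)%R).
  by rewrite rk h n1 (subr_eq a c0 b).
exists (c1 + b), (c2 + b); split=> [/addIr //|a]; apply: (@addnI (a - b == 0)%R).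
by rewrite rk h n2 (subr_eq a c1 b) (subr_eq a c2 b) addnA.
Qed.

End Osserman.

Theorem proposition3p6 (R : realType) (m s : nat) (hs : (1 <= s)%N)
  (M : manifold R (4 * m + 2 + s)) (phi : endofield M)
  (xi : 'I_s -> vfield M) (eta : 'I_s -> oneform M) (g : bilfield M)
  (hM : lorentzian_S_manifold phi xi eta g (Ordinal hs))
  (hrank : forall q : M, \rank (phi q) = (4 * m + 2)%N)
  (nabla : vfield M -> vfield M -> vfield M) (hnabla : levi_civita g nabla)
  (p : M) (hOss : phi_null_osserman phi xi g nabla (Ordinal hs) p) :
  forall u : 'rV[R]_(4 * m + 2 + s),
    null_congruence phi xi g (Ordinal hs) p u ->
    let A := jacobi_phi phi xi g nabla (Ordinal hs) p u in
    (one_eigenvalue (4 * m + 1) A /\ ~ two_eigenvalues 1 (4 * m) A) \/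
    (~ one_eigenvalue (4 * m + 1) A /\ two_eigenvalues 1 (4 * m) A).
Proof.
case: s hs M phi xi eta g hM hrank nabla hnabla p hOss => [//|s] hs M phi xi eta g.
move=> hM hrank nabla hnabla p hOss.
have [E [EE EF]] := phi_basis hM p.
by apply: (jacobi_phi_dichotomy hM hnabla hOss (hrank p) _ EE EF); rewrite hrank.
Qed.
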